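(* Let $Q \subset \mathbb{R}^2$ be a simple (i.e. non self-intersecting) quadrilateral with sides $F_1, F_2, F_3, F_4$ such that one diagonal of $Q$ intersects the other diagonal in its middle (i.e. at the midpoint of that other diagonal). Let $f$ be a solution of the Dirichlet eigenvalue problem $(\Delta + \lambda) f = 0$ in $Q$, $f = 0$ on $\partial Q$, normalized by $\|f\|_{L^2(Q)} = 1$. Then there exists a point $p \in \mathbb{R}^2$ such that the signed areas $\operatorname{Vol}_2^*(C_i(p))$, $i = 1, \dots, 4$, are all equal, and $$\sum_{i=1}^4 \frac{\int_{F_i} |\partial_\nu f|^2 \, dV}{\operatorname{Vol}_1(F_i)} = \frac{4\lambda}{\operatorname{Vol}_2(Q)}.$$
   Context: $\Delta$ is the Laplacian $\partial_{x_1}^2 + \partial_{x_2}^2$. $\partial_\nu f$ is the outward pointing normal derivative of $f$ on the sides, $\nu$ being the outward unit normal to $Q$ (constant, equal to $\nu_i$, on each $F_i$), and $dV$ is the length measure on $F_i$. The diagonals are the segments joining opposite vertices of $Q$. $C_i(p)$ denotes the triangle with base the side $F_i$ and apex $p$. $\operatorname{Vol}_2^*(C_i(p))$ is its signed area: its absolute value is the area of $C_i(p)$ and its sign is the sign of $-v\cdot\nu_i$, where $v$ is any vector from a point of the base $F_i$ to the apex $p$. $\operatorname{Vol}_1(F_i)$ is the length of $F_i$ and $\operatorname{Vol}_2(Q)$ is the area of $Q$. *)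

(* Defs.v *)
(* The plane is R * R, for an arbitrary realType R. *)
From HB Require Import structures.
From mathcomp Require Import all_boot all_order all_algebra.
From mathcomp Require Import all_classical all_reals all_analysis.

Set Implicit Arguments.
Unset Strict Implicit.
Unset Printing Implicit Defensive.

Import Order.TTheory GRing.Theory Num.Theory.
Import numFieldNormedType.Exports.

Local Open Scope classical_set_scope.
Local Open Scope ring_scope.

Notation plane R := (R * R)%type.

Definition dotp (R : realType) (u w : plane R) : R := u.1 * w.1 + u.2 * w.2.

(* The norm that the library puts on [R * R] is the max norm, so the Euclidean
   one has to be introduced; both induce the same topology. *)
Definition enorm (R : realType) (u : plane R) : R := Num.sqrt (dotp u u).

Definition segment (R : realType) (a b : plane R) : set (plane R) :=
  [set a + t *: (b - a) | t in `[0, 1]].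

Definition open_segment (R : realType) (a b : plane R) : set (plane R) :=
  [set a + t *: (b - a) | t in `]0, 1[].

Definition midpoint (R : realType) (a b : plane R) : plane R :=
  2^-1 *: (a + b).

Definition triangle (R : realType) (a b p : plane R) : set (plane R) :=
  [set x | exists s t : R, [/\ 0 <= s, 0 <= t, s + t <= 1 &
                               x = a + s *: (b - a) + t *: (p - a)]].

Definition lebesgue2 (R : realType) :
    {measure set (measurableTypeR R * measurableTypeR R) -> \bar R} :=
  (@lebesgue_measure R \x @lebesgue_measure R)%E.

Definition area (R : realType) (A : set (plane R)) : R := fine (lebesgue2 R A).

(* A quadrilateral is given by its vertices in cyclic order. Indices are added
   in 'I_4, i.e. modulo 4. *)
Definition quad_side (R : realType) (v : 'I_4 -> plane R) (i : 'I_4) :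
    set (plane R) :=
  segment (v i) (v (i + 1)).

Definition side_length (R : realType) (v : 'I_4 -> plane R) (i : 'I_4) : R :=
  enorm (v (i + 1) - v i).

(* [quad_diagonal v i] and [quad_diagonal v (i + 2)] are the same diagonal. *)
Definition quad_diagonal (R : realType) (v : 'I_4 -> plane R) (i : 'I_4) :
    set (plane R) :=
  segment (v i) (v (i + 2)).

Definition quad_boundary (R : realType) (v : 'I_4 -> plane R) : set (plane R) :=
  \bigcup_i quad_side v i.

Definition simple_quadrilateral (R : realType) (v : 'I_4 -> plane R) : Prop :=
  [/\ injective v,
      forall i, quad_side v i `&` quad_side v (i + 1) = [set v (i + 1)] &
      forall i, quad_side v i `&` quad_side v (i + 2) = set0].

(* The open region enclosed by the polygonal line [quad_boundary v]: the bounded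
   part of its complement, as given by the Jordan curve theorem. *)
Definition quad_region (R : realType) (v : 'I_4 -> plane R) : set (plane R) :=
  [set x | ~ quad_boundary v x /\
           bounded_set (connected_component (~` quad_boundary v) x)].

Definition outward_unit_normal (R : realType) (v : 'I_4 -> plane R) (i : 'I_4)
    (n : plane R) : Prop :=
  [/\ enorm n = 1,
      dotp n (v (i + 1) - v i) = 0 &
      forall x, open_segment (v i) (v (i + 1)) x ->
        \forall t \near 0^'+,
          quad_region v (x - t *: n) /\ ~ quad_region v (x + t *: n)].

(* [n] is normal to the base [a, b], so that [dotp (p - x) n] is the same for
   all points x of the base; a is used. *)
Definition signed_area (R : realType) (a b n p : plane R) : R :=
  Num.sg (- dotp (p - a) n) * area (triangle a b p).

Definition partial1 (R : realType) (f : plane R -> R) : plane R -> R :=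
  fun x => 'D_((1, 0) : plane R) f x.

Definition partial2 (R : realType) (f : plane R -> R) : plane R -> R :=
  fun x => 'D_((0, 1) : plane R) f x.

(* Meant for open U. *)
Definition C1_on (R : realType) (U : set (plane R)) (f : plane R -> R) : Prop :=
  forall x, U x ->
    [/\ derivable f x (1, 0), derivable f x (0, 1),
        {for x, continuous (partial1 f)} & {for x, continuous (partial2 f)}].

Definition C2_on (R : realType) (U : set (plane R)) (f : plane R -> R) : Prop :=
  [/\ C1_on U f, C1_on U (partial1 f) & C1_on U (partial2 f)].

Definition laplacian (R : realType) (f : plane R -> R) : plane R -> R :=
  fun x => partial1 (partial1 f) x + partial2 (partial2 f) x.

(* Classical solutions; the values of f outside the closed quadrilateral play
   no role. *)
Definition dirichlet_solution (R : realType) (v : 'I_4 -> plane R) (lambda : R)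
    (f : plane R -> R) : Prop :=
  [/\ C2_on (quad_region v) f,
      {within quad_region v `|` quad_boundary v, continuous f},
      forall x, quad_region v x -> laplacian f x + lambda * f x = 0 &
      forall x, quad_boundary v x -> f x = 0].

(* One-sided derivative along the outward direction [n], using only the values
   of f at points x + h n with h < 0, on the inner side. *)
Definition normal_derivative (R : realType) (f : plane R -> R) (n x : plane R) :
    R :=
  lim ((h^-1 * (f (x + h *: n) - f x)) @[h --> 0^'-]).

(* Integral with respect to length, in the parametrization of the side with
   constant speed [side_length v i]. *)
Definition side_integral (R : realType) (v : 'I_4 -> plane R) (i : 'I_4)
    (g : plane R -> R) : \bar R :=
  ((side_length v i)%:E *
   \int[@lebesgue_measure R]_(t in `[0%R, 1%R])
      (g (v i + t *: (v (i + 1) - v i))%R)%:E)%E.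

(* Main.v *)
(* Let [p] be the midpoint of the diagonal that bisects the other one: the four
   triangles with apex [p] have the same signed area [K / 2], up to orientation.
   With [X = x - p], Rellich's vector field
   [2 (X . grad f) grad f + (lambda f^2 - |grad f|^2) X] has divergence
   [2 lambda f^2]. On the side [F_i], where [f = 0], its normal component is
   [(X . nu_i) |d_nu f|^2], and [X . nu_i] is the constant [|K| / Vol_1(F_i)],
   so that the flux through the boundary is [|K|] times the sum in the theorem.
   As [2 |K|] is the area of the quadrilateral, this is the claim.

   Since [f] is only continuous up to the boundary, the identity is first
   integrated over the copy of the quadrilateral shrunk about [p] by a factor
   [S < 1], triangle by triangle in the coordinates [p + s (A + t B)], where the
   fluxes through the rays from [p] to the vertices cancel. Then [S] tends to
   [1] by dominated convergence, for which the gradient has to be bounded and to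
   converge at the relative interior of the sides. Both follow from the maximum
   principle with quadratic barriers: [f] is bounded by the distance to each
   side, which bounds the gradient through an interior estimate, and near a side
   the same applies to the tangential difference quotients of [f], whence the
   gradient is Lipschitz up to that side. *)
Require Import Defs.
From HB Require Import structures.
From mathcomp Require Import all_boot all_order all_algebra.
From mathcomp Require Import all_classical all_reals all_analysis.
From mathcomp Require Import measurable_realfun ring lra.

Set Implicit Arguments.
Unset Strict Implicit.
Unset Printing Implicit Defensive.

Import Order.TTheory GRing.Theory Num.Theory.
Import numFieldNormedType.Exports.

Local Open Scope classical_set_scope.
Local Open Scope ring_scope.

(** * Directional derivatives and the maximum principle *)

(** Everything rests on convexity. The condition on the diagonals makes the quadrilateral an
    intersection of four half-planes, possibly with a straight angle when the diagonal that bisects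
    the other one ends at that midpoint. Hence the distance to the line of a side is affine and
    nonnegative on the whole closed region, and a quadratic polynomial in it is a barrier valid up
    to the vertices. This bounds the gradient uniformly, corners included.

    The obstacle is that [normal_derivative] is a [lim], meaningful only once convergence is proved,
    while a solution of class C2 has no third derivatives: no barrier applies to its tangential
    derivative. A difference quotient solves the same equation, with bounds uniform in the step. The
    equation then converts a bound on the second tangential derivative into one on the second normal
    derivative.

    Quotients by the signed [K] treat both orientations at once. The interior term converges
    monotonically, [f ^+ 2] being nonnegative; domination serves the side terms. *)

Lemma is_derive_along (R : realType) (g : plane R -> R) (y v : plane R) (r d : R) :
  is_derive (y + r *: v) v g d <-> is_derive r 1 (fun h : R => g (y + h *: v)) d.
Proof.
have E : (fun h : R => h^-1 *: (g (h *: v + (y + r *: v)) - g (y + r *: v))) =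
  (fun h : R => h^-1 *: (g (y + (h *: (1 : R^o) + r : R) *: v) - g (y + r *: v))).
  apply/funext => h; congr (_ *: (g _ - _)).
  by rewrite scalerDl addrCA /GRing.scale /= mulr1.
split=> -[df de]; split.
- by move: df; rewrite /derivable E.
- by move: de; rewrite /derive E.
- by move: df; rewrite /derivable -E.
- by move: de; rewrite /derive -E.
Qed.

Lemma is_derive_along0 (R : realType) (g : plane R -> R) (y v : plane R) (d : R) :
  is_derive y v g d <-> is_derive (0 : R) 1 (fun h : R => g (y + h *: v)) d.
Proof. by rewrite -is_derive_along scale0r addr0. Qed.

Lemma is_derive_cvg (R : realType) (g : R -> R) (x d : R) :
  is_derive x 1 g d <-> (fun h => h^-1 * (g (x + h) - g x)) @ 0^' --> d.
Proof.
have E : (fun h : R => h^-1 *: (g (h *: (1 : R^o) + x) - g x)) =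
  (fun h : R => h^-1 * (g (x + h) - g x)).
  by apply/funext => h; rewrite /GRing.scale /= mulr1 (addrC x).
split=> [[df de]|H].
- by rewrite -de /derive E; move: df; rewrite /derivable E.
- split; first by rewrite /derivable E; apply/cvg_ex; exists d.
  by rewrite /derive E; exact: cvg_lim.
Qed.

Lemma is_derive_unique (R : realType) (V : normedModType R) (g : V -> R)
    (x v : V) (a b : R) :
  is_derive x v g a -> is_derive x v g b -> a = b.
Proof. by move=> [_ <-] [_ <-]. Qed.

(** Fermat gives [psi 0 = 0]. If [c < 0], then [psi] is negative just to the right of [0], and the
    mean value theorem puts [phi] below [phi 0] there. *)
Lemma second_derivative_min (R : realType) (phi psi : R -> R) (c eps : R) :
  0 < eps ->
  (forall r : R, `|r| < eps -> is_derive r 1 phi (psi r)) ->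
  is_derive (0 : R) 1 psi c ->
  (forall r : R, `|r| < eps -> phi 0 <= phi r) -> 0 <= c.
Proof.
move=> e0 dphi dpsi minphi.
have [//|c0] := leP 0 c.
have psi0 : psi 0 = 0.
  have d0 : is_derive (0 : R) 1 phi 0.
    apply: (@derive1_at_min _ _ (- eps) eps).
    - lra.
    - move=> x; rewrite in_itv /= => /andP[x1 x2].
      have := dphi x; rewrite ltr_norml x1 x2 => /(_ isT) [] //.
    - by rewrite in_itv /= oppr_lt0 e0.
    - move=> x; rewrite in_itv /= => /andP[x1 x2].
      by apply: minphi; rewrite ltr_norml x1.
  by apply: (is_derive_unique (dphi 0 _) d0); rewrite normr0.
have /is_derive_cvg := dpsi.
move=> /cvgrPdist_lt /(_ (- c)); rewrite oppr_gt0 => /(_ c0).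
rewrite near_withinE => -[/= d d0 Hd].
set m := Num.min d eps / 2.
have m0 : 0 < m by rewrite divr_gt0 // lt_min d0.
have md : m < d.
  by rewrite /m ltr_pdivrMr // (@le_lt_trans _ _ d) ?ge_min ?lexx //; lra.
have me : m < eps.
  by rewrite /m ltr_pdivrMr // (@le_lt_trans _ _ eps) ?ge_min ?lexx ?orbT //; lra.
have neg x : 0 < x -> x <= m -> psi x < 0.
  move=> x0 xm.
  have := Hd x; rewrite /= sub0r normrN gtr0_norm // => /(_ (le_lt_trans xm md)).
  rewrite gt_eqF// => /(_ isT).
  rewrite add0r psi0 subr0 ltr_norml => /andP[+ _].
  have xV : 0 < x^-1 by rewrite invr_gt0.
  by move=> H; have : x^-1 * psi x < 0; [lra|rewrite pmulr_rlt0].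
have [||z] := @MVT _ phi psi 0 m m0.
- by move=> x; rewrite in_itv /= => /andP[x1 x2]; apply: dphi; rewrite gtr0_norm //; lra.
- apply: derivable_within_continuous => x; rewrite in_itv /= => /andP[x1 x2].
  by have [] := dphi x; rewrite ?ger0_norm //; lra.
rewrite in_itv /= => /andP[z0 zm].
have := neg _ z0 (ltW zm).
have := minphi m; rewrite gtr0_norm // => /(_ me).
by nra.
Qed.

(** Clockwise rotation by a right angle: for a unit vector [n], [(perp n, n)] is a positively
    oriented orthonormal frame. *)
Definition perp (R : realType) (n : plane R) : plane R := (n.2, - n.1).

(* The functional Laplacian in the orthonormal frame (perp n, n), given by
   witnesses for the derivatives so that no junk value can occur. *)
Definition has_laplacian (R : realType) (n : plane R) (U : set (plane R))
    (w L : plane R -> R) : Prop :=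
  exists a b a' b' : plane R -> R, forall x, U x ->
    [/\ is_derive x (perp n) w (a x), is_derive x n w (b x),
        is_derive x (perp n) a (a' x), is_derive x n b (b' x) &
        a' x + b' x = L x].

Lemma nbhs_plane (R : realType) (U : set (plane R)) (x v : plane R) :
  open U -> U x -> exists2 eps : R, 0 < eps &
    forall r, `|r| < eps -> U (x + r *: v).
Proof.
move=> oU Ux.
have H : (fun r : R => x + r *: v) r @[r --> (0 : R)] --> x.
  have := @cvgD _ _ _ _ _ _ _ _ _ (cvg_cst x) (@scalel_continuous _ _ v (0 : R)).
  by rewrite scale0r addr0; apply.
have /H /nbhs_ballP[e /= e0 He] : nbhs x U by exact: open_nbhs_nbhs.
by exists e => // r re; apply: (He r); rewrite /ball /= sub0r normrN.
Qed.

(** At a minimum inside [U] both second derivatives along the frame are nonnegative, against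
    [L x < 0]; so the minimum is either nonnegative or impossible. The strict sign is why the
    barriers carry [N + 1] rather than [N]. *)
Lemma maximum_principle (R : realType) (n : plane R) (K U : set (plane R))
    (w L : plane R -> R) :
  compact K -> open U -> U `<=` K -> {within K, continuous w} ->
  has_laplacian n U w L -> (forall x, U x -> L x < 0) ->
  (forall x, K x -> ~ U x -> 0 <= w x) ->
  forall x, K x -> 0 <= w x.
Proof.
move=> cK oU UK cw [a [b [a' [b' dw]]]] L0 bd x Kx.
have K0 : K !=set0 by exists x.
have [c] := compact_EVT_min K0 cK cw.
rewrite inE => Kc cmin.
have cmin' y : K y -> w c <= w y by move=> Ky; apply: cmin; rewrite inE.
apply: le_trans (cmin' _ Kx).
have [Uc|] := pselect (U c); last exact: bd.
exfalso.
have ge0 v (g g' : plane R -> R) : (forall x, U x -> is_derive x v w (g x) /\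
     is_derive x v g (g' x)) -> 0 <= g' c.
  move=> dg.
  have [eps e0 He] := nbhs_plane v oU Uc.
  apply: (@second_derivative_min _ (fun r => w (c + r *: v))
    (fun r => g (c + r *: v)) _ eps e0).
  - by move=> r re; rewrite -is_derive_along; apply: (dg _ (He _ re)).1.
  - by rewrite -is_derive_along0; apply: (dg _ Uc).2.
  - by move=> r re; rewrite scale0r addr0; exact/cmin'/UK/He.
have := L0 _ Uc; have [_ _ _ _ <-] := dw _ Uc.
have : 0 <= a' c by apply: (ge0 (perp n) a) => y /dw[].
have : 0 <= b' c by apply: (ge0 n b) => y /dw[].
lra.
Qed.

Ltac plane_unfold :=
  rewrite ?/dotp ?/perp /=; rewrite ?/GRing.scale /=; rewrite ?/GRing.scale /=.
Ltac plane_ring := plane_unfold; ring.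
Ltac plane_eq := apply: injective_projections; plane_ring.

Lemma dotpDl (R : realType) (u v w : plane R) :
  dotp (u + v) w = dotp u w + dotp v w.
Proof. by rewrite /dotp /=; ring. Qed.

Lemma dotpZl (R : realType) (k : R) (u w : plane R) :
  dotp (k *: u) w = k * dotp u w.
Proof. by rewrite /dotp /= /GRing.scale /=; ring. Qed.

Lemma dotpC (R : realType) (u w : plane R) : dotp u w = dotp w u.
Proof. by rewrite /dotp; ring. Qed.

Lemma dotp_perp (R : realType) (n : plane R) : dotp n (perp n) = 0.
Proof. by rewrite /dotp /perp /=; ring. Qed.

Lemma dotp_perp2 (R : realType) (n : plane R) : dotp (perp n) (perp n) = dotp n n.
Proof. by rewrite /dotp /perp /=; ring. Qed.

Lemma frame_decomposition (R : realType) (n x : plane R) : dotp n n = 1 ->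
  x = dotp x (perp n) *: perp n + dotp x n *: n.
Proof.
rewrite /dotp /perp; case: x n => [x1 x2] [n1 n2] /= n11.
rewrite /GRing.scale /= -[RHS]/(_ + _, _ + _) /=; congr (_, _); by rewrite /GRing.scale /= -[LHS]mulr1 -n11; ring.
Qed.

Lemma is_derive_dotp (R : realType) (x0 u x v : plane R) :
  is_derive x v (fun y => dotp (y - x0) u) (dotp v u).
Proof.
apply/is_derive_along0.
rewrite (_ : (fun _ => _) = (fun h => dotp (x - x0) u + h * dotp v u)); last first.
  by apply/funext => h; plane_ring.
by apply: is_derive_eq; rewrite ?add0r /GRing.scale /=; ring.
Qed.

Lemma dotp_continuous (R : realType) (x0 u : plane R) :
  continuous (fun y : plane R => dotp (y - x0) u).
Proof.
move=> y; rewrite /dotp /=.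
apply: cvgD; apply: cvgMr_tmp; apply: cvgB; try exact: cvg_cst.
- exact: cvg_fst.
- exact: cvg_snd.
Qed.

Lemma has_laplacianD (R : realType) n (U : set (plane R)) w1 w2 L1 L2 :
  has_laplacian n U w1 L1 -> has_laplacian n U w2 L2 ->
  has_laplacian n U (w1 \+ w2) (L1 \+ L2).
Proof.
move=> [a1 [b1 [a1' [b1' H1]]]] [a2 [b2 [a2' [b2' H2]]]].
exists (a1 \+ a2), (b1 \+ b2), (a1' \+ a2'), (b1' \+ b2') => x Ux.
have [A1 B1 C1 D1 E1] := H1 _ Ux.
have [A2 B2 C2 D2 E2] := H2 _ Ux.
split; try exact: is_deriveD.
by rewrite /= -E1 -E2; ring.
Qed.

Lemma has_laplacianZ (R : realType) n (U : set (plane R)) w L (k : R) :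
  has_laplacian n U w L ->
  has_laplacian n U (fun x => k * w x) (fun x => k * L x).
Proof.
move=> [a [b [a' [b' H]]]].
exists (fun x => k * a x), (fun x => k * b x), (fun x => k * a' x), (fun x => k * b' x).
move=> x Ux; have [A B C D E] := H _ Ux.
split; try exact: (@is_deriveZ _ _ _ _ k).
by rewrite /= -E; ring.
Qed.

Lemma has_laplacian_sub (R : realType) n (U V : set (plane R)) w L :
  V `<=` U -> has_laplacian n U w L -> has_laplacian n V w L.
Proof.
by move=> VU [a [b [a' [b' H]]]]; exists a, b, a', b' => x /VU; exact: H.
Qed.

Lemma has_laplacian_eq (R : realType) n (U : set (plane R)) w w' L L' :
  w =1 w' -> (forall x, U x -> L x = L' x) ->
  has_laplacian n U w L -> has_laplacian n U w' L'.
Proof.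
move=> /funext -> LL' [a [b [a' [b' H]]]]; exists a, b, a', b' => x Ux.
by rewrite -LL'//; exact: H.
Qed.

Lemma is_derive_quadratic (R : realType) (f g : plane R -> R) (x v : plane R)
    (A B C df dg : R) : is_derive x v f df -> is_derive x v g dg ->
  is_derive x v (fun y => A * f y ^+ 2 + (B * g y ^+ 2 + C * g y))
    (2 * A * (f x * df) + (2 * B * g x + C) * dg).
Proof.
move=> Hf Hg.
have H := is_deriveD (is_deriveZ A (is_deriveM Hf Hf))
  (is_deriveD (is_deriveZ B (is_deriveM Hg Hg)) (is_deriveZ C Hg)).
rewrite (_ : (fun _ => _) = (A *: (f * f) + (B *: (g * g) + C *: g))).
  by apply: (is_derive_eq H); rewrite /GRing.scale /=; ring.
by apply/funext => y; rewrite !expr2.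
Qed.

Lemma is_derive_affine (R : realType) (f : plane R -> R) (x v : plane R)
    (A B df : R) : is_derive x v f df ->
  is_derive x v (fun y => A * f y + B) (A * df).
Proof.
move=> Hf.
have H := is_deriveD (is_deriveZ A Hf) (is_derive_cst B x v).
by apply: (is_derive_eq H); rewrite addr0.
Qed.

Lemma quadratic_has_laplacian (R : realType) (n x0 : plane R) U (A B C : R) :
  dotp n n = 1 ->
  has_laplacian n U (fun x => A * dotp (x - x0) (perp n) ^+ 2
     + (B * dotp (x - x0) n ^+ 2 + C * dotp (x - x0) n)) (fun=> 2 * A + 2 * B).
Proof.
move=> n1.
exists (fun x => 2 * A * dotp (x - x0) (perp n) + 0),
  (fun x => 2 * B * dotp (x - x0) n + C), (fun=> 2 * A), (fun=> 2 * B) => x _.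
have De u v := is_derive_dotp x0 u x v.
have n0 := dotp_perp n; have n0' := n0; rewrite dotpC in n0'.
have n2 := dotp_perp2 n; rewrite n1 in n2.
split; last by [].
- apply: (is_derive_eq (is_derive_quadratic _ _ _ (De _ _) (De _ _))).
  by rewrite n0' n2; ring.
- apply: (is_derive_eq (is_derive_quadratic _ _ _ (De _ _) (De _ _))).
  by rewrite n0 n1; ring.
- by apply: (is_derive_eq (is_derive_affine _ _ (De _ _))); rewrite n2 mulr1.
- by apply: (is_derive_eq (is_derive_affine _ _ (De _ _))); rewrite n1 mulr1.
Qed.

(** Apply the maximum principle to [psi + w] and [psi - w]: both have Laplacian at most
    [c + N < 0]. *)
Lemma comparison_principle (R : realType) (n : plane R) (K U : set (plane R))
    (w L psi : plane R -> R) (N c : R) :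
  compact K -> open U -> U `<=` K -> {within K, continuous w} ->
  {within K, continuous psi} ->
  has_laplacian n U w L -> (forall x, U x -> `|L x| <= N) ->
  has_laplacian n U psi (fun=> c) -> c < - N ->
  (forall x, K x -> ~ U x -> `|w x| <= psi x) ->
  forall x, K x -> `|w x| <= psi x.
Proof.
move=> cK oU UK cw cpsi lw LN lpsi cN bd x Kx.
rewrite ler_norml; apply/andP; split.
- suff H : 0 <= psi x + w x by lra.
  apply: (@maximum_principle _ n K U (psi \+ w) _ cK oU UK _
    (has_laplacianD lpsi lw)) => //.
  + by move=> y; apply: cvgD; [exact: cpsi|exact: cw].
  + by move=> y Uy /=; have := LN _ Uy; rewrite ler_norml; lra.
  + by move=> y Ky Uy /=; have := bd _ Ky Uy; rewrite ler_norml; lra.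
- suff H : 0 <= psi x + - 1 * w x by lra.
  apply: (@maximum_principle _ n K U (psi \+ (fun x => -1 * w x)) _ cK oU UK _
    (has_laplacianD lpsi (has_laplacianZ (-1) lw))) => //.
  + move=> y; apply: cvgD; [exact: cpsi|].
    by apply: cvgMl_tmp; exact: cw.
  + by move=> y Uy /=; have := LN _ Uy; rewrite ler_norml; lra.
  + by move=> y Ky Uy /=; have := bd _ Ky Uy; rewrite ler_norml; lra.
Qed.

Lemma closed_halfplane (R : realType) (c : R) (x0 u : plane R) :
  closed [set y : plane R | c <= dotp (y - x0) u].
Proof.
exact: ((continuous_closedP _).1 (@dotp_continuous R x0 u) _ (@closed_ge R c)).
Qed.

Lemma open_halfplane (R : realType) (c : R) (x0 u : plane R) :
  open [set y : plane R | c < dotp (y - x0) u].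
Proof.
exact: ((continuousP _).1 (@dotp_continuous R x0 u) _ (@open_gt R c)).
Qed.

Lemma dotpNr (R : realType) (u w : plane R) : dotp u (- w) = - dotp u w.
Proof. by plane_ring. Qed.

Lemma plane_compact (R : realType) (K : set (plane R)) (M : R) :
  closed K -> (forall x, K x -> `|x.1| <= M /\ `|x.2| <= M) -> compact K.
Proof.
move=> cK KM.
apply: (subclosed_compact cK
  (compact_setX (@segment_compact R (- M) M) (@segment_compact R (- M) M))).
by move=> x /KM [H1 H2]; split; rewrite /= in_itv /= -ler_norml.
Qed.

(** * Barriers and the interior gradient estimate *)

Definition half_square (R : realType) (n x0 : plane R) (r : R) :
    set (plane R) :=
  [set x | [/\ `|dotp (x - x0) (perp n)| <= r, 0 <= dotp (x - x0) n &
               dotp (x - x0) n <= r]].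

Definition open_half_square (R : realType) (n x0 : plane R) (r : R) :
    set (plane R) :=
  [set x | [/\ `|dotp (x - x0) (perp n)| < r, 0 < dotp (x - x0) n &
               dotp (x - x0) n < r]].

Lemma open_half_squareW (R : realType) (n x0 : plane R) (r : R) :
  open_half_square n x0 r `<=` half_square n x0 r.
Proof. by move=> x [? ? ?]; split; exact: ltW. Qed.

Lemma frame_coordinates (R : realType) (n x0 x : plane R) : dotp n n = 1 ->
  x = x0 + dotp (x - x0) (perp n) *: perp n + dotp (x - x0) n *: n.
Proof.
move=> n1; rewrite -addrA -frame_decomposition //.
by rewrite addrC subrK.
Qed.

Lemma half_square_compact (R : realType) (n x0 : plane R) (r : R) :
  dotp n n = 1 -> compact (half_square n x0 r).
Proof.
move=> n1.
apply: (@plane_compact _ _ (`|x0.1| + `|x0.2| + `|r| * (`|n.1| + `|n.2|))).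
- rewrite (_ : half_square _ _ _ =
    [set y : plane R | - r <= dotp (y - x0) (perp n)] `&`
    [set y : plane R | - r <= dotp (y - x0) (- perp n)] `&`
    [set y : plane R | 0 <= dotp (y - x0) n] `&`
    [set y : plane R | - r <= dotp (y - x0) (- n)]); last first.
    apply/seteqP; split=> y; rewrite /half_square /= !dotpNr ler_norml !lerN2.
      by move=> [/andP[]].
    by move=> [[[-> ->] ->] ->].
  by do ?apply: closedI; exact: closed_halfplane.
- move=> x [H1 H2 H3].
  have H4 : `|dotp (x - x0) n| <= `|r|.
    by rewrite ger0_norm //; apply: le_trans H3 _; exact: ler_norm.
  have {}H1 := le_trans H1 (ler_norm r).
  have E1 : x.1 = x0.1 + dotp (x - x0) (perp n) * n.2 + dotp (x - x0) n * n.1.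
    by rewrite {1}(frame_coordinates x0 x n1).
  have E2 : x.2 = x0.2 + dotp (x - x0) (perp n) * - n.1 + dotp (x - x0) n * n.2.
    by rewrite {1}(frame_coordinates x0 x n1).
  have T (a b c : R) : `|a + b + c| <= `|a| + `|b| + `|c|.
    by apply: le_trans (ler_normD _ _) _; rewrite lerD2r ler_normD.
  have m1 (a b : R) : `|a| <= `|r| -> `|a * b| <= `|r| * `|b|.
    by move=> H; rewrite normrM ler_wpM2r.
  rewrite E1 E2; split; apply: le_trans (T _ _ _) _.
  + have := m1 _ n.2 H1; have := m1 _ n.1 H4; have := normr_ge0 x0.2; lra.
  + have := m1 _ (- n.1) H1; rewrite normrN.
    have := m1 _ n.2 H4; have := normr_ge0 x0.1; lra.
Qed.

Lemma open_half_square_open (R : realType) (n x0 : plane R) (r : R) :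
  open (open_half_square n x0 r).
Proof.
rewrite (_ : open_half_square _ _ _ =
    [set y : plane R | - r < dotp (y - x0) (perp n)] `&`
    [set y : plane R | - r < dotp (y - x0) (- perp n)] `&`
    [set y : plane R | 0 < dotp (y - x0) n] `&`
    [set y : plane R | - r < dotp (y - x0) (- n)]); last first.
    apply/seteqP; split=> y; rewrite /open_half_square /= !dotpNr ltr_norml !ltrN2.
      by move=> [/andP[]].
    by move=> [[[-> ->] ->] ->].
by do ?apply: openI; exact: open_halfplane.
Qed.

Lemma quadratic_continuous (R : realType) (x0 u n : plane R) (A B C : R) :
  continuous (fun x : plane R => A * dotp (x - x0) u ^+ 2
     + (B * dotp (x - x0) n ^+ 2 + C * dotp (x - x0) n)).
Proof.
move=> x; have cu := @dotp_continuous R x0 u x; have cn := @dotp_continuous R x0 n x.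
apply: cvgD; [|apply: cvgD]; apply: cvgMl_tmp => //.
  by rewrite expr2; apply: cvgM.
by rewrite expr2; apply: cvgM.
Qed.

(* The barrier is [(M/r^2) (a^2 + b (2 r - b)) + (N+1)/2 b (r - b)] in the frame
   coordinates [a], [b]: its first term is harmonic and at least [M] on the
   three sides of the half square where [b != 0]. *)
Lemma half_square_barrier (R : realType) (n x0 : plane R) (r M N : R)
    (w L : plane R -> R) :
  dotp n n = 1 -> 0 < r -> 0 <= M -> 0 <= N ->
  {within half_square n x0 r, continuous w} ->
  has_laplacian n (open_half_square n x0 r) w L ->
  (forall x, open_half_square n x0 r x -> `|L x| <= N) ->
  (forall x, half_square n x0 r x -> `|w x| <= M) ->
  (forall x, half_square n x0 r x -> dotp (x - x0) n = 0 -> w x = 0) ->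
  forall y, 0 <= y -> y <= r ->
    `|w (x0 + y *: n)| <= (2 * M / r + (N + 1) * r / 2) * y.
Proof.
move=> n1 r0 M0 N0 cw lw LN wM w0 y y0 yr.
(* [B] makes the Laplacian [2 * A + 2 * B] equal to [- (N + 1)]; [C] is the slope of the barrier at
   the flat edge. *)
set A := M / r ^+ 2; set B := - A - (N + 1) / 2.
set C := 2 * M / r + (N + 1) * r / 2.
have A0 : 0 <= A by rewrite divr_ge0 // exprn_ge0 // ltW.
have Ar : A * r ^+ 2 = M by rewrite /A divfK // expf_neq0 // gt_eqF.
have CE : C = 2 * (A * r) + (N + 1) * r / 2.
  by rewrite /C; congr (_ + _); rewrite -Ar; field; rewrite gt_eqF.
set psi : plane R -> R := fun x => A * dotp (x - x0) (perp n) ^+ 2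
     + (B * dotp (x - x0) n ^+ 2 + C * dotp (x - x0) n).
have alE : dotp (x0 + y *: n - x0) (perp n) = 0.
  by rewrite -[RHS](mulr0 y) -(dotp_perp n); plane_ring.
have beE : dotp (x0 + y *: n - x0) n = y.
  by rewrite -[RHS]mulr1 -n1; plane_ring.
have : `|w (x0 + y *: n)| <= psi (x0 + y *: n).
  have lpsi : has_laplacian n (open_half_square n x0 r) psi (fun=> 2 * A + 2 * B).
    exact: quadratic_has_laplacian.
  have cpsi : {within half_square n x0 r, continuous psi}.
    by apply: continuous_subspaceT; exact: quadratic_continuous.
  have cmp := comparison_principle (@half_square_compact R n x0 r n1)
     (@open_half_square_open R n x0 r) (@open_half_squareW _ n x0 r) cw cpsi lw LN
     lpsi.
  apply: cmp.
  - by rewrite /B; lra.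
  - move=> x Kx Ux; have [a1 b1 b2] := Kx.
    rewrite /psi.
    have [b0|b0] := eqVneq (dotp (x - x0) n) 0.
      rewrite w0 // b0 normr0 expr0n /= !mulr0 !addr0 mulr_ge0 //.
      by rewrite sqr_ge0.
    apply: le_trans (wM _ Kx) _; rewrite -Ar CE /B.
    have b3 : 0 < dotp (x - x0) n by rewrite lt_neqAle eq_sym b0.
    set a := dotp (x - x0) (perp n) in a1 *.
    set b := dotp (x - x0) n in b1 b2 b3 *.
    have [ar|ar] := ltP `|a| r.
      have -> : b = r.
        apply/eqP; rewrite eq_le b2 /= leNgt; apply/negP => br.
        by apply: Ux; split.
      have := sqr_ge0 a; nra.
    have -> : a ^+ 2 = r ^+ 2.
      have : `|a| = r by apply/le_anti; rewrite a1 ar.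
      by rewrite -(real_normK (num_real a)) => ->.
    have : 0 <= A * (b * (r - b)) by rewrite mulr_ge0 // mulr_ge0 // subr_ge0.
    have : 0 <= (N + 1) * (b * (r - b)).
      by rewrite mulr_ge0 ?addr_ge0 // mulr_ge0 // subr_ge0.
    have : 0 <= A * (b * r) by rewrite mulr_ge0 // mulr_ge0 // ltW.
    lra.
  - split.
    + by rewrite alE normr0 ltW.
    + by rewrite beE.
    + by rewrite beE.
move=> /le_trans; apply.
(* On the normal through [x0] only the terms in the depth [y] remain, and the one in [y ^+ 2] is
   nonpositive. *)
rewrite /psi alE beE expr0n /= mulr0 add0r.
have : 0 <= A * y ^+ 2 by rewrite mulr_ge0 // sqr_ge0.
have : 0 <= (N + 1) * y ^+ 2 by rewrite mulr_ge0 ?sqr_ge0 // addr_ge0.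
rewrite /B; lra.
Qed.

Lemma within_comp_continuous (T1 T2 T3 : topologicalType) (A : set T1)
    (B : set T2) (g : T1 -> T2) (f : T2 -> T3) :
  {within B, continuous f} -> continuous g -> (forall x, A x -> B (g x)) ->
  {within A, continuous (f \o g)}.
Proof.
move=> /subspace_continuousP cf cg AB; apply/subspace_continuousP => x Ax.
apply: (@cvg_comp _ _ _ g f _ (within B (nbhs (g x)))); last exact/cf/AB.
move=> W HW; have H : nbhs x (g @^-1` (fun t => B t -> W t)) by exact: (cg x _ HW).
by apply: (filterS _ H) => y Hy Ay; apply: Hy; exact: AB.
Qed.

Lemma is_derive_le (R : realType) (g : R -> R) (x d C r : R) :
  is_derive x 1 g d -> 0 < r ->
  (forall h, 0 < h -> h <= r -> `|g (x + h) - g x| <= C * h) -> `|d| <= C.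
Proof.
move=> /is_derive_cvg dg r0 H; have [//|Cd] := leP `|d| C.
move: dg => /cvgrPdist_lt /(_ (`|d| - C)); rewrite subr_gt0 => /(_ Cd).
rewrite near_withinE => -[/= e e0 He].
set h := Num.min r (e / 2).
have h0 : 0 < h by rewrite lt_min r0 divr_gt0.
have he : h < e.
  apply: (@le_lt_trans _ _ (e / 2)); first by rewrite ge_min lexx orbT.
  by lra.
have := He h; rewrite /= sub0r normrN gtr0_norm // => /(_ he).
rewrite gt_eqF // => /(_ isT).
have hr : h <= r by rewrite ge_min lexx.
have := H h h0 hr.
set G := g (x + h) - g x => HG.
have : `|h^-1 * G| <= C.
  by rewrite normrM normfV (gtr0_norm h0) ler_pdivrMl // mulrC.
have : `|d| <= `|d - h^-1 * G| + `|h^-1 * G|.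
  by rewrite -{1}(subrK (h^-1 * G) d) ler_normD.
lra.
Qed.

Definition square (R : realType) (n a : plane R) (r : R) : set (plane R) :=
  [set x | `|dotp (x - a) (perp n)| <= r /\ `|dotp (x - a) n| <= r].

Lemma half_square_sub (R : realType) (n a : plane R) (r : R) :
  half_square n a r `<=` square n a r.
Proof. by move=> x [? ? ?]; split => //; rewrite ger0_norm. Qed.

(** Reflection in the line through [a] orthogonal to [n]. *)
Definition mirror (R : realType) (n a x : plane R) : plane R :=
  x - (2 * dotp (x - a) n) *: n.

Lemma dotp_mirror (R : realType) (n a x : plane R) : dotp n n = 1 ->
  dotp (mirror n a x - a) (perp n) = dotp (x - a) (perp n) /\
  dotp (mirror n a x - a) n = - dotp (x - a) n.
Proof.
move=> n1; have E u : dotp (mirror n a x - a) u =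
    dotp (x - a) u - 2 * dotp (x - a) n * dotp n u.
  by rewrite /mirror; plane_ring.
by rewrite !E n1 dotp_perp; split; ring.
Qed.

Lemma mirror_square (R : realType) (n a x : plane R) (r : R) :
  dotp n n = 1 -> square n a r x -> square n a r (mirror n a x).
Proof.
by move=> n1 [? ?]; have [E1 E2] := dotp_mirror a x n1; split; rewrite ?E1 // E2 normrN.
Qed.

Lemma mirror_continuous (R : realType) (n a : plane R) :
  continuous (mirror n a).
Proof.
move=> x; apply: cvgB; first exact: cvg_id.
by apply: cvgZr_tmp; apply: cvgMl_tmp; exact: dotp_continuous.
Qed.

Lemma is_derive_mirror (R : realType) (n a x : plane R) (w : plane R -> R) :
  dotp n n = 1 ->
  (forall d, is_derive (mirror n a x) (perp n) w d ->
     is_derive x (perp n) (w \o mirror n a) d) /\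
  (forall d, is_derive (mirror n a x) n w d ->
     is_derive x n (w \o mirror n a) (- d)).
Proof.
move=> n1; split=> d /is_derive_along0 H; apply/is_derive_along0.
- rewrite [X in is_derive _ _ X _](_ : _ = fun h : R => w (mirror n a x + h *: perp n)) //.
  apply/funext => h /=; congr w; rewrite /mirror.
  have -> : dotp (x + h *: perp n - a) n = dotp (x - a) n by plane_ring.
  by rewrite addrAC.
- rewrite [X in is_derive _ _ X _](_ : _ =
    (fun h : R => w (mirror n a x + h *: n)) \o -%R).
    have := @is_derive1_comp _ (fun h : R => w (mirror n a x + h *: n)) -%R 0 d (-1).
    rewrite oppr0 mulrN1; apply => //.
  apply/funext => h /=; congr w; rewrite /mirror.
  have -> : dotp (x + h *: n - a) n = dotp (x - a) n + h * dotp n n.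
    by plane_ring.
  rewrite n1 mulr1.
  by plane_eq.
Qed.

Lemma has_laplacian_mirror (R : realType) (n a : plane R) (U V : set (plane R))
    (w L : plane R -> R) : dotp n n = 1 ->
  (forall x, V x -> U (mirror n a x)) -> has_laplacian n U w L ->
  has_laplacian n V (w \o mirror n a) (L \o mirror n a).
Proof.
move=> n1 VU [f [g [f' [g' H]]]].
exists (f \o mirror n a), (fun x => -1 * g (mirror n a x)),
  (f' \o mirror n a), (g' \o mirror n a) => x /VU /H [A B C D E].
have [r1 _] := is_derive_mirror a x w n1.
have [_ r2] := is_derive_mirror a x w n1.
have [r3 _] := is_derive_mirror a x f n1.
have [_ r4] := is_derive_mirror a x g n1.
split => //.
- exact: r1.
- by rewrite mulN1r; exact: r2.
- exact: r3.
- by apply: (is_derive_eq (is_deriveZ (-1) (r4 _ D))); rewrite scaleN1r opprK.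
Qed.

(** The odd part of [w] under reflection in the line through [a] vanishes on that line, keeps the
    bounds [M] and [N], and has the same derivative [d] at [a]. So a barrier made for functions
    vanishing on an edge yields an interior estimate. *)
Lemma interior_gradient (R : realType) (n a : plane R) (r M N d : R)
    (w L : plane R -> R) :
  dotp n n = 1 -> 0 < r -> 0 <= M -> 0 <= N ->
  (forall x, square n a r x -> {for x, continuous w}) ->
  has_laplacian n (square n a r) w L ->
  (forall x, square n a r x -> `|w x| <= M) ->
  (forall x, square n a r x -> `|L x| <= N) ->
  is_derive a n w d -> `|d| <= 2 * M / r + (N + 1) * r / 2.
Proof.
move=> n1 r0 M0 N0 cw lw wM LN dw.
set w' : plane R -> R := (fun x => 2^-1 * w x) \+
  (fun x => - 2^-1 * (w \o mirror n a) x).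
set L' : plane R -> R := (fun x => 2^-1 * L x) \+
  (fun x => - 2^-1 * (L \o mirror n a) x).
have half (f : plane R -> R) (C : R) : (forall x, square n a r x -> `|f x| <= C) ->
    forall x, square n a r x ->
    `|2^-1 * f x + - 2^-1 * f (mirror n a x)| <= C.
  move=> H x sx; have := H _ sx; have := H _ (mirror_square n1 sx).
  by rewrite !ler_norml; lra.
have lw' : has_laplacian n (square n a r) w' L'.
  apply: has_laplacianD; apply: has_laplacianZ => //.
  by apply: has_laplacian_mirror lw => // x; exact: mirror_square.
have cw' : {within half_square n a r, continuous w'}.
  apply: continuous_in_subspaceT => x; rewrite inE => /half_square_sub sx.
  apply: cvgD; apply: cvgMl_tmp; first exact: cw.
  apply: continuous_comp; first exact: mirror_continuous.
  by apply: cw; exact: mirror_square.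
have := half_square_barrier n1 r0 M0 N0 cw' (has_laplacian_sub
  (fun x h => half_square_sub (open_half_squareW h)) lw')
  (fun x h => half _ _ LN _ (half_square_sub (open_half_squareW h)))
  (fun x h => half _ _ wM _ (half_square_sub h)).
move=> /(_ _)/wrap[].
  move=> x _ x0; rewrite /w' /= /mirror x0 mulr0 scale0r subr0.
  by rewrite mulNr subrr.
set C := 2 * M / r + _ => HC.
have /is_derive_along0 dw1 := dw.
(* This symmetric difference is twice the odd part of [w] along the normal, which the barrier bounds
   linearly in [h]. *)
have dw2 : is_derive (0 : R) 1 (fun h : R => w (a + h *: n) - w (a + (- h) *: n))
   (d - (- d)).
  apply: is_deriveB.
  have := @is_derive1_comp _ (fun h : R => w (a + h *: n)) -%R 0 d (-1).
  rewrite oppr0 mulrN1; apply => //.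
have : `|d - (- d)| <= 2 * C.
  apply: (is_derive_le dw2 r0) => h h0 hr.
  have := HC h (ltW h0) hr.
  rewrite add0r /w' /= scale0r addr0 oppr0 scale0r addr0 subrr subr0.
  rewrite (_ : mirror n a (a + h *: n) = a + - h *: n).
    by rewrite !ler_norml; lra.
  have E : dotp (a + h *: n - a) n = h * dotp n n by plane_ring.
  by rewrite /mirror E n1 mulr1; plane_eq.
by rewrite !ler_norml; lra.
Qed.

(** * Functions of class C1 and C2 *)

Lemma MVT0 (R : realType) (phi dphi : R -> R) (t : R) :
  (forall r : R, `|r| <= `|t| -> is_derive r 1 phi (dphi r)) ->
  exists2 c, `|c| <= `|t| & phi t - phi 0 = dphi c * t.
Proof.
move=> H; have [t0|t0] := leP 0 t.
- have [||c] := @MVT_segment _ phi dphi 0 t t0.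
  + by move=> x; rewrite in_itv /= => /andP[? ?]; apply: H; rewrite !ger0_norm // ltW.
  + apply: derivable_within_continuous => x; rewrite in_itv /= => /andP[? ?].
    by have [|//] := H x; rewrite !ger0_norm.
  + rewrite in_itv /= subr0 => /andP[? ?] ->; exists c => //.
    by rewrite !ger0_norm.
- have [||c] := @MVT_segment _ phi dphi t 0 (ltW t0).
  + by move=> x; rewrite in_itv /= => /andP[? ?]; apply: H; rewrite !ltr0_norm // lerN2 ltW.
  + apply: derivable_within_continuous => x; rewrite in_itv /= => /andP[? ?].
    by have [|//] := H x; rewrite (ltr0_norm t0) // ler0_norm // lerN2.
  + rewrite in_itv /= sub0r => /andP[? ?] E; exists c.
      by rewrite (ltr0_norm t0) // ler0_norm // lerN2.
    by rewrite -opprB E; ring.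
Qed.

Lemma nbhs_box (R : realType) (P : set (plane R)) (x : plane R) : nbhs x P ->
  exists2 d : R, 0 < d &
    forall a b, `|a| < d -> `|b| < d -> P (x.1 + a, x.2 + b).
Proof.
move=> /nbhs_ballP[d /= d0 H]; exists d => // a b ad bd; apply: H.
by split => /=; rewrite /ball /= opprD addrA subrr sub0r normrN.
Qed.

Lemma nbhs_box_cont (R : realType) (U : set (plane R)) (g : plane R -> R)
    (x : plane R) (e : R) : 0 < e -> open U -> U x -> {for x, continuous g} ->
  exists2 d : R, 0 < d & forall a b, `|a| < d -> `|b| < d ->
    U (x.1 + a, x.2 + b) /\ `|g (x.1 + a, x.2 + b) - g x| < e.
Proof.
move=> e0 oU Ux /cvgrPdist_lt /(_ _ e0) H.
have [|d d0 Hd] := @nbhs_box _ (U `&` [set y | `|g x - g y| < e]) x.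
  by apply: filterI => //; exact: open_nbhs_nbhs.
by exists d => // a b ad bd; have [? ?] := Hd a b ad bd; rewrite distrC.
Qed.

Lemma C1_is_derive1 (R : realType) (U : set (plane R)) (g : plane R -> R)
    (x : plane R) (a b r : R) : C1_on U g -> U (x.1 + (a + r), x.2 + b) ->
  is_derive r 1 (fun r : R => g (x.1 + (a + r), x.2 + b))
    (partial1 g (x.1 + (a + r), x.2 + b)).
Proof.
move=> Cg Ur.
have E (h : R) : (x.1 + a, x.2 + b) + h *: (1, 0) = (x.1 + (a + h), x.2 + b) :> plane R.
  by plane_eq.
have := is_derive_along g (x.1 + a, x.2 + b) (1, 0) r (partial1 g (x.1 + (a + r), x.2 + b)).
rewrite E (_ : (fun h : R => _) = (fun r : R => g (x.1 + (a + r), x.2 + b))).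
  by case=> H _; apply: H; have [d1 _ _ _] := Cg _ Ur; exact: (derivableP d1).
by apply/funext => h; rewrite E.
Qed.

Lemma C1_is_derive2 (R : realType) (U : set (plane R)) (g : plane R -> R)
    (x : plane R) (a b r : R) : C1_on U g -> U (x.1 + a, x.2 + (b + r)) ->
  is_derive r 1 (fun r : R => g (x.1 + a, x.2 + (b + r)))
    (partial2 g (x.1 + a, x.2 + (b + r))).
Proof.
move=> Cg Ur.
have E (h : R) : (x.1 + a, x.2 + b) + h *: (0, 1) = (x.1 + a, x.2 + (b + h)) :> plane R.
  by plane_eq.
have := is_derive_along g (x.1 + a, x.2 + b) (0, 1) r (partial2 g (x.1 + a, x.2 + (b + r))).
rewrite E (_ : (fun h : R => _) = (fun r : R => g (x.1 + a, x.2 + (b + r)))).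
  by case=> H _; apply: H; have [_ d2 _ _] := Cg _ Ur; exact: (derivableP d2).
by apply/funext => h; rewrite E.
Qed.

(* The total derivative is obtained by applying the mean value theorem along
   the two legs of an axis-parallel path from [x] to [x + (a, b)]. *)
Lemma C1_increment (R : realType) (U : set (plane R)) (g : plane R -> R)
    (x : plane R) (e : R) : open U -> C1_on U g -> U x -> 0 < e ->
  exists2 d : R, 0 < d & forall a b, `|a| < d -> `|b| < d ->
    `|g (x.1 + a, x.2 + b) - g x - (partial1 g x * a + partial2 g x * b)|
      <= e * (`|a| + `|b|).
Proof.
move=> oU Cg Ux e0; have [_ _ c1 c2] := Cg _ Ux.
have [d1 d10 H1] := nbhs_box_cont e0 oU Ux c1.
have [d2 d20 H2] := nbhs_box_cont e0 oU Ux c2.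
exists (Num.min d1 d2) => [|a b]; first by rewrite lt_min d10.
rewrite !lt_min => /andP[a1 a2] /andP[b1 b2].
have d10' : `|0 : R| < d1 by rewrite normr0.
have d20' : `|0 : R| < d2 by rewrite normr0.
have [r ra|ca ca1] := @MVT0 _ (fun r => g (x.1 + (0 + r), x.2 + 0))
   (fun r => partial1 g (x.1 + (0 + r), x.2 + 0)) a.
  apply: (C1_is_derive1 Cg); rewrite add0r.
  by apply: (H1 _ _ _ _).1 => //; exact: le_lt_trans ra a1.
have [r ra|cb cb1] := @MVT0 _ (fun r => g (x.1 + a, x.2 + (0 + r)))
   (fun r => partial2 g (x.1 + a, x.2 + (0 + r))) b.
  apply: (C1_is_derive2 Cg); rewrite add0r.
  by apply: (H1 _ _ _ _).1 => //; exact: le_lt_trans ra b1.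
rewrite !add0r !addr0 -!surjective_pairing => Eb Ea.
have [_ Ha] := H1 _ _ (le_lt_trans ca1 a1) d10'; rewrite addr0 in Ha.
have [_ Hb] := H2 _ _ a2 (le_lt_trans cb1 b2).
move: Ea Eb Ha Hb.
move: (g (x.1 + a, x.2 + b)) (g (x.1 + a, x.2)) (g x) => g2 g1 g0.
move: (partial1 g _) (partial1 g x) (partial2 g _) (partial2 g x).
move=> p1 p0 q1 q0 Ea Eb Ha Hb.
have -> : g2 - g0 - (p0 * a + q0 * b) = (p1 - p0) * a + (q1 - q0) * b.
  by rewrite !mulrBl -Ea -Eb; ring.
have le (p q s : R) : `|p - q| < e -> `|(p - q) * s| <= e * `|s|.
  by move=> /ltW H; rewrite normrM ler_wpM2r.
by rewrite mulrDr (le_trans (ler_normD _ _)) // lerD // le.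
Qed.

Lemma C1_is_derive (R : realType) (U : set (plane R)) (g : plane R -> R)
    (x v : plane R) : open U -> C1_on U g -> U x ->
  is_derive x v g (v.1 * partial1 g x + v.2 * partial2 g x).
Proof.
move=> oU Cg Ux; apply/is_derive_along0/is_derive_cvg/cvgrPdist_le => e e0.
set m := `|v.1| + `|v.2| + 1.
have m0 : 0 < m by rewrite ltr_wpDl // addr_ge0.
have [d d0 H] := C1_increment oU Cg Ux (divr_gt0 e0 m0).
rewrite near_withinE; exists (d / m) => /=; first exact: divr_gt0.
move=> h /=; rewrite sub0r normrN => hd h0.
have hm (t : R) : `|t| <= m -> `|h * t| < d.
  move=> tm; rewrite normrM; apply: le_lt_trans (ler_wpM2l (normr_ge0 h) tm) _.
  by rewrite -ltr_pdivlMr.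
have hv1 : `|h * v.1| < d by apply: hm; rewrite /m; have := normr_ge0 v.2; lra.
have hv2 : `|h * v.2| < d by apply: hm; rewrite /m; have := normr_ge0 v.1; lra.
have := H _ _ hv1 hv2; rewrite add0r scale0r addr0.
have -> : x + h *: v = (x.1 + h * v.1, x.2 + h * v.2) by [].
set D := g (_, _) - g x => HD.
have -> : v.1 * partial1 g x + v.2 * partial2 g x - h^-1 * D =
  - (h^-1 * (D - (partial1 g x * (h * v.1) + partial2 g x * (h * v.2)))).
  by field.
rewrite normrN normrM normfV ler_pdivrMl ?normr_gt0 //.
apply: le_trans HD _; rewrite !normrM -mulrDr mulrCA ler_wpM2l //.
rewrite mulrAC ler_pdivrMr // ler_wpM2l ?(ltW e0) //.
by rewrite /m; lra.
Qed.

Lemma C1_continuous (R : realType) (U : set (plane R)) (g : plane R -> R)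
    (x : plane R) : open U -> C1_on U g -> U x -> {for x, continuous g}.
Proof.
move=> oU Cg Ux; apply/cvgrPdist_le => e e0.
have [d d0 H] := C1_increment oU Cg Ux ltr01.
set m := `|partial1 g x| + `|partial2 g x| + 2.
have m0 : 0 < m by rewrite ltr_wpDl // addr_ge0.
have dm0 : 0 < Num.min d (e / m) by rewrite lt_min d0 divr_gt0.
apply: filterS (nbhsx_ballx x _ dm0).
move=> y [] /=; rewrite /ball /= !lt_min => /andP[a1 a2] /andP[b1 b2].
have := H (y.1 - x.1) (y.2 - x.2); rewrite ![`|y.1 - _|]distrC ![`|y.2 - _|]distrC.
move=> /(_ a1 b1); rewrite !(addrC _ (_ - _)) !subrK -surjective_pairing mul1r.
move: a2 b2; rewrite !ltr_pdivlMr //.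
set A := `|x.1 - y.1|; set B := `|x.2 - y.2| => A1 B1 HD.
have A0 : 0 <= A by exact: normr_ge0.
have B0 : 0 <= B by exact: normr_ge0.
move: HD; rewrite -/A -/B.
have N1 : `|partial1 g x * (y.1 - x.1)| = `|partial1 g x| * A.
  by rewrite normrM distrC.
have N2 : `|partial2 g x * (y.2 - x.2)| = `|partial2 g x| * B.
  by rewrite normrM distrC.
move: N1 N2 (normr_ge0 (partial1 g x)) (normr_ge0 (partial2 g x)) A1 B1; rewrite /m.
move: (partial1 g x * _) (partial2 g x * _) `|partial1 g x| `|partial2 g x|.
move: (g x) (g y) A B A0 B0 => gx gy A B A0 B0 p1 p2 q1 q2 N1 N2 n1 n2 A1 B1 HD.
have HH : `|gx - gy| <= `|p1| + `|p2| + (A + B).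
  rewrite distrC -(subrK (p1 + p2) (gy - gx)) addrC.
  by rewrite (le_trans (ler_normD _ _)) // lerD // ler_normD.
apply: le_trans HH _; rewrite N1 N2; have [AB|/ltW AB] := leP A B.
- by have := ler_wpM2l n1 AB; lra.
- by have := ler_wpM2l n2 AB; lra.
Qed.

Definition dir_deriv (R : realType) (v : plane R) (f : plane R -> R) :
    plane R -> R :=
  fun x => v.1 * partial1 f x + v.2 * partial2 f x.

Lemma C2_is_derive (R : realType) (U : set (plane R)) (f : plane R -> R)
    (x u v : plane R) : open U -> C2_on U f -> U x ->
  is_derive x v f (dir_deriv v f x) /\
  is_derive x v (dir_deriv u f)
    (u.1 * dir_deriv v (partial1 f) x + u.2 * dir_deriv v (partial2 f) x).
Proof.
move=> oU [C C1 C2] Ux; split; first exact: C1_is_derive oU C Ux.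
have H1 := C1_is_derive v oU C1 Ux.
have H2 := C1_is_derive v oU C2 Ux.
exact: is_deriveD (is_deriveZ u.1 H1) (is_deriveZ u.2 H2).
Qed.

Lemma C2_has_laplacian (R : realType) (n : plane R) (U : set (plane R))
    (f : plane R -> R) : dotp n n = 1 -> open U -> C2_on U f ->
  has_laplacian n U f (laplacian f).
Proof.
move=> n1 oU Cf.
have H u v x := @C2_is_derive _ U f x u v oU Cf.
pose DD u v x := u.1 * dir_deriv v (partial1 f) x + u.2 * dir_deriv v (partial2 f) x.
exists (dir_deriv (perp n) f), (dir_deriv n f), (DD (perp n) (perp n)), (DD n n).
move=> x Ux; split.
- by have [] := H n (perp n) x Ux.
- by have [] := H n n x Ux.
- by have [] := H (perp n) (perp n) x Ux.
- by have [] := H n n x Ux.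
rewrite /DD /dir_deriv /laplacian /perp /=; move: n1; rewrite /dotp.
move: (partial1 _ _) (partial2 _ _) (partial1 (partial2 _) _) (partial2 (partial2 _) _).
move=> a b c d n1; rewrite -[a + d]mulr1 -n1; ring.
Qed.

(** The second difference of [f] over a square of side [h] is [h * h] times one or the other mixed
    derivative, according to the order of two mean value steps, at points within [h] of [x] in each
    coordinate. Continuity of both at [x] lets them differ by less than any [e]. *)
Lemma mixed_partials (R : realType) (U : set (plane R)) (f : plane R -> R)
    (x : plane R) : open U -> C2_on U f -> U x ->
  partial1 (partial2 f) x = partial2 (partial1 f) x.
Proof.
move=> oU [C C1 C2] Ux; apply/eqP; rewrite -subr_eq0 -normr_le0.
apply/ler_addgt0Pr => e e0; rewrite add0r.
have e20 : 0 < e / 2 by rewrite divr_gt0.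
have [_ _ _ c12] := C1 _ Ux; have [_ _ c21 _] := C2 _ Ux.
have [d1 d10 H1] := nbhs_box_cont e20 oU Ux c12.
have [d2 d20 H2] := nbhs_box_cont e20 oU Ux c21.
set h := Num.min d1 d2 / 2.
have h0 : 0 < h by rewrite divr_gt0 // lt_min d10.
have hd1 : h < d1.
  have : Num.min d1 d2 <= d1; first by rewrite ge_min lexx.
  by rewrite /h; lra.
have hd2 : h < d2.
  have : Num.min d1 d2 <= d2; first by rewrite ge_min lexx orbT.
  by rewrite /h; lra.
have hh : `|h| = h by rewrite gtr0_norm.
have Ubox a b : `|a| <= h -> `|b| <= h -> U (x.1 + a, x.2 + b).
  by move=> ah bh; apply: (H1 _ _ _ _).1; exact: le_lt_trans hd1.
have z0 : `|0 : R| <= h by rewrite normr0 ltW.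
have [r|a ah Ea] := @MVT0 _ (fun r => f (x.1 + (0 + r), x.2 + h) - f (x.1 + (0 + r), x.2 + 0))
  (fun r => partial1 f (x.1 + (0 + r), x.2 + h) - partial1 f (x.1 + (0 + r), x.2 + 0)) h.
  rewrite hh => rh; apply: is_deriveB; apply: (C1_is_derive1 C); rewrite add0r.
    by apply: Ubox => //; rewrite hh.
  exact: Ubox.
have [r|b bh Eb] := @MVT0 _ (fun r => partial1 f (x.1 + a, x.2 + (0 + r)))
  (fun r => partial2 (partial1 f) (x.1 + a, x.2 + (0 + r))) h.
  rewrite hh in ah *; move=> rh; apply: (C1_is_derive2 C1); rewrite add0r.
  exact: Ubox.
have [r|b' bh' Eb'] := @MVT0 _ (fun r => f (x.1 + h, x.2 + (0 + r)) - f (x.1 + 0, x.2 + (0 + r)))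
  (fun r => partial2 f (x.1 + h, x.2 + (0 + r)) - partial2 f (x.1 + 0, x.2 + (0 + r))) h.
  rewrite hh => rh; apply: is_deriveB; apply: (C1_is_derive2 C); rewrite add0r.
    by apply: Ubox => //; rewrite hh.
  exact: Ubox.
have [r|a' ah' Ea'] := @MVT0 _ (fun r => partial2 f (x.1 + (0 + r), x.2 + b'))
  (fun r => partial1 (partial2 f) (x.1 + (0 + r), x.2 + b')) h.
  rewrite hh in bh' *; move=> rh; apply: (C1_is_derive1 C2); rewrite add0r.
  exact: Ubox.
rewrite hh in ah bh ah' bh'.
move: Ea Eb Ea' Eb'; rewrite !add0r !addr0.
have [_] := H1 a b (le_lt_trans ah hd1) (le_lt_trans bh hd1).
have [_] := H2 a' b' (le_lt_trans ah' hd2) (le_lt_trans bh' hd2).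
move: (partial1 (partial2 f) _) (partial1 (partial2 f) _).
move: (partial2 (partial1 f) _) (partial2 (partial1 f) _).
move: (partial1 f _) (partial1 f _) (partial2 f _) (partial2 f _).
move: (f _) (f _) (f _) (f _) => f1 f2 f3 f4 p1 p2 p3 p4 q1 q2 q3 q4.
move=> K1 K2 Ea Eb Ea' Eb'.
(* Both are the same second difference divided by [h * h]. *)
have E : q2 = q4.
  have : (q2 - q4) * (h * h) = 0.
    rewrite [LHS](_ : _ = q2 * h * h - q4 * h * h); last by ring.
    by rewrite -Eb -Ea' -Ea -Eb'; ring.
  move/eqP; rewrite mulf_eq0 subr_eq0 => /orP[/eqP //|].
  by rewrite mulf_eq0 orbb gt_eqF.
rewrite -E in K1; move: K1 K2; rewrite !ltr_norml ler_norml; lra.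
Qed.

(** * Gradient bounds up to the sides of a polygon *)

(** The [n k] point inwards. For a unit vector [n k], [dotp (x - v k) (n k)] is the distance of a
    point [x] of this convex set to the line through [v k] orthogonal to [n k]. *)
Definition polygon (R : realType) (v n : 'I_4 -> plane R) : set (plane R) :=
  [set x | forall k, 0 < dotp (x - v k) (n k)].

Definition closed_polygon (R : realType) (v n : 'I_4 -> plane R) :
    set (plane R) :=
  [set x | forall k, 0 <= dotp (x - v k) (n k)].

(** The setting of all estimates: [v k] only marks a point on the line of a side. It will be applied
    with [n k = - nu k]. *)
Record polygon_solution (R : realType) (v n : 'I_4 -> plane R) (lambda : R)
    (f : plane R -> R) : Prop := PolygonSolution {
  solution_unit : forall k, dotp (n k) (n k) = 1 ;
  solution_compact : compact (closed_polygon v n) ;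
  solution_C2 : C2_on (polygon v n) f ;
  solution_continuous : {within closed_polygon v n, continuous f} ;
  solution_eq : forall x, polygon v n x -> laplacian f x = - lambda * f x ;
  solution_bd : forall x, closed_polygon v n x -> ~ polygon v n x -> f x = 0 }.

Lemma polygonW (R : realType) (v n : 'I_4 -> plane R) :
  polygon v n `<=` closed_polygon v n.
Proof. by move=> x H k; exact: ltW. Qed.

Lemma forall_ord4 (P : 'I_4 -> Prop) : P 0 -> P 1 -> P 2 -> P 3 -> forall k, P k.
Proof.
move=> P0 P1 P2 P3 [[|[|[|[|//]]]] H].
- by rewrite (_ : Ordinal H = 0) //; exact: val_inj.
- by rewrite (_ : Ordinal H = 1) //; exact: val_inj.
- by rewrite (_ : Ordinal H = 2) //; exact: val_inj.
- by rewrite (_ : Ordinal H = 3) //; exact: val_inj.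
Qed.

Lemma polygon_open (R : realType) (v n : 'I_4 -> plane R) : open (polygon v n).
Proof.
pose H k := [set x : plane R | 0 < dotp (x - v k) (n k)].
rewrite (_ : polygon v n = H 0 `&` H 1 `&` H 2 `&` H 3).
  by do ?apply: openI; exact: open_halfplane.
apply/seteqP; split=> x /=; first by move=> h; do !split; exact: h.
by case=> [[[? ?] ?] ?]; exact: forall_ord4.
Qed.

Lemma compact_norm_bound (R : realType) (K : set (plane R)) (g : plane R -> R) :
  compact K -> {within K, continuous g} ->
  exists2 M : R, 0 <= M & forall x, K x -> `|g x| <= M.
Proof.
move=> cK cg; have [K0|K0] := pselect (K !=set0); last first.
  by exists 0 => // x Kx; exfalso; apply: K0; exists x.
have [a _ Ha] := compact_EVT_max K0 cK cg.
have [b _ Hb] := compact_EVT_min K0 cK cg.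
exists (`|g a| + `|g b|); first by rewrite addr_ge0.
move=> x Kx; have := Ha x; have := Hb x; rewrite inE => /(_ Kx) h1 /(_ Kx) h2.
have := ler_norm (g a); have := ler_norm (- g b); rewrite normrN.
have := normr_ge0 (g a); have := normr_ge0 (g b).
rewrite ler_norml; lra.
Qed.

Lemma solution_bounded (R : realType) (v n : 'I_4 -> plane R) lambda f :
  polygon_solution v n lambda f ->
  exists2 M : R, 0 <= M & forall x, closed_polygon v n x -> `|f x| <= M.
Proof.
by move=> S; apply: compact_norm_bound;
  [exact: (solution_compact S)|exact: (solution_continuous S)].
Qed.

Lemma uniform_bound (R : realType) (P : 'I_4 -> R -> Prop) :
  (forall k (a b : R), P k a -> a <= b -> P k b) ->
  (forall k, exists2 a : R, 0 <= a & P k a) ->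
  exists2 a : R, 0 <= a & forall k, P k a.
Proof.
move=> mP /(_ _)/cid2 H; exists (\sum_k s2val (H k)).
  by apply: sumr_ge0 => k _; exact: (s2valP (H k)).
move=> k; apply: (mP k (s2val (H k))); first exact: (s2valP' (H k)).
rewrite (bigD1 k) //= lerDl; apply: sumr_ge0 => j _; exact: (s2valP (H j)).
Qed.

Lemma polygon_height (R : realType) (v n : 'I_4 -> plane R) :
  compact (closed_polygon v n) -> exists2 D : R, 0 <= D &
    forall k x, closed_polygon v n x -> dotp (x - v k) (n k) <= D.
Proof.
move=> cK; apply: uniform_bound => [k a b H ab x /H h|k].
  exact: le_trans ab.
have [|D D0 HD] := @compact_norm_bound _ _ (fun x => dotp (x - v k) (n k)) cK.
  by apply: continuous_subspaceT; exact: dotp_continuous.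
by exists D => // x /HD; apply: le_trans; exact: ler_norm.
Qed.

(** Barrier [(N + 1) / 2 * b * (D - b)] in the distance [b] to the line of the side: it vanishes for
    [b = 0], is nonnegative because [0 <= b <= D] on the closed polygon, and has Laplacian
    [- (N + 1)]. Being global, it covers the vertices as well. *)
Lemma solution_le_dist (R : realType) (v n : 'I_4 -> plane R) lambda f :
  polygon_solution v n lambda f -> exists2 C : R, 0 <= C &
    forall k x, closed_polygon v n x -> `|f x| <= C * dotp (x - v k) (n k).
Proof.
move=> S; have [M M0 HM] := solution_bounded S.
have cK := solution_compact S; have [D D0 HD] := polygon_height cK.
have N0 : 0 <= `|lambda| * M by rewrite mulr_ge0.
set N := `|lambda| * M in N0 *.
exists ((N + 1) / 2 * D); first by rewrite mulr_ge0 // divr_ge0 // addr_ge0.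
move=> k x Kx.
have n1 := solution_unit S k.
set psi : plane R -> R := fun x => 0 * dotp (x - v k) (perp (n k)) ^+ 2 +
  (- ((N + 1) / 2) * dotp (x - v k) (n k) ^+ 2 +
   (N + 1) / 2 * D * dotp (x - v k) (n k)).
have lpsi : has_laplacian (n k) (polygon v n) psi
    (fun=> 2 * 0 + 2 * - ((N + 1) / 2)) by exact: quadratic_has_laplacian.
have cpsi : {within closed_polygon v n, continuous psi}.
  by apply: continuous_subspaceT; exact: quadratic_continuous.
have LN y : polygon v n y -> `|laplacian f y| <= N.
  move=> Uy; rewrite (solution_eq S) // normrM normrN ler_wpM2l //.
  exact/HM/polygonW.
have cmp := comparison_principle cK (@polygon_open R v n) (@polygonW R v n)
  (solution_continuous S) cpsi
  (C2_has_laplacian n1 (@polygon_open R v n) (solution_C2 S)) LN lpsi.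
have : `|f x| <= psi x.
  apply: cmp => //; first by lra.
  move=> y Ky Uy; rewrite (solution_bd S) // normr0 /psi mul0r add0r.
  have := HD k y Ky; have := Ky k; set b := dotp _ _ => b0 bD.
  have : 0 <= (N + 1) * (b * (D - b)).
    by rewrite mulr_ge0 ?addr_ge0 // mulr_ge0 // subr_ge0.
  by lra.
move=> /le_trans; apply; rewrite /psi mul0r add0r gerDr mulNr oppr_le0.
by rewrite mulr_ge0 ?sqr_ge0 // divr_ge0 // addr_ge0.
Qed.

Lemma dotp_unit_le1 (R : realType) (u w : plane R) :
  dotp u u = 1 -> dotp w w = 1 -> `|dotp u w| <= 1.
Proof.
rewrite /dotp => u1 w1; rewrite -(@ler_pXn2r _ 2) ?nnegrE // expr1n.
rewrite real_normK ?num_real //.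
have E : (u.1 * w.1 + u.2 * w.2) ^+ 2 + (u.1 * w.2 - u.2 * w.1) ^+ 2 =
  (u.1 * u.1 + u.2 * u.2) * (w.1 * w.1 + w.2 * w.2) by ring.
rewrite u1 w1 mulr1 in E; rewrite -E lerDl; exact: sqr_ge0.
Qed.

(** The square is tilted with respect to [w], so both of its coordinates contribute; hence the
    factor [2]. *)
Lemma square_dotp_le (R : realType) (u w a y : plane R) (r : R) :
  dotp u u = 1 -> dotp w w = 1 -> square u a r y ->
  `|dotp (y - a) w| <= 2 * r.
Proof.
move=> u1 w1 [h1 h2].
have E z : dotp z w = dotp z (perp u) * dotp (perp u) w + dotp z u * dotp u w.
  by rewrite {1}(frame_decomposition z u1) dotpDl !dotpZl.
rewrite E.
have p1 : dotp (perp u) (perp u) = 1 by rewrite dotp_perp2.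
have := dotp_unit_le1 p1 w1; have := dotp_unit_le1 u1 w1 => k1 k2.
apply: le_trans (ler_normD _ _) _; rewrite !normrM mulrDl !mul1r.
by apply: lerD; rewrite -[leRHS]mulr1 ler_pM.
Qed.

(* A square of size comparable to the distance to the boundary fits in the
   polygon, and [f] is at most linear in that distance there. *)
Lemma solution_gradient_bounded (R : realType) (v n : 'I_4 -> plane R) lambda f :
  polygon_solution v n lambda f -> exists2 L : R, 0 <= L &
    forall u x, dotp u u = 1 -> polygon v n x -> `|dir_deriv u f x| <= L.
Proof.
move=> S; have [M M0 HM] := solution_bounded S.
have [D D0 HD] := polygon_height (solution_compact S).
have [C C0 HC] := solution_le_dist S.
have N0 : 0 <= `|lambda| * M by rewrite mulr_ge0.
set N := `|lambda| * M in N0 *.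
(* With [m] the distance to the nearest side, a square of radius [m / 4] changes every distance by
   at most [m / 2]. There [|f| <= C * (3 / 2 * m)], and [2 * (3 / 2 * m) / (m / 4) = 12]. *)
exists (12 * C + (N + 1) * D).
  by rewrite addr_ge0 // mulr_ge0 // addr_ge0.
move=> u x u1 Qx.
have [k _ kmin] := @Order.TotalTheory.arg_minP _ _ _ ord0 xpredT
  (fun k => dotp (x - v k) (n k)) isT.
set m := dotp (x - v k) (n k) in kmin.
have m0 : 0 < m by exact: Qx.
have mD : m <= D by apply: HD; exact: polygonW.
have r0 : 0 < m / 4 by rewrite divr_gt0.
have near y j : square u x (m / 4) y ->
    `|dotp (y - v j) (n j) - dotp (x - v j) (n j)| <= m / 2.
  move=> sy; have := square_dotp_le u1 (solution_unit S j) sy.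
  have -> : dotp (y - v j) (n j) - dotp (x - v j) (n j) = dotp (y - x) (n j).
    by plane_ring.
  by lra.
have Qy y : square u x (m / 4) y -> polygon v n y.
  move=> sy j; have := near y j sy; have := kmin j isT.
  by rewrite ler_norml -/m; lra.
have oQ := @polygon_open R v n.
have := @interior_gradient _ u x (m / 4) (C * (3 / 2 * m)) N
  (dir_deriv u f x) f (laplacian f) u1 r0.
have -> : 2 * (C * (3 / 2 * m)) / (m / 4) + (N + 1) * (m / 4) / 2 =
    12 * C + (N + 1) * (m / 8).
  by field; rewrite gt_eqF.
move=> H; apply: (@le_trans _ _ (12 * C + (N + 1) * (m / 8))); last first.
  by rewrite lerD2l ler_wpM2l ?addr_ge0 //; lra.
apply: H => //.
- by rewrite !mulr_ge0 // ltW.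
- by move=> y /Qy Uy; have [C1f _ _] := solution_C2 S; exact: C1_continuous oQ C1f Uy.
- by apply: has_laplacian_sub Qy _; exact: C2_has_laplacian (solution_C2 S).
- move=> y sy; apply: le_trans (HC k y (polygonW (Qy _ sy))) _.
  rewrite ler_wpM2l //; have := near y k sy; rewrite ler_norml -/m; lra.
- move=> y /Qy Uy; rewrite (solution_eq S) // normrM normrN ler_wpM2l //.
  exact/HM/polygonW.
- by have [] := C2_is_derive u u oQ (solution_C2 S) Qx.
Qed.

(** * Boundary regularity along a side *)

Lemma is_derive_translate (R : realType) (w : plane R -> R) (x c v : plane R) (d : R) :
  is_derive (x + c) v w d -> is_derive x v (fun y => w (y + c)) d.
Proof.
move=> /is_derive_along0 H; apply/is_derive_along0.
rewrite [X in is_derive _ _ X _](_ : _ = fun h : R => w (x + c + h *: v)) //.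
by apply/funext => h; rewrite addrAC.
Qed.

Lemma has_laplacian_translate (R : realType) (n c : plane R) (U V : set (plane R))
    (w L : plane R -> R) :
  (forall x, V x -> U (x + c)) -> has_laplacian n U w L ->
  has_laplacian n V (fun y => w (y + c)) (fun y => L (y + c)).
Proof.
move=> VU [f [g [f' [g' H]]]].
exists (fun y => f (y + c)), (fun y => g (y + c)), (fun y => f' (y + c)),
  (fun y => g' (y + c)) => x /VU /H [A B C D E].
by split; try exact: is_derive_translate.
Qed.

(** [g s + C * s] is nondecreasing, so its infimum is the limit of [g] at [0] from the right; each
    [g t - C * t] is a lower bound of it. *)
Lemma lipschitz_right_limit (R : realType) (g : R -> R) (C r : R) : 0 < r -> 0 <= C ->
  (forall s t, 0 < s -> s <= t -> t <= r -> `|g t - g s| <= C * (t - s)) ->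
  exists G : R, forall t, 0 < t -> t <= r -> `|g t - G| <= C * t.
Proof.
move=> r0 C0 H; set A := [set g s + C * s | s in [set s | 0 < s <= r]].
have lbA t : 0 < t -> t <= r -> lbound A (g t - C * t).
  move=> t0 tr _ [s /= /andP[s0 sr] <-]; have [st|/ltW ts] := leP s t.
  - have := H s t s0 st tr; have := mulr_ge0 C0 (ltW s0).
    by rewrite ler_norml; lra.
  - have := H t s t0 ts sr; have := mulr_ge0 C0 (ltW t0).
    by rewrite ler_norml; lra.
have A0 : A !=set0 by exists (g r + C * r), r => //=; rewrite r0 lexx.
exists (inf A) => t t0 tr; rewrite ler_norml; apply/andP; split.
- have : inf A <= g t + C * t.
    apply: inf_lbound; last by exists t => //=; rewrite t0.
    by exists (g t - C * t); exact: lbA.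
  by lra.
- have : g t - C * t <= inf A by apply: lb_le_inf => //; exact: lbA.
  by lra.
Qed.

Definition frame_point (R : realType) (x0 n : plane R) (a b : R) : plane R :=
  x0 + a *: perp n + b *: n.

Lemma frame_point_coord (R : realType) (x0 n : plane R) (a b : R) :
  dotp n n = 1 -> dotp (frame_point x0 n a b - x0) (perp n) = a /\
  dotp (frame_point x0 n a b - x0) n = b.
Proof.
move=> n1; have E u : dotp (frame_point x0 n a b - x0) u =
   a * dotp (perp n) u + b * dotp n u by rewrite /frame_point; plane_ring.
rewrite !E dotp_perp2 n1 dotp_perp (dotpC (perp n)) dotp_perp.
by split; ring.
Qed.

(* [x0] is in the relative interior of the side number [k]. *)
Definition flat_boundary (R : realType) (v n : 'I_4 -> plane R) (k : 'I_4)
    (x0 : plane R) (rho : R) : Prop :=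
  [/\ 0 < rho, dotp (x0 - v k) (n k) = 0 &
      forall a b, `|a| <= rho -> 0 <= b -> b <= rho ->
        closed_polygon v n (frame_point x0 (n k) a b) /\
        (0 < b -> polygon v n (frame_point x0 (n k) a b))].

Lemma frame_pointD1 (R : realType) (x0 n : plane R) (a b h : R) :
  frame_point x0 n a b + h *: perp n = frame_point x0 n (a + h) b.
Proof. by rewrite /frame_point; plane_eq. Qed.

Lemma frame_pointD2 (R : realType) (x0 n : plane R) (a b h : R) :
  frame_point x0 n a b + h *: n = frame_point x0 n a (b + h).
Proof. by rewrite /frame_point; plane_eq. Qed.

Lemma frame_point_half_square (R : realType) (x0 n x : plane R) (a r : R) :
  dotp n n = 1 -> half_square n (frame_point x0 n a 0) r x ->
  exists a' b, [/\ x = frame_point x0 n (a + a') b, `|a'| <= r, 0 <= b & b <= r].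
Proof.
move=> n1 [h1 h2 h3]; exists (dotp (x - frame_point x0 n a 0) (perp n)).
exists (dotp (x - frame_point x0 n a 0) n); split => //.
rewrite {1}(frame_coordinates (frame_point x0 n a 0) x n1).
by rewrite frame_pointD1 frame_pointD2 add0r.
Qed.

Lemma flat_boundary0 (R : realType) (v n : 'I_4 -> plane R) lambda f k x0 rho a :
  polygon_solution v n lambda f -> flat_boundary v n k x0 rho ->
  `|a| <= rho -> f (frame_point x0 (n k) a 0) = 0.
Proof.
move=> S [rho0 x0k H] ha; apply: (solution_bd S).
  by apply: (H a 0 ha _ _).1 => //; exact: ltW.
move=> /(_ k); rewrite (_ : dotp _ _ = dotp (frame_point x0 (n k) a 0 - x0) (n k)
  + dotp (x0 - v k) (n k)); last by plane_ring.
have [_ ->] := frame_point_coord x0 a 0 (solution_unit S k).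
by rewrite x0k addr0 ltxx.
Qed.

(** Mean value theorem along a segment parallel to the side, with the global gradient bound; on the
    side itself both values vanish. *)
Lemma solution_tangential_lipschitz (R : realType) (v n : 'I_4 -> plane R)
    lambda f : polygon_solution v n lambda f ->
  exists2 L : R, 0 <= L & forall k x0 rho a b h,
    flat_boundary v n k x0 rho -> 0 <= h -> `|a| <= rho -> `|a + h| <= rho ->
    0 <= b -> b <= rho ->
    `|f (frame_point x0 (n k) (a + h) b) - f (frame_point x0 (n k) a b)| <= L * h.
Proof.
move=> S; have [L L0 HL] := solution_gradient_bounded S.
exists L => // k x0 rho a b h FB h0 ha hah b0 br.
have [rho0 _ HF] := FB.
move: b0; rewrite le_eqVlt => /orP[/eqP<-|b0].
  by rewrite !(flat_boundary0 S FB) // subrr normr0 mulr_ge0.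
have p1 : dotp (perp (n k)) (perp (n k)) = 1 by rewrite dotp_perp2 (solution_unit S).
have U r : 0 <= r -> r <= h -> polygon v n (frame_point x0 (n k) a b + r *: perp (n k)).
  move=> r0 rh; rewrite frame_pointD1; apply: (HF _ _ _ _ br).2 => //; last exact: ltW.
  by move: ha hah; rewrite !ler_norml; lra.
have [||c] := @MVT_segment _ (fun r => f (frame_point x0 (n k) a b + r *: perp (n k)))
  (fun r => dir_deriv (perp (n k)) f (frame_point x0 (n k) a b + r *: perp (n k))) 0 h h0.
- move=> r; rewrite in_itv /= => /andP[r0 rh]; rewrite -is_derive_along.
  by have [] := C2_is_derive (perp (n k)) (perp (n k)) (@polygon_open R v n) (solution_C2 S) (U r (ltW r0) (ltW rh)).
- apply: derivable_within_continuous => r; rewrite in_itv /= => /andP[r0 rh].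
  have [H _] := C2_is_derive (perp (n k)) (perp (n k)) (@polygon_open R v n) (solution_C2 S) (U r r0 rh).
  by move/is_derive_along: H => [].
rewrite in_itv /= => /andP[c0 ch].
rewrite !frame_pointD1 addr0 => ->; rewrite subr0 normrM (ger0_norm h0).
by rewrite ler_wpM2r // HL // -frame_pointD1; exact: U.
Qed.

(** A quotient instead of the derivative: it is as smooth as [f] and satisfies the same linear
    equation, so that barriers apply to it. *)
Definition tangential_quotient (R : realType) (n : plane R) (f : plane R -> R)
    (h : R) (x : plane R) : R :=
  h^-1 * (f (x + h *: perp n) - f x).

(** Two rounds of barriers. The quotient is bounded by the tangential Lipschitz constant and
    vanishes on the side, so [half_square_barrier] makes it at most linear in the depth; then
    [interior_gradient], on squares of radius proportional to the depth, bounds its gradient. The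
    factor [3] leaves room for [a], for the half square around it and for the shift by [h]. *)
Lemma tangential_quotient_bounds (R : realType) (v n : 'I_4 -> plane R)
    (lambda : R) f k x0 (r : R) :
  polygon_solution v n lambda f -> flat_boundary v n k x0 (3 * r) ->
  exists2 C : R, 0 <= C & forall h : R, 0 < h -> h <= r ->
    (forall a b : R, `|a| <= r -> 0 <= b -> b <= r ->
      `|tangential_quotient (n k) f h (frame_point x0 (n k) a b)| <= C * b) /\
    (forall w (a b : R), dotp w w = 1 -> `|a| <= r / 2 -> 0 < b -> b <= r / 2 ->
      `|tangential_quotient (n k) (dir_deriv w f) h (frame_point x0 (n k) a b)|
        <= C).
Proof.
move=> S FB; have [L L0 HL] := solution_tangential_lipschitz S.
have n1 := solution_unit S k; have [rho0 x0k HF] := FB.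
have r0 : 0 < r by lra.
have r0' := ltW r0.
have oQ := @polygon_open R v n.
have N0 : 0 <= `|lambda| * L by rewrite mulr_ge0.
set N := `|lambda| * L in N0 *.
set C := 2 * L / r + (N + 1) * r / 2.
have N1 : 0 <= (N + 1) * r by apply: mulr_ge0 => //; lra.
have Lr : 0 <= L / r by exact: divr_ge0.
have C0 : 0 <= C by rewrite /C; lra.
(* The [12] comes from squares of radius [b / 4], on which the depth is at most [3 / 2 * b]. The sum
   also dominates the first constant [C]. *)
exists (12 * C + (N + 1) * r); first by lra.
move=> h h0 hr; set u := tangential_quotient (n k) f h.
have uE a b : u (frame_point x0 (n k) a b) =
    h^-1 * (f (frame_point x0 (n k) (a + h) b) - f (frame_point x0 (n k) a b)).
  by rewrite /u /tangential_quotient frame_pointD1.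
have abs3 (a : R) : `|a| <= 2 * r -> `|a| <= 3 * r /\ `|a + h| <= 3 * r.
  by rewrite !ler_norml => ?; split; lra.
have uL (a b : R) : `|a| <= 2 * r -> 0 <= b -> b <= r -> `|u (frame_point x0 (n k) a b)| <= L.
  move=> /abs3[a1 a2] b0 br; rewrite uE normrM normfV (gtr0_norm h0) ler_pdivrMl //.
  by rewrite mulrC; apply: (HL _ _ _ _ _ _ FB) => //; lra.
pose Lu := tangential_quotient (n k) (laplacian f) h.
have lapu w V : dotp w w = 1 ->
    (forall x, V x -> polygon v n x /\ polygon v n (x + h *: perp (n k))) ->
    has_laplacian w V u Lu.
  move=> w1 HV; have lf := C2_has_laplacian w1 oQ (solution_C2 S).
  have VQ : V `<=` polygon v n by move=> x /HV[].
  have l1 := has_laplacian_translate (fun x Vx => (HV x Vx).2) lf.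
  have l2 := has_laplacianZ (-1) (has_laplacian_sub VQ lf).
  apply: has_laplacian_eq (has_laplacianZ h^-1 (has_laplacianD l1 l2)) => [x|x _];
    by rewrite /u /Lu /tangential_quotient /= mulN1r.
have Lule x : polygon v n x -> polygon v n (x + h *: perp (n k)) ->
    `|u x| <= L -> `|Lu x| <= N.
  move=> Q1 Q2 ux; rewrite /Lu /tangential_quotient !(solution_eq S) //.
  rewrite -mulrBr mulrCA -/(tangential_quotient (n k) f h x) -/u.
  by rewrite normrM normrN ler_wpM2l.
have bd1 (a b : R) : `|a| <= r -> 0 <= b -> b <= r ->
    `|u (frame_point x0 (n k) a b)| <= C * b.
  move=> ar b0 br; set c := frame_point x0 (n k) a 0.
  have ptE (a' : R) : `|a'| <= r -> `|a + a'| <= 2 * r.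
    by move: ar; rewrite !ler_norml; lra.
  have halfE x : half_square (n k) c r x -> closed_polygon v n x /\
      closed_polygon v n (x + h *: perp (n k)) /\ `|u x| <= L.
    move=> /(frame_point_half_square n1)[a' [b' [-> /ptE a'r b'0 b'r]]].
    have [a1 a2] := abs3 _ a'r; rewrite frame_pointD1; split; [|split].
    - by apply: (HF _ _ a1 b'0 _).1; lra.
    - by apply: (HF _ _ a2 b'0 _).1; lra.
    - exact: uL.
  have openE x : open_half_square (n k) c r x -> polygon v n x /\
      polygon v n (x + h *: perp (n k)).
    move=> ox; have [_ x1 _] := ox.
    have [a' [b' [E /ptE a'r b'0 b'r]]] := frame_point_half_square n1 (open_half_squareW ox).
    have [a1 a2] := abs3 _ a'r.
    have b'1 : 0 < b'.
      have [_ F1] := frame_point_coord x0 (a + a') b' n1.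
      have [_ F2] := frame_point_coord x0 a 0 n1.
      move: x1; rewrite E /c; rewrite (_ : dotp _ _ =
        dotp (frame_point x0 (n k) (a + a') b' - x0) (n k) -
        dotp (frame_point x0 (n k) a 0 - x0) (n k)); last by plane_ring.
      by rewrite F1 F2 subr0.
    rewrite E frame_pointD1; split.
    - by apply: (HF _ _ a1 b'0 _).2 => //; lra.
    - by apply: (HF _ _ a2 b'0 _).2 => //; lra.
  have cu : {within half_square (n k) c r, continuous u}.
    move=> x; rewrite /u /tangential_quotient; apply: cvgMl_tmp; apply: cvgB.
      apply: (@within_comp_continuous _ _ _ (half_square (n k) c r) _ (fun y => y + h *: perp (n k)) _ (solution_continuous S)).
        by move=> y; apply: cvgD; [exact: cvg_id|exact: cvg_cst].
      by move=> y /halfE[_ []].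
    have := @within_comp_continuous _ _ _ (half_square (n k) c r) _ idfun _ (solution_continuous S).
    apply; first by move=> y; exact: cvg_id.
    by move=> y /halfE[].
  have E y : c + y *: n k = frame_point x0 (n k) a y.
    by rewrite /c frame_pointD2 add0r.
  rewrite -E; apply: (half_square_barrier n1 r0 L0 N0 cu (lapu _ _ n1 openE)) => //.
  - by move=> x ox; have [Q1 Q2] := openE x ox; apply: Lule => //;
      have [_ []] := halfE x (open_half_squareW ox).
  - by move=> x /halfE[_ []].
  - move=> x hx; have [a' [b' [-> /ptE a'r b'0 b'r]]] := frame_point_half_square n1 hx.
    have [_ F1] := frame_point_coord x0 (a + a') b' n1.
    have [_ F2] := frame_point_coord x0 a 0 n1.
    rewrite /c; rewrite (_ : dotp _ _ =
        dotp (frame_point x0 (n k) (a + a') b' - x0) (n k) -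
        dotp (frame_point x0 (n k) a 0 - x0) (n k)); last by plane_ring.
    rewrite F1 F2 subr0 uE => ->; have [a1 a2] := abs3 _ a'r.
    by rewrite !(flat_boundary0 S FB) // subrr mulr0.
split.
  move=> a b ar b0 br; apply: le_trans (bd1 a b ar b0 br) _.
  by rewrite ler_wpM2r //; lra.
move=> w a b w1 ar b0 br; set y := frame_point x0 (n k) a b.
have s0 : 0 < b / 4 by rewrite divr_gt0.
have p1 : dotp (perp (n k)) (perp (n k)) = 1 by rewrite dotp_perp2.
have sqE x : square w y (b / 4) x -> exists a' b', [/\ x = frame_point x0 (n k) a' b',
    `|a'| <= r, 0 < b' & b' <= 3 / 2 * b].
  move=> sx; have h1 := square_dotp_le w1 p1 sx; have h2 := square_dotp_le w1 n1 sx.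
  exists (a + dotp (x - y) (perp (n k))), (b + dotp (x - y) (n k)); split.
  - by rewrite {1}(frame_coordinates y x n1) frame_pointD1 frame_pointD2.
  - by move: ar h1; rewrite !ler_norml; lra.
  - by move: h2; rewrite ler_norml; lra.
  - by move: h2; rewrite ler_norml; lra.
have sqQ x : square w y (b / 4) x -> polygon v n x /\ polygon v n (x + h *: perp (n k)).
  move=> /sqE[a' [b' [-> a'r b'0 b'b]]].
  have /abs3[a1 a2] : `|a'| <= 2 * r by lra.
  rewrite frame_pointD1; split.
  - by apply: (HF _ _ a1 (ltW b'0) _).2 => //; lra.
  - by apply: (HF _ _ a2 (ltW b'0) _).2 => //; lra.
have sqL x : square w y (b / 4) x -> `|u x| <= L.
  move=> /sqE[a' [b' [-> a'r b'0 b'b]]]; apply: uL; lra.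
have [C1f _ _] := solution_C2 S.
have Qy : polygon v n y /\ polygon v n (y + h *: perp (n k)).
  by apply: sqQ; split; rewrite subrr /dotp /= !mul0r addr0 normr0 ltW.
have du : is_derive y w u (tangential_quotient (n k) (dir_deriv w f) h y).
  have [d1 _] := C2_is_derive w w oQ (solution_C2 S) Qy.1.
  have [d2 _] := C2_is_derive w w oQ (solution_C2 S) Qy.2.
  have d3 := is_deriveB (is_derive_translate d2) d1.
  exact: (is_deriveZ h^-1 d3).
have := @interior_gradient _ w y (b / 4) (C * (3 / 2 * b)) N _ u Lu w1 s0 _ N0 _
  (lapu _ _ w1 sqQ) _ _ du.
have -> : 2 * (C * (3 / 2 * b)) / (b / 4) + (N + 1) * (b / 4) / 2 =
    12 * C + (N + 1) * (b / 8).
  by field; rewrite gt_eqF.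
move=> H; apply: (@le_trans _ _ (12 * C + (N + 1) * (b / 8))); last first.
  by rewrite lerD2l ler_wpM2l //; lra.
apply: H.
- by rewrite mulr_ge0 // mulr_ge0 // ltW.
- move=> x /sqQ[Q1 Q2]; apply: cvgMl_tmp; apply: cvgB; last exact: C1_continuous oQ C1f Q1.
  apply: (@cvg_comp _ _ _ (fun y => y + h *: perp (n k)) f _ (nbhs (x + h *: perp (n k)))).
    by apply: cvgD; [exact: cvg_id|exact: cvg_cst].
  exact: C1_continuous oQ C1f Q2.
- move=> x /sqE[a' [b' [-> a'r b'0 b'b]]].
  apply: le_trans (bd1 a' b' a'r (ltW b'0) _) _; first by lra.
  by rewrite ler_wpM2l.
- by move=> x sx; have [Q1 Q2] := sqQ x sx; apply: Lule => //; exact: sqL.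
Qed.

Lemma laplacian_frame (R : realType) (n x : plane R) (f : plane R -> R) :
  dotp n n = 1 ->
  ((perp n).1 * dir_deriv (perp n) (partial1 f) x +
   (perp n).2 * dir_deriv (perp n) (partial2 f) x) +
  (n.1 * dir_deriv n (partial1 f) x + n.2 * dir_deriv n (partial2 f) x) =
  laplacian f x.
Proof.
rewrite /dotp => n1; rewrite /dir_deriv /laplacian /perp /=.
move: (partial1 _ _) (partial2 _ _) (partial1 (partial2 _) _) (partial2 (partial2 _) _).
by move=> a b c d; rewrite -[a + d]mulr1 -n1; ring.
Qed.

(** By the quotient bounds the gradient is Lipschitz parallel to the side; for [h] tending to [0]
    they also make the tangential derivative linear in the depth and bound the second tangential
    derivative. By the equation the second normal derivative is then bounded, so the normal
    derivative has a limit [G] along the normal through [x0]. *)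
Lemma boundary_gradient (R : realType) (v n : 'I_4 -> plane R)
    (lambda : R) f k x0 (r : R) :
  polygon_solution v n lambda f -> flat_boundary v n k x0 (3 * r) ->
  exists G C : R, 0 <= C /\ forall a b : R, `|a| <= r / 2 -> 0 < b -> b <= r / 2 ->
    `|dir_deriv (n k) f (frame_point x0 (n k) a b) - G| <= C * (`|a| + b) /\
    `|dir_deriv (perp (n k)) f (frame_point x0 (n k) a b)| <= C * b.
Proof.
move=> S FB; have [M M0 HM] := solution_bounded S.
have [C C0 HC] := tangential_quotient_bounds S FB.
have n1 := solution_unit S k; have [rho0 x0k HF] := FB.
have p1 : dotp (perp (n k)) (perp (n k)) = 1 by rewrite dotp_perp2.
have r0 : 0 < r by lra.
have oQ := @polygon_open R v n.
have Q a b : `|a| <= r / 2 -> 0 < b -> b <= r / 2 -> polygon v n (frame_point x0 (n k) a b).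
  by move=> ar b0 br; apply: (HF _ _ _ (ltW b0) _).2 => //; lra.
have Lip w a b h : dotp w w = 1 -> `|a| <= r / 2 -> 0 < b -> b <= r / 2 -> 0 < h -> h <= r ->
   `|dir_deriv w f (frame_point x0 (n k) (a + h) b) -
     dir_deriv w f (frame_point x0 (n k) a b)| <= C * h.
  move=> w1 ar b0 br h0 hr; have := (HC h h0 hr).2 w a b w1 ar b0 br.
  rewrite /tangential_quotient frame_pointD1 normrM normfV (gtr0_norm h0).
  by rewrite ler_pdivrMl // mulrC.
have tan a b : `|a| <= r / 2 -> 0 < b -> b <= r / 2 ->
    `|dir_deriv (perp (n k)) f (frame_point x0 (n k) a b)| <= C * b.
  move=> ar b0 br; have ar' : `|a| <= r by lra.
  have br' : b <= r by lra.
  have [d1 _] := C2_is_derive (perp (n k)) (perp (n k)) oQ (solution_C2 S) (Q a b ar b0 br).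
  apply: (is_derive_le ((is_derive_along0 _ _ _ _).1 d1) r0) => h h0 hr.
  have := (HC h h0 hr).1 a b ar' (ltW b0) br'.
  rewrite /tangential_quotient normrM normfV (gtr0_norm h0) ler_pdivrMl //.
  by rewrite add0r scale0r addr0 mulrC.
pose DD (u : plane R) x := u.1 * dir_deriv u (partial1 f) x + u.2 * dir_deriv u (partial2 f) x.
have DDe a b : `|a| <= r / 2 -> 0 < b -> b <= r / 2 ->
    `|DD (perp (n k)) (frame_point x0 (n k) a b)| <= C.
  move=> ar b0 br.
  have [_ d1] := C2_is_derive (perp (n k)) (perp (n k)) oQ (solution_C2 S) (Q a b ar b0 br).
  apply: (is_derive_le ((is_derive_along0 _ _ _ _).1 d1) r0) => h h0 hr.
  by rewrite add0r scale0r addr0 frame_pointD1; exact: Lip.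
(* Bound for the second normal derivative, which is [- lambda * f] minus the second tangential
   one. *)
set C' := C + `|lambda| * M.
have lM0 : 0 <= `|lambda| * M by rewrite mulr_ge0.
have DDn b : 0 < b -> b <= r / 2 -> `|DD (n k) (frame_point x0 (n k) 0 b)| <= C'.
  move=> b0 br; have a0 : `|0 : R| <= r / 2 by rewrite normr0; lra.
  have := DDe 0 b a0 b0 br; have := laplacian_frame (frame_point x0 (n k) 0 b) f n1.
  rewrite (solution_eq S); last exact: Q.
  rewrite -/(DD _ _) -/(DD _ _) => E H.
  have -> : DD (n k) (frame_point x0 (n k) 0 b) =
      - lambda * f (frame_point x0 (n k) 0 b) - DD (perp (n k)) (frame_point x0 (n k) 0 b).
    by rewrite -E; ring.
  apply: le_trans (ler_normB _ _) _; rewrite /C' addrC lerD //.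
  rewrite normrM normrN ler_wpM2l //; apply: HM.
  by apply: polygonW; exact: Q.
have r20 : 0 < r / 2 by rewrite divr_gt0.
have C'0 : 0 <= C' by rewrite addr_ge0.
have [|G HG] := @lipschitz_right_limit _ (fun b => dir_deriv (n k) f (frame_point x0 (n k) 0 b)) C' _ r20 C'0.
  move=> s t s0 st tr.
  have a0 : `|0 : R| <= r / 2 by rewrite normr0 ltW.
  have D u : s <= u -> u <= t -> is_derive u 1
      (fun b => dir_deriv (n k) f (frame_point x0 (n k) 0 b)) (DD (n k) (frame_point x0 (n k) 0 u)).
    move=> su ut.
    have u0 : 0 < u := lt_le_trans s0 su.
    have [_ d1] := C2_is_derive (n k) (n k) oQ (solution_C2 S) (Q 0 u a0 u0 (le_trans ut tr)).
    have := is_derive_along (dir_deriv (n k) f) (frame_point x0 (n k) 0 0) (n k) u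
      (DD (n k) (frame_point x0 (n k) 0 u)).
    rewrite frame_pointD2 add0r => -[/(_ d1) + _].
    rewrite [X in is_derive _ _ X _ -> _](_ : _ = (fun b => dir_deriv (n k) f (frame_point x0 (n k) 0 b))) //.
    by apply/funext => h; rewrite frame_pointD2 add0r.
  have [||c] := @MVT_segment _ (fun b => dir_deriv (n k) f (frame_point x0 (n k) 0 b))
    (fun u => DD (n k) (frame_point x0 (n k) 0 u)) s t st.
  - by move=> u; rewrite in_itv /= => /andP[? ?]; apply: D; exact: ltW.
  - apply: derivable_within_continuous => u; rewrite in_itv /= => /andP[su ut].
    by have [] := D u su ut.
  rewrite in_itv /= => /andP[sc ct] ->.
  rewrite normrM (ger0_norm (_ : 0 <= t - s)) ?subr_ge0 // ler_wpM2r ?subr_ge0 //.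
  by apply: DDn; [exact: lt_le_trans sc|exact: le_trans ct tr].
exists G, C'; split => // a b ar b0 br; split; last first.
  by apply: le_trans (tan a b ar b0 br) _; rewrite ler_wpM2r ?(ltW b0) // lerDl.
have a0 : `|0 : R| <= r / 2 by rewrite normr0 ltW.
(* Move parallel to the side to the normal through [x0]. [Lip] only shifts by a positive amount, so
   the starting point depends on the sign of [a]. *)
have sh : `|dir_deriv (n k) f (frame_point x0 (n k) a b) -
      dir_deriv (n k) f (frame_point x0 (n k) 0 b)| <= C * `|a|.
  have [a_gt0|a_lt0|<-] := ltgtP 0 a; last by rewrite subrr normr0 mulr0.
  - have := Lip (n k) 0 b a n1 a0 b0 br a_gt0; rewrite add0r (gtr0_norm a_gt0); apply.
    by move: ar; rewrite (gtr0_norm a_gt0); lra.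
  - have Na : 0 < - a by rewrite oppr_gt0.
    have := Lip (n k) a b (- a) n1 ar b0 br Na; rewrite subrr distrC (ltr0_norm a_lt0); apply.
    by move: ar; rewrite (ltr0_norm a_lt0); lra.
have := HG b b0 br.
set g0 := dir_deriv _ f _ in sh *; set g1 := dir_deriv _ f _ in sh *.
move=> H; rewrite -(subrK g1 g0) -addrA; apply: le_trans (ler_normD _ _) _.
rewrite mulrDr lerD //; apply: le_trans sh _.
by rewrite ler_wpM2r // /C' lerDl.
Qed.

(** * Quadrilaterals with a bisected diagonal *)

Definition det2 (R : realType) (u w : plane R) : R := u.1 * w.2 - u.2 * w.1.

(* The quadrilateral with a diagonal from [p - u] to [p + u] that passes through
   the midpoint [p + kappa u] of the other diagonal. *)
Record kite (R : realType) (v : 'I_4 -> plane R) (i : 'I_4) (p u w : plane R)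
    (kappa : R) : Prop := Kite {
  kite_det : det2 u w != 0 ;
  kite_ge : -1 <= kappa ;
  kite_le : kappa <= 1 ;
  kite0 : v i = p - u ;
  kite1 : v (i + 1) = p + kappa *: u - w ;
  kite2 : v (i + 2) = p + u ;
  kite3 : v (i + 3) = p + kappa *: u + w }.

Lemma ord4_eqs (i : 'I_4) :
  [/\ i + 1 + 1 = i + 2, i + 2 + 1 = i + 3, i + 3 + 1 = i & i + 1 + 2 = i + 3].
Proof.
by split; rewrite -addrA; first [congr (_ + _)|rewrite -[RHS]addr0; congr (_ + _)];
  exact: val_inj.
Qed.

Lemma forall_ord4_shift (i : 'I_4) (P : 'I_4 -> Prop) :
  P i -> P (i + 1) -> P (i + 2) -> P (i + 3) -> forall k, P k.
Proof.
move=> P0 P1 P2 P3 k; rewrite -(subrK i k) addrC.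
apply: (@forall_ord4 (fun j => P (i + j))) => //; last by rewrite addr0.
Qed.

(** If [a * b > 0], the two sides leave their common vertex in the same direction and overlap beyond
    it. *)
Lemma simple_adjacent (R : realType) (v : 'I_4 -> plane R) (k : 'I_4)
    (z : plane R) (a b : R) :
  simple_quadrilateral v -> v k = v (k + 1) + a *: z ->
  v (k + 1 + 1) = v (k + 1) + b *: z -> a * b <= 0.
Proof.
move=> [inj adj _] Ek Ek2; rewrite leNgt; apply/negP => ab.
have a0 : a != 0 by apply: contraTneq ab => ->; rewrite mul0r ltxx.
have b0 : b != 0 by apply: contraTneq ab => ->; rewrite mulr0 ltxx.
have s0 : a + b != 0 by apply/eqP => E; have := sqr_ge0 a; nra.
have c1 : 0 <= b / (a + b) <= 1.
  have -> : b / (a + b) = (a * b + b ^+ 2) / (a + b) ^+ 2 by field.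
  have s2 : 0 < (a + b) ^+ 2 by rewrite exprn_even_gt0.
  have := sqr_ge0 a; have := sqr_ge0 b => b2 a2.
  by rewrite divr_ge0 ?ler_pdivrMr ?mul1r //; nra.
(* [a * b / (a + b)] has the sign of [a] and [b] and is smaller than both in absolute value, so [y]
   would be a second common point of the two sides. *)
set y := v (k + 1) + (a * b / (a + b)) *: z.
have : [set v (k + 1)] y.
  rewrite -(adj k); split.
  - exists (1 - b / (a + b)); first by rewrite /= in_itv /=; lra.
    by rewrite Ek /y; apply: injective_projections; plane_unfold; field.
  - exists (1 - b / (a + b)); first by rewrite /= in_itv /=; lra.
    by rewrite Ek2 /y; apply: injective_projections; plane_unfold; field.
rewrite /y /= => /eqP; rewrite -subr_eq0 addrAC subrr add0r scaler_eq0.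
rewrite !mulf_eq0 invr_eq0 (negbTE a0) (negbTE b0) (negbTE s0) /= => /eqP z0.
move: Ek; rewrite z0 scaler0 addr0 => /inj /eqP.
by rewrite -subr_eq0 opprD addrA subrr sub0r.
Qed.

Lemma parallel_scale (R : realType) (u w : plane R) : u != 0 -> det2 u w = 0 ->
  exists c : R, w = c *: u.
Proof.
move=> u0 D; exists (dotp w u / dotp u u).
have uu : dotp u u != 0.
  apply: contraNneq u0 => /eqP; rewrite /dotp paddr_eq0 -?expr2 ?sqr_ge0 //.
  rewrite !sqrf_eq0 => /andP[/eqP u1 /eqP u2].
  by apply/eqP; apply: injective_projections.
move: D uu; rewrite /det2 /dotp => D uu.
apply: injective_projections; plane_unfold.
- apply: (mulIf uu); rewrite mulrAC divfK //.
  have -> : w.1 * (u.1 * u.1 + u.2 * u.2) =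
     (w.1 * u.1 + w.2 * u.2) * u.1 - u.2 * (u.1 * w.2 - u.2 * w.1) by ring.
  by rewrite D mulr0 subr0.
- apply: (mulIf uu); rewrite mulrAC divfK //.
  have -> : w.2 * (u.1 * u.1 + u.2 * u.2) =
     (w.1 * u.1 + w.2 * u.2) * u.2 + u.1 * (u.1 * w.2 - u.2 * w.1) by ring.
  by rewrite D mulr0 addr0.
Qed.

(** [p] is the midpoint and [u] half of the diagonal from [v i], and [w] is half of the other one;
    [kappa = 2 * t - 1] moves the parameter from [[0, 1]] to [[-1, 1]]. The substance is
    [det2 u w != 0]: simplicity excludes four collinear vertices. *)
Lemma quadrilateral_kite (R : realType) (v : 'I_4 -> plane R) (i : 'I_4) :
  simple_quadrilateral v ->
  quad_diagonal v i (midpoint (v (i + 1)) (v (i + 3))) ->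
  exists p u w kappa, kite v i p u w kappa.
Proof.
move=> S [t]; rewrite /= in_itv /= => /andP[t0 t1] Em.
set a := v i in Em *; set b := v (i + 1) in Em *; set c := v (i + 2) in Em *.
set d := v (i + 3) in Em *.
pose p : plane R := 2^-1 *: (a + c); pose u : plane R := 2^-1 *: (c - a).
pose w : plane R := 2^-1 *: (d - b).
have Ea : a = p - u by rewrite /p /u; apply: injective_projections; plane_unfold; field.
have Ec : c = p + u by rewrite /p /u; apply: injective_projections; plane_unfold; field.
have Em1 := congr1 fst Em; have Em2 := congr1 snd Em.
move: Em1 Em2; rewrite /midpoint; plane_unfold => Em1 Em2.
have Eb : b = p + (2 * t - 1) *: u - w.
  by rewrite /p /u /w; apply: injective_projections; plane_unfold; lra.
have Ed : d = p + (2 * t - 1) *: u + w.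
  by rewrite /p /u /w; apply: injective_projections; plane_unfold; lra.
exists p, u, w, (2 * t - 1); split => //; try lra.
apply/negP => /eqP D.
have [inj _ _] := S.
have ac : a != c.
  apply/negP => /eqP /inj /eqP; rewrite -subr_eq0 opprD addrA subrr sub0r.
  by rewrite oppr_eq0.
have u0 : u != 0 by rewrite scaler_eq0 invr_eq0 pnatr_eq0 /= subr_eq0 eq_sym.
have [om Ew] := parallel_scale u0 D.
set be := 2 * t - 1 - om; set de := 2 * t - 1 + om.
have {}Eb : b = p + be *: u by rewrite Eb Ew /be; plane_eq.
have {}Ed : d = p + de *: u by rewrite Ed Ew /de; plane_eq.
have [e1 e2 e3 _] := ord4_eqs i.
(* On the line the vertices sit at [-1], [be], [1], [de], and no vertex may have both neighbours
   strictly on one side. [A2] and [A3] place [be] and [de] between [-1] and [1], while [A1] wants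
   [-1] between them; distinctness of the vertices makes this absurd. *)
have A1 : (de + 1) * (be + 1) <= 0.
  apply: (@simple_adjacent _ v (i + 3) u _ _ S); rewrite e3 -/a -/b -/d ?Ea ?Eb ?Ed;
    plane_eq.
have A2 : (-1 - be) * (1 - be) <= 0.
  apply: (@simple_adjacent _ v i u _ _ S); rewrite ?e1 -/a -/b -/c ?Ea ?Eb ?Ec;
    plane_eq.
have A3 : (1 - de) * (-1 - de) <= 0.
  apply: (@simple_adjacent _ v (i + 2) u _ _ S); rewrite e2 ?e3 -/a -/c -/d ?Ea ?Ec ?Ed;
    plane_eq.
have N (j k : 'I_4) (r s : R) : v j = p + r *: u -> v k = p + s *: u -> j != k -> r != s.
  move=> Ej Ek; apply: contraNN => /eqP rs; apply/eqP/inj.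
  by rewrite Ej Ek rs.
have Ea' : a = p + -1 *: u by rewrite Ea; plane_eq.
have Ec' : c = p + 1 *: u by rewrite Ec; plane_eq.
have shift (x y : 'I_4) : x != y -> i + x != i + y by rewrite (inj_eq (addrI i)).
have n1 : be != -1 by apply: (N (i + 1) (i + 0)); rewrite ?addr0 // -{2}(addr0 i) shift.
have n2 : be != 1 by apply: (N (i + 1) (i + 2)); rewrite ?shift.
have n3 : de != -1 by apply: (N (i + 3) (i + 0)); rewrite ?addr0 // -{2}(addr0 i) shift.
have n4 : de != 1 by apply: (N (i + 3) (i + 2)); rewrite ?shift.
have b1 : -1 < be by rewrite lt_neqAle eq_sym n1; nra.
have d1 : -1 < de by rewrite lt_neqAle eq_sym n3; nra.
by nra.
Qed.

(* Up to the factor [K], twice the signed area of the triangle with base the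
   side number [k] and apex [x]. *)
Definition side_coord (R : realType) (v : 'I_4 -> plane R) (K : R) (k : 'I_4)
    (x : plane R) : R :=
  det2 (v k - x) (v (k + 1) - v k) / K.

Section KiteCoordinates.
Context {R : realType} (v : 'I_4 -> plane R) (i : 'I_4) (p u w : plane R)
  (kappa : R).
Hypothesis H : kite v i p u w kappa.
Let K := det2 u w.

Definition kite_x (x : plane R) : R := det2 (x - p) w / det2 u w.
Definition kite_y (x : plane R) : R := det2 u (x - p) / det2 u w.

Lemma kite_coord (x : plane R) : x = p + kite_x x *: u + kite_y x *: w.
Proof.
have := kite_det H; rewrite /kite_x /kite_y /det2 => K0.
by apply: injective_projections; plane_unfold; field.
Qed.

Lemma kite_coordE (a b : R) : kite_x (p + a *: u + b *: w) = a /\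
  kite_y (p + a *: u + b *: w) = b.
Proof.
have := kite_det H; rewrite /kite_x /kite_y /det2 => K0.
by split; plane_unfold; field.
Qed.

Lemma kite_side_coord : [/\
  forall x, side_coord v K i x = 1 + kite_x x + (1 + kappa) * kite_y x,
  forall x, side_coord v K (i + 1) x = 1 - kite_x x + (1 - kappa) * kite_y x,
  forall x, side_coord v K (i + 2) x = 1 - kite_x x - (1 - kappa) * kite_y x &
  forall x, side_coord v K (i + 3) x = 1 + kite_x x - (1 + kappa) * kite_y x].
Proof.
have K0 := kite_det H; have [e1 e2 e3 _] := ord4_eqs i.
by split => x; rewrite /side_coord ?e1 ?e2 ?e3 ?(kite0 H) ?(kite1 H) ?(kite2 H)
  ?(kite3 H) {1}(kite_coord x); move: (kite_x x) (kite_y x) => a b;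
  move: K0; rewrite /K /det2; plane_unfold => K0; field.
Qed.

Lemma kite_triangles k : det2 (v k - p) (v (k + 1) - v k) = K.
Proof.
have [e1 e2 e3 _] := ord4_eqs i.
apply: (@forall_ord4_shift i (fun k => det2 (v k - p) (v (k + 1) - v k) = K));
  rewrite ?e1 ?e2 ?e3 ?(kite0 H) ?(kite1 H) ?(kite2 H) ?(kite3 H) /K /det2;
  plane_ring.
Qed.

Lemma kite_side_xi t : [/\
  kite_x (v i + t *: (v (i + 1) - v i)) = -1 + t * (1 + kappa) /\
  kite_y (v i + t *: (v (i + 1) - v i)) = - t,
  kite_x (v (i + 1) + t *: (v (i + 1 + 1) - v (i + 1))) = kappa + t * (1 - kappa) /\
  kite_y (v (i + 1) + t *: (v (i + 1 + 1) - v (i + 1))) = t - 1,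
  kite_x (v (i + 2) + t *: (v (i + 2 + 1) - v (i + 2))) = 1 + t * (kappa - 1) /\
  kite_y (v (i + 2) + t *: (v (i + 2 + 1) - v (i + 2))) = t &
  kite_x (v (i + 3) + t *: (v (i + 3 + 1) - v (i + 3))) = kappa - t * (1 + kappa) /\
  kite_y (v (i + 3) + t *: (v (i + 3 + 1) - v (i + 3))) = 1 - t].
Proof.
have [e1 e2 e3 _] := ord4_eqs i.
have E x a b : x = p + a *: u + b *: w -> kite_x x = a /\ kite_y x = b.
  by move=> ->; exact: kite_coordE.
by split; apply: E; rewrite ?e1 ?e2 ?e3 ?(kite0 H) ?(kite1 H) ?(kite2 H) ?(kite3 H); plane_eq.
Qed.

(** The second alternative covers [j = k] and the straight angles: for [kappa = -1] the vertex [v i]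
    is the midpoint of its neighbours and the sides [i] and [i + 3] are collinear; for [kappa = 1]
    the same happens at [v (i + 2)] to the sides [i + 1] and [i + 2]. *)
Lemma kite_side_positive (j k : 'I_4) :
  (forall t : R, 0 < t -> t < 1 -> 0 < side_coord v K j (v k + t *: (v (k + 1) - v k)))
  \/ (forall x, side_coord v K j x = side_coord v K k x).
Proof.
have [c0 c1 c2 c3] := kite_side_coord.
have k1 := kite_ge H; have k2 := kite_le H.
have ge_or : 0 < 1 + kappa \/ kappa = -1.
  by have [|?] := ltP 0 (1 + kappa); [left|right; lra].
have le_or : 0 < 1 - kappa \/ kappa = 1.
  by have [|?] := ltP 0 (1 - kappa); [left|right; lra].
move: j; apply: (@forall_ord4_shift i); move: k; apply: (@forall_ord4_shift i);
  try (by right);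
  try (by left=> t t0 t1; have [[x0 y0] [x1 y1] [x2 y2] [x3 y3]] := kite_side_xi t;
    rewrite ?c0 ?c1 ?c2 ?c3 ?x0 ?y0 ?x1 ?y1 ?x2 ?y2 ?x3 ?y3; nra);
  try (case: ge_or => [g|kE]; [left|by right=> x; rewrite ?c0 ?c1 ?c2 ?c3 kE; ring];
    by move=> t t0 t1; have [[x0 y0] [x1 y1] [x2 y2] [x3 y3]] := kite_side_xi t;
    rewrite ?c0 ?c1 ?c2 ?c3 ?x0 ?y0 ?x1 ?y1 ?x2 ?y2 ?x3 ?y3; nra);
  try (case: le_or => [g|kE]; [left|by right=> x; rewrite ?c0 ?c1 ?c2 ?c3 kE; ring];
    by move=> t t0 t1; have [[x0 y0] [x1 y1] [x2 y2] [x3 y3]] := kite_side_xi t;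
    rewrite ?c0 ?c1 ?c2 ?c3 ?x0 ?y0 ?x1 ?y1 ?x2 ?y2 ?x3 ?y3; nra).
Qed.

Lemma kite_boundary x : quad_boundary v x <->
  (forall k, 0 <= side_coord v K k x) /\ exists k, side_coord v K k x = 0.
Proof.
have [c0 c1 c2 c3] := kite_side_coord.
have k1 := kite_ge H; have k2 := kite_le H; split.
- move=> [k _ [t]]; rewrite /= in_itv /= => /andP[t0 t1] <-; split; last first.
    exists k; rewrite /side_coord /det2; plane_unfold.
    by apply/eqP; rewrite mulf_eq0; apply/orP; left; apply/eqP; ring.
  have [[x0 y0] [x1 y1] [x2 y2] [x3 y3]] := kite_side_xi t.
  move: k; apply: (@forall_ord4_shift i); apply: (@forall_ord4_shift i);
    rewrite ?c0 ?c1 ?c2 ?c3 ?x0 ?y0 ?x1 ?y1 ?x2 ?y2 ?x3 ?y3; nra.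
- move=> [ge0 [k]].
  have g0 := ge0 i; have g1 := ge0 (i + 1); have g2 := ge0 (i + 2); have g3 := ge0 (i + 3).
  rewrite c0 in g0; rewrite c1 in g1; rewrite c2 in g2; rewrite c3 in g3.
  have ex := kite_coord x.
  have [e1 e2 e3 _] := ord4_eqs i.
  set a := kite_x x in ex c0 c1 c2 c3 g0 g1 g2 g3.
  have side j t : 0 <= t -> t <= 1 -> x = v j + t *: (v (j + 1) - v j) ->
      quad_boundary v x.
    by move=> t0 t1 E; exists j => //; exists t; rewrite /= ?in_itv /= ?t0.
  pose b := kite_y x.
  have S0 : b <= 0 -> -1 <= b -> a = -1 - (1 + kappa) * b -> quad_boundary v x.
    move=> b0 b1 aE; apply: (side i (- b));  [lra|lra|].
    rewrite {1}ex (kite0 H) (kite1 H) -/a -/b aE; plane_eq.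
  have S1 : b <= 0 -> -1 <= b -> a = 1 + (1 - kappa) * b -> quad_boundary v x.
    move=> b0 b1 aE; apply: (side (i + 1) (1 + b));  [lra|lra|].
    rewrite {1}ex e1 (kite1 H) (kite2 H) -/a -/b aE; plane_eq.
  have S2 : 0 <= b -> b <= 1 -> a = 1 - (1 - kappa) * b -> quad_boundary v x.
    move=> b0 b1 aE; apply: (side (i + 2) b);  [lra|lra|].
    rewrite {1}ex e2 (kite2 H) (kite3 H) -/a -/b aE; plane_eq.
  have S3 : 0 <= b -> b <= 1 -> a = -1 + (1 + kappa) * b -> quad_boundary v x.
    move=> b0 b1 aE; apply: (side (i + 3) (1 - b));  [lra|lra|].
    rewrite {1}ex e3 (kite3 H) (kite0 H) -/a -/b aE; plane_eq.
  have bb : -1 <= b <= 1 by rewrite /b; lra.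
  have /andP[b1 b2] := bb.
  rewrite -/b in g0 g1 g2 g3.
  (* The sign of [b] leaves two candidate sides. When the vanishing coordinate belongs to a side of
     the other half, the inequality of the adjacent candidate turns into an equality. *)
  have [b0|b0] := leP b 0.
  + move: k; apply: (@forall_ord4_shift i); rewrite ?c0 ?c1 ?c2 ?c3 -/a -/b => Ek.
    * by apply: S0 => //; lra.
    * by apply: S1 => //; lra.
    * by apply: S1 => //; nra.
    * by apply: S0 => //; nra.
  + have b0' := ltW b0.
    move: k; apply: (@forall_ord4_shift i); rewrite ?c0 ?c1 ?c2 ?c3 -/a -/b => Ek.
    * by apply: S3 => //; nra.
    * by apply: S2 => //; nra.
    * by apply: S2 => //; lra.
    * by apply: S3 => //; lra.
Qed.

Lemma kite_sector_coord : [/\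
  forall x, det2 (x - p) (v (i + 1) - p) / K = - kite_x x - kappa * kite_y x /\
            det2 (v i - p) (x - p) / K = - kite_y x,
  forall x, det2 (x - p) (v (i + 1 + 1) - p) / K = - kite_y x /\
            det2 (v (i + 1) - p) (x - p) / K = kite_x x + kappa * kite_y x,
  forall x, det2 (x - p) (v (i + 2 + 1) - p) / K = kite_x x - kappa * kite_y x /\
            det2 (v (i + 2) - p) (x - p) / K = kite_y x &
  forall x, det2 (x - p) (v (i + 3 + 1) - p) / K = kite_y x /\
            det2 (v (i + 3) - p) (x - p) / K = kappa * kite_y x - kite_x x].
Proof.
have K0 := kite_det H; have [e1 e2 e3 _] := ord4_eqs i.
by split => x; rewrite ?e1 ?e2 ?e3 ?(kite0 H) ?(kite1 H) ?(kite2 H)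
  ?(kite3 H); move: (kite_coord x); move: (kite_x x) (kite_y x) => a b ->;
  move: K0; rewrite /K /det2; plane_unfold => K0; split; field.
Qed.

End KiteCoordinates.

(** The cone at [p] between the rays to [v k] and [v (k + 1)], described by the coordinates of
    [x - p] along these two vectors. It contains the first ray but neither the second nor [p], so
    that the four cones partition the rest of the plane. *)
Definition sector (R : realType) (v : 'I_4 -> plane R) (p : plane R) (K : R)
    (k : 'I_4) : set (plane R) :=
  [set x | 0 < det2 (x - p) (v (k + 1) - p) / K /\ 0 <= det2 (v k - p) (x - p) / K].

(** Interface between geometry and analysis, free of the parameters of [kite]. [K] is twice the
    common oriented area of the triangles with apex [p]. *)
Record balanced_quadrilateral (R : realType) (v : 'I_4 -> plane R) (p : plane R)
    (K : R) : Prop := BalancedQuadrilateral {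
  balanced_neq0 : K != 0 ;
  balanced_triangles : forall k, det2 (v k - p) (v (k + 1) - v k) = K ;
  balanced_boundary : forall x, quad_boundary v x <->
    (forall k, 0 <= side_coord v K k x) /\ exists k, side_coord v K k x = 0 ;
  balanced_side : forall j k,
    (forall t : R, 0 < t -> t < 1 ->
       0 < side_coord v K j (v k + t *: (v (k + 1) - v k))) \/
    (forall x, side_coord v K j x = side_coord v K k x) ;
  balanced_bounded : exists B : R, forall x, (forall k, 0 <= side_coord v K k x) ->
    `|x.1| <= B /\ `|x.2| <= B ;
  balanced_sector : forall x, x != p -> exists k, sector v p K k x ;
  balanced_sector_inj : forall x j k,
    sector v p K j x -> sector v p K k x -> j = k ;
  balanced_sector_side : forall x k, sector v p K k x -> 0 < side_coord v K k x ->
    forall j, 0 < side_coord v K j x }.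

Lemma kite_balanced (R : realType) (v : 'I_4 -> plane R) (i : 'I_4) (p u w : plane R)
    (kappa : R) : kite v i p u w kappa ->
  balanced_quadrilateral v p (det2 u w).
Proof.
move=> H; have [c0 c1 c2 c3] := kite_side_coord H.
have [s0 s1 s2 s3] := kite_sector_coord H.
have k1 := kite_ge H; have k2 := kite_le H.
split.
- exact: kite_det H.
- exact: kite_triangles H.
- exact: kite_boundary H.
- exact: kite_side_positive H.
- exists (`|p.1| + `|p.2| + (`|u.1| + `|u.2|) + (`|w.1| + `|w.2|)) => x Hx.
  have := Hx i; have := Hx (i + 1); have := Hx (i + 2); have := Hx (i + 3).
  rewrite c0 c1 c2 c3 => h3 h2 h1 h0.
  have : `|kite_y p u w x| <= 1 by rewrite ler_norml; lra.
  have : `|kite_x p u w x| <= 1 by rewrite ler_norml; nra.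
  have E1 := congr1 fst (kite_coord H x); have E2 := congr1 snd (kite_coord H x).
  move: E1 E2; plane_unfold; move: (kite_x _ _ _ _) (kite_y _ _ _ _) => a b -> -> a1 b1.
  have T (r s t : R) : `|r + a * s + b * t| <= `|r| + `|s| + `|t|.
    apply: le_trans (ler_normD _ _) _; rewrite lerD //; last first.
      by rewrite normrM ler_piMl.
    apply: le_trans (ler_normD _ _) _; rewrite lerD // normrM ler_piMl //.
  have := normr_ge0 p.1; have := normr_ge0 p.2; have := normr_ge0 u.1.
  have := normr_ge0 u.2; have := normr_ge0 w.1; have := normr_ge0 w.2.
  by split; apply: le_trans (T _ _ _) _; lra.
- move=> x xp; rewrite /sector /=.
  have [y0|y0|y0] := ltgtP (kite_y p u w x) 0.
  + have [z0|z0] := ltP (kite_x p u w x + kappa * kite_y p u w x) 0.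
      by exists i; have [-> ->] := s0 x; lra.
    by exists (i + 1); have [-> ->] := s1 x; lra.
  + have [z0|z0] := ltP 0 (kite_x p u w x - kappa * kite_y p u w x).
      by exists (i + 2); have [-> ->] := s2 x; lra.
    by exists (i + 3); have [-> ->] := s3 x; lra.
  + have [z0|z0|z0] := ltgtP (kite_x p u w x) 0.
    * by exists i; have [-> ->] := s0 x; rewrite y0; lra.
    * by exists (i + 2); have [-> ->] := s2 x; rewrite y0; lra.
    * case/eqP: xp; rewrite (kite_coord H x) y0 z0; plane_eq.
- move=> x; rewrite /sector /=.
  have [a0 b0] := s0 x; have [a1 b1] := s1 x; have [a2 b2] := s2 x; have [a3 b3] := s3 x.
  apply: (@forall_ord4_shift i); apply: (@forall_ord4_shift i) => //;
    rewrite ?a0 ?b0 ?a1 ?b1 ?a2 ?b2 ?a3 ?b3 => -[h1 h2] [h3 h4]; exfalso; nra.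
- move=> x k; move: k; rewrite /sector /=.
  have [a0 b0] := s0 x; have [a1 b1] := s1 x; have [a2 b2] := s2 x; have [a3 b3] := s3 x.
  apply: (@forall_ord4_shift i) => -[];
    rewrite ?a0 ?b0 ?a1 ?b1 ?a2 ?b2 ?a3 ?b3 ?c0 ?c1 ?c2 ?c3 => h1 h2 h3;
    apply: (@forall_ord4_shift i); rewrite ?c0 ?c1 ?c2 ?c3; nra.
Qed.

(** Gradient of the affine function [side_coord v K k]: a normal that is not normalized, pointing
    inwards for either orientation thanks to the division by [K]. *)
Definition side_normal (R : realType) (v : 'I_4 -> plane R) (K : R) (k : 'I_4) :
    plane R :=
  K^-1 *: - perp (v (k + 1) - v k).

Lemma side_coordE (R : realType) (v : 'I_4 -> plane R) (K : R) (k : 'I_4) x :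
  side_coord v K k x = dotp (x - v k) (side_normal v K k).
Proof. by rewrite /side_coord /side_normal /det2; plane_ring. Qed.

(** [side_coord v K k] is affine and equals [1] at [p], which is the equality of the four areas. *)
Lemma side_coord_ray (R : realType) (v : 'I_4 -> plane R) p K k x (s : R) :
  balanced_quadrilateral v p K ->
  side_coord v K k (p + s *: (x - p)) = 1 - s * (1 - side_coord v K k x).
Proof.
move=> B; have := balanced_neq0 B; have := balanced_triangles B k.
rewrite /side_coord; move: (v (k + 1) - v k) => z <-; rewrite /det2; plane_unfold => K0.
by field.
Qed.

(** From a point outside, the ray away from [p] keeps a negative side coordinate negative, so it
    escapes to infinity without meeting the boundary. Conversely the polygon is open, and closed
    relative to the complement of the boundary, so the component of any of its points stays in it
    and is bounded. *)
Lemma quad_region_polygon (R : realType) (v : 'I_4 -> plane R) p K :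
  balanced_quadrilateral v p K ->
  quad_region v = polygon v (side_normal v K).
Proof.
move=> B; apply/seteqP; split=> x.
- move=> [nbd bnd] k; rewrite -side_coordE ltNge; apply/negP => lek.
  (* [x] is off the boundary, so a nonpositive coordinate forces some coordinate, perhaps another
     one, to be strictly negative. *)
  have [j jlt] : exists j, side_coord v K j x < 0.
    apply: contrapT => /forallNP nj; apply: nbd; apply/(balanced_boundary B).
    split=> [j|]; first by rewrite leNgt; apply/negP; exact: nj.
    exists k; apply/eqP; rewrite eq_le lek leNgt /=; apply/negP; exact: nj.
  have xp : x - p != 0.
    apply/eqP => xp0; have := side_coord_ray j x 0 B.
    rewrite xp0 scaler0 addr0 -[in X in _ - _ * (_ - X)](subrK p x) xp0 add0r.
    move=> E; have := E; rewrite mul0r subr0 => E1.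
    by move: jlt; rewrite -(subrK p x) xp0 add0r E1; lra.
  pose ray := [set p + s *: (x - p) | s in `[1, +oo[].
  have cray : connected ray.
    apply: connected_continuous_connected.
      by apply/connected_intervalP; exact: interval_is_interval.
    apply: continuous_subspaceT => s; apply: cvgD; first exact: cvg_cst.
    exact: scalel_continuous.
  have subray : ray `<=` connected_component (~` quad_boundary v) x.
    apply: connected_component_max => //.
      by exists 1; [rewrite /= in_itv /= lexx|rewrite scale1r addrC subrK].
    move=> _ [s + <-] /(balanced_boundary B)[/(_ j) + _].
    by rewrite /= in_itv /= andbT (side_coord_ray _ _ _ B) => s1; nra.
  move: bnd => [M [_ /(_ (`|M| + 1))]].
  have Mlt : M < `|M| + 1 by have := ler_norm M; lra.
  move=> /(_ Mlt) bnd.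
  have x0 : 0 < `|x - p| by rewrite normr_gt0.
  (* This makes the norm of [s *: (x - p)] equal to [|x - p| + |M| + 2 + |p|], beyond [|M| + 1] even
     after subtracting [|p|]. *)
  pose s := 1 + (`|M| + 2 + `|p|) / `|x - p|.
  have s1 : 1 <= s by rewrite lerDl divr_ge0 // addr_ge0 // addr_ge0.
  have : `|p + s *: (x - p)| <= `|M| + 1.
    by apply: bnd; apply: subray; exists s => //; rewrite /= in_itv /= s1.
  have : `|s *: (x - p)| <= `|p + s *: (x - p)| + `|p|.
    by rewrite -{1}(addKr p (s *: (x - p))) addrC (le_trans (ler_normB _ _)).
  rewrite normrZ (ger0_norm (le_trans ler01 s1)) /s mulrDl mul1r divfK ?gt_eqF //.
  lra.
- move=> Qx.
  have Qx' k : 0 < side_coord v K k x by rewrite side_coordE; exact: Qx.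
  have nb y : polygon v (side_normal v K) y -> ~ quad_boundary v y.
    move=> Qy /(balanced_boundary B)[_ [k yk]].
    by have := Qy k; rewrite -side_coordE yk ltxx.
  have nbc y : ~ quad_boundary v y -> closed_polygon v (side_normal v K) y ->
      polygon v (side_normal v K) y.
    move=> ny Qy k; rewrite lt_neqAle Qy andbT eq_sym; apply/eqP => yk; apply: ny.
    apply/(balanced_boundary B); split=> [j|]; first by rewrite side_coordE; exact: Qy.
    by exists k; rewrite side_coordE.
  have clQ : closed (closed_polygon v (side_normal v K)).
    pose F k := [set x : plane R | 0 <= dotp (x - v k) (side_normal v K k)].
    rewrite (_ : closed_polygon _ _ = F 0 `&` F 1 `&` F 2 `&` F 3).
      by do ?apply: closedI; exact: closed_halfplane.
    apply/seteqP; split=> y /=; first by move=> h; do !split; exact: h.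
    by case=> [[[? ?] ?] ?]; exact: forall_ord4.
  have nx := nb x Qx; split => //.
  set C := connected_component _ x.
  have Csub : C `<=` ~` quad_boundary v by exact: connected_component_sub.
  have CE : C `&` polygon v (side_normal v K) = C.
    apply: (@component_connected _ (~` quad_boundary v) x).
    + by exists x; split => //; exact: connected_component_refl.
    + by exists (polygon v (side_normal v K)); [exact: polygon_open|].
    + exists (closed_polygon v (side_normal v K)) => //.
      apply/seteqP; split=> y [Cy Py]; split => //; first exact: polygonW.
      by apply: nbc => //; exact: Csub.
  have [M HM] := balanced_bounded B.
  exists M; split; first exact: num_real.
  move=> y My z; rewrite -CE => -[_ Pz].
  have [|z1 z2] := HM z; first by move=> k; rewrite side_coordE ltW.
  by rewrite /= prod_normE ge_max (le_trans z1 (ltW My)) (le_trans z2 (ltW My)).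
Qed.

(** * Integration over triangles *)

(** The pushforward rescaled by [|a|] gives every interval []x, y]] its length, and these values
    determine Lebesgue measure. *)
Lemma lebesgue_measure_affine (R : realType) (a b : R) (A : set R) : a != 0 ->
  measurable A -> pushforward (@lebesgue_measure R)
    ((fun x : R => a * x + b) : _ -> measurableTypeR R) A =
  (`|a|^-1%:E * @lebesgue_measure R A)%E.
Proof.
move=> a0 mA.
have na0 : 0 < `|a| by rewrite normr_gt0.
have mphi : measurable_fun setT ((fun x : R => a * x + b) : _ -> measurableTypeR R).
  by apply: measurable_funD => //; exact: measurable_funM.
have E : forall B : set R, measurable B -> @lebesgue_measure R B =
    pushforward (mscale (NngNum (ltW na0)) (@lebesgue_measure R))
      ((fun x : R => a * x + b) : _ -> measurableTypeR R) B.
  move=> B mB; apply: lebesgue_measure_unique => //= _ [[x y]] _ <-.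
  rewrite /pushforward /= /mscale /=.
  have [a_gt0|a_lt0] := ltP 0 a.
  - rewrite (_ : _ @^-1` _ = [set` `](x - b) / a, (y - b) / a]]); last first.
      apply/seteqP; split=> z; rewrite /= !in_itv /= => /andP[h1 h2].
        by rewrite ltr_pdivrMr // ler_pdivlMr // ltrBlDr lerBrDr mulrC h1.
      by move: h1 h2; rewrite ltr_pdivrMr // ler_pdivlMr // ltrBlDr lerBrDr mulrC => ->.
    rewrite !lebesgue_measure_itv /= !lte_fin ltr_pM2r ?invr_gt0 // ltrD2r.
    case: ifP => _; rewrite ?mule0 // gtr0_norm //=.
    by congr EFin; field.
  - have {}a_lt0 : a < 0 by rewrite lt_neqAle a0.
    rewrite (_ : _ @^-1` _ = [set` `[(y - b) / a, (x - b) / a[]); last first.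
      apply/seteqP; split=> z; rewrite /= !in_itv /= => /andP[h1 h2].
        by rewrite ler_ndivrMr // ltr_ndivlMr // ltrBlDr lerBrDr mulrC h1 h2.
      by move: h1 h2; rewrite ler_ndivrMr // ltr_ndivlMr // ltrBlDr lerBrDr mulrC => -> ->.
    rewrite !lebesgue_measure_itv /= !lte_fin ltr_nM2r ?invr_lt0 // ltrD2r.
    case: ifP => _; rewrite ?mule0 // ltr0_norm //=.
    by congr EFin; field.
by rewrite E // /pushforward /mscale /= muleA -EFinM mulVf ?gt_eqF // mul1e.
Qed.

Lemma ge0_integral_affine (R : realType) (F : R -> \bar R) (a b : R) : a != 0 ->
  measurable_fun setT F -> (forall x, (0 <= F x)%E) ->
  (\int[@lebesgue_measure R]_x F (a * x + b)%R =
   `|a|^-1%:E * \int[@lebesgue_measure R]_x F x)%E.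
Proof.
move=> a0 mF F0.
have mphi : measurable_fun setT ((fun x : R => a * x + b) : measurableTypeR R -> measurableTypeR R).
  by apply: measurable_funD => //; exact: measurable_funM.
have na0 : 0 <= `|a|^-1 by rewrite invr_ge0.
have := @ge0_integral_pushforward _ _ _ _ _ _ mphi (@lebesgue_measure R) setT F measurableT mF (fun y _ => F0 y).
rewrite preimage_setT => <-.
rewrite (@eq_measure_integral _ _ _ _ (mscale (NngNum na0) (@lebesgue_measure R))).
  by rewrite ge0_integral_mscale.
by move=> A mA _; rewrite /mscale /=; exact: lebesgue_measure_affine.
Qed.

Notation mplane R := (measurableTypeR R * measurableTypeR R)%type.

Lemma measurable_fun_affine2 (R : realType) (a b e : R) :
  measurable_fun setT ((fun z => a * z.1 + b * z.2 + e) : mplane R -> measurableTypeR R).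
Proof.
apply: measurable_funD => //; apply: measurable_funD; apply: measurable_funM => //.
Qed.

Lemma ge0_integral_swap (R : realType) (F : plane R -> \bar R) :
  measurable_fun setT (F : mplane R -> \bar R) -> (forall x, (0 <= F x)%E) ->
  (\int[lebesgue2 R]_z F (z.2, z.1) = \int[lebesgue2 R]_z F z)%E.
Proof.
move=> mF F0.
have mF' : measurable_fun setT ((fun z => F (z.2, z.1)) : mplane R -> \bar R).
  apply: (measurableT_comp mF).
  by apply: measurable_fun_pair; [exact: measurable_snd|exact: measurable_fst].
rewrite /lebesgue2 fubini_tonelli1 //= (fubini_tonelli2 (F : mplane R -> \bar R)) //.
Qed.

(** Gaussian elimination: an affine substitution in the first variable, an exchange of the
    integrations, a substitution in the second variable. The pivots [a] and [d - b * c / a] multiply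
    to the determinant. *)
Lemma ge0_integral_linear_aux (R : realType) (F : plane R -> \bar R)
    (a b c d e1 e2 : R) : a != 0 -> a * d - b * c != 0 ->
  measurable_fun setT (F : mplane R -> \bar R) -> (forall x, (0 <= F x)%E) ->
  (\int[lebesgue2 R]_z F (a * z.1 + b * z.2 + e1, c * z.1 + d * z.2 + e2)%R =
   `|a * d - b * c|^-1%:E * \int[lebesgue2 R]_z F z)%E.
Proof.
move=> a0 D0 mF F0.
have comp (a' b' c' d' e e' : R) : measurable_fun setT
    ((fun z => F (a' * z.1 + b' * z.2 + e, c' * z.1 + d' * z.2 + e')) : mplane R -> \bar R).
  apply: (measurableT_comp mF).
  by apply: measurable_fun_pair; exact: measurable_fun_affine2.
rewrite /lebesgue2 fubini_tonelli2; [|exact: comp a b c d e1 e2|by move=> z; exact: F0].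
rewrite /fubini_G /=.
pose H (z : plane R) := F (z.1, c / a * z.1 + (d - b * c / a) * z.2 + (e2 - c * e1 / a)).
have mH : measurable_fun setT (H : mplane R -> \bar R).
  have := comp 1 0 (c / a) (d - b * c / a) 0 (e2 - c * e1 / a).
  by under eq_fun do rewrite mul1r mul0r !addr0.
have H0 z : (0 <= H z)%E by exact: F0.
have inner1 (t : R) : (\int[@lebesgue_measure R]_s
     F (a * s + b * t + e1, c * s + d * t + e2)%R =
    `|a|^-1%:E * \int[@lebesgue_measure R]_s H (s, t))%E.
  rewrite -(ge0_integral_affine (b * t + e1) a0);
    try (by move=> x; exact: F0); try exact: (@measurable_fun_pair1 _ _ _ (measurableTypeR R) (measurableTypeR R) _ H t mH).
  apply: eq_integral => s _; rewrite /H /=; congr (F (_, _)); first by rewrite addrA.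
  by field.
under eq_integral do rewrite inner1.
have iH t : (0 <= \int[@lebesgue_measure R]_s H (s, t))%E by apply: integral_ge0 => s _; exact: F0.
rewrite ge0_integralZl //; last first.
  exact: (measurable_fun_fubini_tonelli_G (m1 := @lebesgue_measure R) (H : mplane R -> \bar R) mH H0).
rewrite -(fubini_tonelli (H : mplane R -> \bar R)) //.
have d0 : d - b * c / a != 0.
  have -> : d - b * c / a = (a * d - b * c) / a by field.
  by rewrite mulf_neq0 // invr_neq0.
have inner2 (s : R) : (\int[@lebesgue_measure R]_t H (s, t) =
    `|d - b * c / a|^-1%:E * \int[@lebesgue_measure R]_t F (s, t))%E.
  rewrite -(ge0_integral_affine (c / a * s + (e2 - c * e1 / a)) d0);
    try (by move=> x; exact: F0); try exact: (@measurable_fun_pair2 _ _ _ (measurableTypeR R) (measurableTypeR R) _ F s mF).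
  by apply: eq_integral => t _; rewrite /H /=; congr (F (_, _)); ring.
under eq_integral do rewrite inner2.
rewrite ge0_integralZl //; try (by move=> s _; apply: integral_ge0 => t _; exact: F0);
  try exact: (measurable_fun_fubini_tonelli_F (m2 := @lebesgue_measure R) (F : mplane R -> \bar R) mF F0).
rewrite fubini_tonelli1 // muleA -EFinM; congr (_%:E * _)%E.
rewrite -invfM -normrM; congr (`|_|^-1); field; exact: a0.
Qed.

Lemma ge0_integral_linear (R : realType) (F : plane R -> \bar R)
    (p A B : plane R) : det2 A B != 0 ->
  measurable_fun setT (F : mplane R -> \bar R) -> (forall x, (0 <= F x)%E) ->
  (\int[lebesgue2 R]_z F (p + z.1 *: A + z.2 *: B)%R =
   `|det2 A B|^-1%:E * \int[lebesgue2 R]_z F z)%E.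
Proof.
rewrite /det2 => D0 mF F0.
have E z : p + z.1 *: A + z.2 *: B =
    (A.1 * z.1 + B.1 * z.2 + p.1, A.2 * z.1 + B.2 * z.2 + p.2).
  by plane_eq.
under eq_integral do rewrite E.
(* A zero pivot is replaced by [B.1] through an exchange of the two variables, which only flips the
   sign of the determinant. *)
have [A0|A0] := eqVneq A.1 0; last first.
  have D0' : A.1 * B.2 - B.1 * A.2 != 0 by rewrite (mulrC B.1).
  by rewrite (@ge0_integral_linear_aux _ F) // (mulrC B.1).
have B0 : B.1 != 0 by apply: contraNneq D0 => ->; rewrite A0 mul0r mulr0 subrr.
have D0' : B.1 * A.2 - A.1 * B.2 != 0.
  by rewrite -oppr_eq0 opprB (mulrC B.1).
transitivity (\int[lebesgue2 R]_z F (B.1 * z.1 + A.1 * z.2 + p.1, B.2 * z.1 + A.2 * z.2 + p.2)%R)%E.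
  rewrite -(@ge0_integral_swap _ (fun z => F (B.1 * z.1 + A.1 * z.2 + p.1, B.2 * z.1 + A.2 * z.2 + p.2))) //.
    by apply: eq_integral => z _ /=; congr (F (_, _)); ring.
  apply: (measurableT_comp mF).
  by apply: measurable_fun_pair; exact: measurable_fun_affine2.
by rewrite (@ge0_integral_linear_aux _ F) // distrC (mulrC B.1).
Qed.

(** Measurability refers to the product of two Borel sigma-algebras. An open set is the countable
    union of the squares with rational centre and radius that it contains. *)
Lemma open_measurable_plane (R : realType) (U : set (plane R)) :
  open U -> measurable (U : set (mplane R)).
Proof.
move=> oU.
pose box (q : rat * rat * rat) : set (mplane R) :=
  ball (ratr q.1.1 : R) (ratr q.2 : R) `*` ball (ratr q.1.2 : R) (ratr q.2 : R).
pose F q := if `[< box q `<=` U >] then box q else set0.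
have -> : (U : set (mplane R)) = \bigcup_q F q.
  apply/seteqP; split=> [x Ux|x [q _]]; last first.
    by rewrite /F; case: ifPn => // /asboolP; exact.
  have [d d0 Hd] := nbhs_box (open_nbhs_nbhs (conj oU Ux)).
  have near (r : R) : exists q : rat, `|r - ratr q| < d / 4.
    have [|q /itvP hq] := @rat_in_itvoo _ (r - d / 4) (r + d / 4); first by lra.
    exists q; have /andP[h1 h2] : r - d / 4 < ratr q < r + d / 4 by rewrite !hq.
    by rewrite ltr_norml; lra.
  have [q1 h1] := near x.1; have [q2 h2] := near x.2.
  (* The centre is within [d / 4] of [x] and the radius between [d / 4] and [d / 2], so the square
     contains [x] and stays within [d] of it. *)
  have [|e /itvP he] := @rat_in_itvoo _ (d / 4) (d / 2); first by lra.
  have /andP[e1 e2] : d / 4 < ratr e < d / 2 by rewrite !he.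
  exists (q1, q2, e) => //; rewrite /F asboolT; last first.
    move=> y [/= y1 y2]; rewrite (_ : y = (x.1 + (y.1 - x.1), x.2 + (y.2 - x.2))).
      apply: Hd.
      - by move: y1 h1; rewrite /ball /= !ltr_norml; lra.
      - by move: y2 h2; rewrite /ball /= !ltr_norml; lra.
    by rewrite !(addrC _ (_ - _)) !subrK -surjective_pairing.
  by split=> /=; rewrite /ball /= distrC; exact: lt_trans e1.
apply: countable_bigcupT_measurable => // q.
rewrite /F; case: ifPn => // _.
by apply: measurableX; apply: open_measurable; exact: ball_open.
Qed.

Lemma open_continuous_measurable_plane (R : realType) (U : set (plane R))
    (g : plane R -> R) : open U -> (forall x, U x -> {for x, continuous g}) ->
  measurable_fun (U : set (mplane R)) (g : mplane R -> R).
Proof.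
move=> oU cg; apply: (measurability _ (RGenOpens.measurableE R)).
move=> _ [_ [a [b ->] <-]]; apply: open_measurable_plane.
rewrite openE => x [Ux gx]; apply: filterI; first exact: open_nbhs_nbhs.
apply: cg => //; exact: open_nbhs_nbhs (conj (interval_open _ _) gx).
Qed.

Definition coord1 (R : realType) (p A B x : plane R) : R :=
  det2 (x - p) B / det2 A B.
Definition coord2 (R : realType) (p A B x : plane R) : R :=
  det2 A (x - p) / det2 A B.

Lemma coordE (R : realType) (p A B : plane R) (s t : R) : det2 A B != 0 ->
  coord1 p A B (p + s *: A + t *: B) = s /\ coord2 p A B (p + s *: A + t *: B) = t.
Proof.
by rewrite /coord1 /coord2 /det2 => D; split; plane_unfold; field.
Qed.

Lemma coordK (R : realType) (p A B x : plane R) : det2 A B != 0 ->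
  x = p + coord1 p A B x *: A + coord2 p A B x *: B.
Proof.
rewrite /coord1 /coord2 /det2 => D.
by apply: injective_projections; plane_unfold; field.
Qed.

Lemma measurable_coord (R : realType) (p A B : plane R) :
  measurable_fun setT (coord1 p A B : mplane R -> measurableTypeR R) /\
  measurable_fun setT (coord2 p A B : mplane R -> measurableTypeR R).
Proof.
split.
- rewrite (_ : coord1 p A B = fun z => (B.2 / det2 A B) * z.1 + (- B.1 / det2 A B) * z.2 +
     (- (p.1 * B.2 - p.2 * B.1) / det2 A B)); first exact: measurable_fun_affine2.
  by apply/funext => z; rewrite /coord1 {1}/det2; plane_ring.
- rewrite (_ : coord2 p A B = fun z => (- A.2 / det2 A B) * z.1 + (A.1 / det2 A B) * z.2 +
     (- (A.1 * p.2 - A.2 * p.1) / det2 A B)); first exact: measurable_fun_affine2.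
  by apply/funext => z; rewrite /coord2 {1}/det2; plane_ring.
Qed.

(* Half open, so that the sectors of a quadrilateral are disjoint. *)
Definition half_triangle (R : realType) (p A B : plane R) : set (plane R) :=
  [set x | [/\ 0 < coord1 p A B x, coord1 p A B x < 1, 0 <= coord2 p A B x &
               coord2 p A B x < coord1 p A B x]].

Lemma measurable_half_triangle (R : realType) (p A B : plane R) :
  measurable (half_triangle p A B : set (mplane R)).
Proof.
have [m1 m2] := measurable_coord p A B.
have m3 : measurable_fun setT
    ((fun x => coord1 p A B x - coord2 p A B x) : mplane R -> measurableTypeR R).
  exact: measurable_funB.
rewrite (_ : half_triangle p A B =
  (coord1 p A B @^-1` `]0, 1[) `&` (coord2 p A B @^-1` `[0, +oo[) `&`
  ((fun x => coord1 p A B x - coord2 p A B x) @^-1` `]0, +oo[)); last first.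
  apply/seteqP; split=> x; rewrite /half_triangle /= !in_itv /= !andbT subr_gt0.
    by move=> [-> -> -> ->].
  by move=> [[/andP[-> ->] ->] ->].
apply: measurableI; [apply: measurableI|]; rewrite -[X in measurable X]setTI;
  [exact: m1|exact: m2|exact: m3].
Qed.

(** The linear coordinates give the factor [|det2 A B|]. Replacing [t] by [s * t] for fixed [s] adds
    the factor [s] and turns [0 <= t < s] into [0 <= t < 1]. *)
Lemma integral_half_triangle (R : realType) (p A B : plane R) (F : plane R -> \bar R) :
  det2 A B != 0 -> measurable_fun setT (F : mplane R -> \bar R) ->
  (forall x, (0 <= F x)%E) ->
  (\int[lebesgue2 R]_(x in half_triangle p A B) F x =
   `|det2 A B|%:E * \int[@lebesgue_measure R]_(s in `]0%R, 1%R[)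
     (s%:E * \int[@lebesgue_measure R]_(t in `[0%R, 1%R[) F (p + s *: (A + t *: B))%R))%E.
Proof.
move=> D0 mF F0; set T := half_triangle p A B.
have mT : measurable (T : set (mplane R)) := @measurable_half_triangle R p A B.
have mFT : measurable_fun setT ((F \_ T) : mplane R -> \bar R).
  by apply/(measurable_restrictT _ mT); exact: measurable_funTS.
have FT0 x : (0 <= (F \_ T) x)%E by rewrite patchE; case: ifP.
have mH : measurable_fun setT ((fun z => (F \_ T) (p + z.1 *: A + z.2 *: B)) : mplane R -> \bar R).
  apply: (measurableT_comp mFT).
  rewrite (_ : (fun z => _) = fun z => (A.1 * z.1 + B.1 * z.2 + p.1, A.2 * z.1 + B.2 * z.2 + p.2)).
    by apply: measurable_fun_pair; exact: measurable_fun_affine2.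
  by apply/funext => z; plane_eq.
have n0 : 0 < `|det2 A B| by rewrite normr_gt0.
have -> : (\int[lebesgue2 R]_(x in T) F x = `|det2 A B|%:E *
    \int[lebesgue2 R]_z (F \_ T) (p + z.1 *: A + z.2 *: B)%R)%E.
  rewrite (ge0_integral_linear p D0 mFT FT0) muleA -EFinM divff ?gt_eqF // mul1e.
  exact: integral_mkcond.
congr (_ * _)%E.
rewrite /lebesgue2 fubini_tonelli1 //= [RHS]integral_mkcond.
apply: eq_integral => s _; rewrite patchE /fubini_F /=.
have TE t : T (p + s *: A + t *: B) <-> [/\ 0 < s, s < 1, 0 <= t & t < s].
  by rewrite /T /half_triangle /=; have [-> ->] := coordE p s t D0.
case: ifPn => [/set_mem|/negP] s01; last first.
  under eq_integral => t _.
    rewrite patchE memNset; last first.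
      by move=> /TE[h1 h2 _ _]; apply: s01; rewrite inE /= in_itv /= h1.
    over.
  exact: integral0.
move: s01; rewrite /= in_itv /= => /andP[s0 s1].
have sn0 : s != 0 by rewrite gt_eqF.
have mHs := @measurable_fun_pair2 _ _ _ (measurableTypeR R) (measurableTypeR R) _ _ s mH.
have := ge0_integral_affine 0 sn0 mHs (fun t => FT0 _).
rewrite /= gtr0_norm // => E.
have -> : (\int[@lebesgue_measure R]_y (F \_ T) (p + s *: A + y *: B)%R =
  s%:E * \int[@lebesgue_measure R]_x (F \_ T) (p + s *: A + (s * x + 0) *: B)%R)%E.
  by rewrite E muleA -EFinM divff // mul1e.
congr (_ * _)%E; rewrite [RHS]integral_mkcond; apply: eq_integral => t _.
have PE : p + s *: A + (s * t + 0) *: B = p + s *: (A + t *: B) by plane_eq.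
rewrite !patchE /= PE; congr (if _ then _ else _).
apply/idP/idP => /set_mem.
- rewrite -PE addr0 => /TE[_ _ h1 h2]; rewrite inE /= in_itv /=.
  by move: h1 h2; rewrite pmulr_rge0 // gtr_pMr // => -> ->.
- rewrite /= in_itv /= => /andP[t0 t1]; rewrite inE -PE addr0; apply/TE.
  by split => //; [rewrite mulr_ge0 // ltW|rewrite gtr_pMr].
Qed.

(** If [alpha] and [beta] are the cone coordinates of [x], its triangle coordinates are
    [alpha + beta] and [beta], and its side coordinate is [1 - (alpha + beta)]. *)
Lemma half_triangle_sector (R : realType) (v : 'I_4 -> plane R) p K k x :
  balanced_quadrilateral v p K ->
  half_triangle p (v k - p) (v (k + 1) - v k) x <->
  sector v p K k x /\ 0 < side_coord v K k x.
Proof.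
move=> B; have K0 := balanced_neq0 B; have KE := balanced_triangles B k.
rewrite /half_triangle /sector /=.
have E1 : coord1 p (v k - p) (v (k + 1) - v k) x =
    det2 (x - p) (v (k + 1) - p) / K + det2 (v k - p) (x - p) / K.
  by rewrite /coord1 KE /det2; plane_ring.
have E2 : coord2 p (v k - p) (v (k + 1) - v k) x = det2 (v k - p) (x - p) / K.
  by rewrite /coord2 KE.
have E3 : side_coord v K k x =
    1 - (det2 (x - p) (v (k + 1) - p) / K + det2 (v k - p) (x - p) / K).
  by apply: (mulIf K0); rewrite mulrBl mulrDl mul1r !divfK // -{1}KE /det2; plane_ring.
rewrite E1 E2 E3; split=> [[]|[[]]] *; first by (split; first split); lra.
by split; lra.
Qed.

(** The sectors cut the region into four disjoint half open triangles; the apex [p], which lies in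
    none of them, has measure zero. *)
Lemma integral_quadrilateral (R : realType) (v : 'I_4 -> plane R) p K
    (F : plane R -> \bar R) :
  balanced_quadrilateral v p K ->
  measurable_fun setT (F : mplane R -> \bar R) -> (forall x, (0 <= F x)%E) ->
  (\int[lebesgue2 R]_(x in quad_region v) F x = \sum_(k < 4)
    (`|K|%:E * \int[@lebesgue_measure R]_(s in `]0%R, 1%R[)
     (s%:E * \int[@lebesgue_measure R]_(t in `[0%R, 1%R[)
        F (p + s *: (v k - p + t *: (v (k + 1) - v k)))%R)))%E.
Proof.
move=> B mF F0.
pose T k := half_triangle p (v k - p) (v (k + 1) - v k).
have mT k : measurable (T k : set (mplane R)) by exact: measurable_half_triangle.
have mp : measurable ([set p] : set (mplane R)).
  rewrite (_ : [set p] = [set p.1] `*` [set p.2]); last first.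
    apply/seteqP; split=> x; first by move=> ->.
    by move=> [/= x1 x2]; apply: injective_projections.
  by apply: measurableX.
have mQ : measurable (quad_region v : set (mplane R)).
  by rewrite (quad_region_polygon B); apply: open_measurable_plane; exact: polygon_open.
have mp0 : lebesgue2 R [set p] = 0%E.
  rewrite (_ : [set p] = [set p.1] `*` [set p.2]); last first.
    apply/seteqP; split=> x; first by move=> ->.
    by move=> [/= x1 x2]; apply: injective_projections.
  have m1 (r : R) : measurable ([set r] : set (measurableTypeR R)) by exact: measurable_set1.
  apply: (etrans (product_measure1E (@lebesgue_measure R) (@lebesgue_measure R) (m1 p.1) (m1 p.2))).
  by rewrite /= lebesgue_measure_set1 mul0e.
rewrite (@ge0_negligible_integral _ _ _ (lebesgue2 R) _ [set p]) //; last first.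
  exact: measurable_funTS.
have -> : quad_region v `\` [set p] = \big[setU/set0]_(k <- enum 'I_4) T k.
  rewrite (quad_region_polygon B); apply/seteqP; split=> x.
  - move=> [Qx xp]; have [|k sk] := balanced_sector B (x := x); first exact/eqP.
    rewrite -bigcup_seq; exists k; first by rewrite /= mem_enum.
    by apply/(half_triangle_sector _ _ B); rewrite side_coordE.
  - rewrite -bigcup_seq => -[k _ /(half_triangle_sector _ _ B)[sk kx]]; split.
      by move=> j; rewrite -side_coordE; exact: (balanced_sector_side B sk kx j).
    move=> xp; move: sk; rewrite xp /sector /= subrr /det2 /= !mul0r subrr mul0r.
    by rewrite ltxx => -[].
rewrite ge0_integral_bigsetU //; last 3 first.
- exact: enum_uniq.
- move=> j k _ _ [x [/(half_triangle_sector _ _ B)[sj _] /(half_triangle_sector _ _ B)[sk _]]].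
  exact: (balanced_sector_inj B sj sk).
- exact: measurable_funTS.
rewrite big_enum /=; apply: eq_bigr => k _.
by rewrite integral_half_triangle // (balanced_triangles B k) ?(balanced_neq0 B).
Qed.

(** The measure of the standard triangle is kept as a common factor: the four areas are only to be
    compared with each other. *)
Lemma triangle_area (R : realType) (a b q : plane R) :
  det2 (b - a) (q - a) != 0 ->
  area (triangle a b q) = `|det2 (b - a) (q - a)| *
    fine (lebesgue2 R [set z | [/\ 0 <= z.1, 0 <= z.2 & z.1 + z.2 <= 1]]).
Proof.
move=> D0; set S := [set z : plane R | _].
have mid1 : measurable_fun setT (fst : mplane R -> measurableTypeR R) by exact: measurable_fst.
have mid2 : measurable_fun setT (snd : mplane R -> measurableTypeR R) by exact: measurable_snd.
have halfplanes (g1 g2 : mplane R -> measurableTypeR R) :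
    measurable_fun setT g1 -> measurable_fun setT g2 ->
    measurable ([set z | [/\ 0 <= g1 z, 0 <= g2 z & g1 z + g2 z <= 1]] : set (mplane R)).
  move=> m1 m2; have m3 : measurable_fun setT ((fun z => g1 z + g2 z) : mplane R -> measurableTypeR R).
    exact: measurable_funD.
  rewrite (_ : [set z | _] = (g1 @^-1` `[0, +oo[) `&` (g2 @^-1` `[0, +oo[) `&`
     ((fun z => g1 z + g2 z) @^-1` `]-oo, 1])); last first.
    apply/seteqP; split=> x; rewrite /= !in_itv /= !andbT; first by move=> [-> -> ->].
    by move=> [[-> ->] ->].
  apply: measurableI; [apply: measurableI|]; rewrite -[X in measurable X]setTI;
    [exact: m1|exact: m2|exact: m3].
have mS : measurable (S : set (mplane R)) by exact: halfplanes.
set T := triangle a b q.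
have TE : T = [set z | [/\ 0 <= coord1 a (b - a) (q - a) z,
    0 <= coord2 a (b - a) (q - a) z &
    coord1 a (b - a) (q - a) z + coord2 a (b - a) (q - a) z <= 1]].
  apply/seteqP; split=> x /=.
    by move=> [s [t [s0 t0 st ->]]]; have [-> ->] := coordE a s t D0.
  move=> [s0 t0 st]; exists (coord1 a (b - a) (q - a) x), (coord2 a (b - a) (q - a) x).
  by split => //; exact: coordK.
have mT : measurable (T : set (mplane R)).
  by rewrite TE; have [? ?] := measurable_coord a (b - a) (q - a); exact: halfplanes.
pose I x : \bar R := (\1_T x : R)%:E.
have mI : measurable_fun setT (I : mplane R -> \bar R).
  by apply/measurable_EFinP; exact: measurable_indic.
have I0 x : (0 <= I x)%E by rewrite lee_fin.
have := ge0_integral_linear a D0 mI I0.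
have -> : (\int[lebesgue2 R]_z I z = lebesgue2 R T)%E.
  by rewrite integral_indic // setIT.
have -> : (\int[lebesgue2 R]_z I (a + z.1 *: (b - a) + z.2 *: (q - a))%R
    = lebesgue2 R S)%E.
  transitivity (lebesgue2 R (S `&` setT)); last by rewrite setIT.
  rewrite -integral_indic //; apply: eq_integral => z _; rewrite /I.
  congr (_%:E); rewrite !indicE; congr ((nat_of_bool _)%:R).
  have [c1 c2] := coordE a z.1 z.2 D0.
  by apply/idP/idP => /set_mem h; rewrite inE; move: h; rewrite TE /S /= c1 c2.
move=> E; have n0 : 0 < `|det2 (b - a) (q - a)| by rewrite normr_gt0.
(* In the infinite cases [fine] returns [0] on both sides and the equation still holds. *)
rewrite /area E; move: (lebesgue2 R T) => [r| |] /=.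
- by rewrite mulrA divff ?mul1r // gt_eqF.
- by rewrite gt0_muley ?mulr0 // lte_fin invr_gt0.
- by rewrite gt0_muleNy ?mulr0 // lte_fin invr_gt0.
Qed.

Lemma integral_itv01_id (R : realType) :
  (\int[@lebesgue_measure R]_(s in `]0%R, 1%R[) s%:E = (2^-1)%:E)%E.
Proof.
rewrite -(@integral_itv_bndoo _ 0 1 _ true false) //.
rewrite (@continuous_FTC2 _ id (fun x => 2^-1 * (x * x)) 0 1) //.
- by rewrite mulr1 mulr0 mulr0 mulr1 sube0.
- by apply: continuous_subspaceT => x; exact: cvg_id.
- split.
  + by move=> x _; apply: derivableM => //; apply: derivableM.
  + apply: cvg_at_right_filter; apply: cvgMl_tmp; apply: cvgM; exact: cvg_id.
  + apply: cvg_at_left_filter; apply: cvgMl_tmp; apply: cvgM; exact: cvg_id.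
- move=> x _; rewrite derive1E deriveMl // deriveM // derive_id /=.
  by rewrite /GRing.scale /= mulr1; field.
Qed.

Lemma quad_region_area (R : realType) (v : 'I_4 -> plane R) p K :
  balanced_quadrilateral v p K -> area (quad_region v) = 2 * `|K|.
Proof.
move=> B; rewrite /area.
have mQ : measurable (quad_region v : set (mplane R)).
  by rewrite (quad_region_polygon B); apply: open_measurable_plane; exact: polygon_open.
have : (\int[lebesgue2 R]_(x in quad_region v) (cst 1%E) x = lebesgue2 R (quad_region v))%E.
  by rewrite integral_cst // mul1e.
rewrite (integral_quadrilateral B) // => <-.
rewrite (eq_bigr (fun=> (`|K| / 2)%:E)).
  by rewrite !big_ord_recl big_ord0 /=; lra.
move=> k _; rewrite EFinM; congr (_ * _)%E; rewrite -integral_itv01_id.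
apply: eq_integral => s _; rewrite integral_cst // mul1e.
by rewrite /= lebesgue_measure_itv /= lte_fin ltr01 oppr0 adde0 mule1.
Qed.

(** * Rellich's identity on a triangle *)

Lemma integral_derivative (R : realType) (F f : R -> R) (a b : R) : a < b ->
  (forall x, a <= x -> x <= b -> is_derive x 1 F (f x)) ->
  (forall x, a <= x -> x <= b -> {for x, continuous f}) ->
  (\int[@lebesgue_measure R]_(x in `[a, b]) (f x)%:E = (F b - F a)%:E)%E.
Proof.
move=> ab dF cf.
have cF x : a <= x -> x <= b -> {for x, continuous F}.
  move=> ax xb; apply: differentiable_continuous; apply/derivable1_diffP.
  by have [] := dF x ax xb.
rewrite (continuous_FTC2 ab (F := F)) ?EFinB //.
- apply: continuous_in_subspaceT => x; rewrite inE /= in_itv /= => /andP[ax xb].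
  exact: cf.
- split.
  + by move=> x; rewrite in_itv /= => /andP[/ltW ax /ltW xb]; have [] := dF x ax xb.
  + by apply: cvg_at_right_filter; apply: cF => //; exact: ltW.
  + by apply: cvg_at_left_filter; apply: cF => //; exact: ltW.
- move=> x; rewrite in_itv /= => /andP[/ltW ax /ltW xb]; rewrite derive1E.
  by have [_] := dF x ax xb.
Qed.

Lemma continuous_section1 (R : realType) (g : plane R -> R) (s t : R) :
  {for (s, t), continuous g} -> {for s, continuous (fun x => g (x, t))}.
Proof.
move=> cg; have cs : (fun x : R => x) @ s --> s by exact: cvg_id.
have ct : (fun _ : R => t) @ s --> t by exact: cvg_cst.
exact: (cvg_comp _ g (cvg_pair cs ct) cg).
Qed.

Lemma continuous_section2 (R : realType) (g : plane R -> R) (s t : R) :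
  {for (s, t), continuous g} -> {for t, continuous (fun y => g (s, y))}.
Proof.
move=> cg; have ct : (fun y : R => y) @ t --> t by exact: cvg_id.
have cs : (fun _ : R => s) @ t --> s by exact: cvg_cst.
exact: (cvg_comp _ g (cvg_pair cs ct) cg).
Qed.

(** Both iterated integrals are tied to one integral over the plane of the extension by zero; there
    integrability allows sums to be split. *)
Lemma rectangle_integrals (R : realType) (S : R) (W : set (plane R))
    (g : plane R -> R) : 0 < S -> open W ->
  (forall s t, 0 <= s -> s <= S -> 0 <= t -> t <= 1 -> W (s, t)) ->
  (forall x, W x -> {for x, continuous g}) ->
  let G : mplane R -> \bar R := (EFin \o g) \_ (`[0, S] `*` `[0, 1]) in
  [/\ (@lebesgue_measure R \x @lebesgue_measure R)%E.-integrable setT G,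
   (\int[@lebesgue_measure R]_(s in `[0%R, S]) \int[@lebesgue_measure R]_(t in `[0%R, 1%R])
     (g (s, t))%:E = \int[@lebesgue_measure R \x @lebesgue_measure R]_z G z)%E &
   (\int[@lebesgue_measure R]_(t in `[0%R, 1%R]) \int[@lebesgue_measure R]_(s in `[0%R, S])
     (g (s, t))%:E = \int[@lebesgue_measure R \x @lebesgue_measure R]_z G z)%E].
Proof.
move=> S0 oW HW cg G; set D : set (mplane R) := `[0, S] `*` `[0, 1].
have DW : D `<=` W.
  by move=> [s t] [/=]; rewrite !in_itv /= => /andP[? ?] /andP[? ?]; exact: HW.
have mD : measurable D by apply: measurableX.
have D01 s t : ((s, t) \in D) = (s \in `[0, S]%classic) && (t \in `[0, 1]%classic).
  by apply/idP/andP; rewrite !inE => -[].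
have cD : compact (D : set (plane R)).
  exact: compact_setX (@segment_compact R 0 S) (@segment_compact R 0 1).
have cgD : {within (D : set (plane R)), continuous g}.
  by apply: continuous_in_subspaceT => x; rewrite inE => /DW; exact: cg.
have [M M0 HM] := compact_norm_bound cD cgD.
have iG : (@lebesgue_measure R \x @lebesgue_measure R)%E.-integrable setT G.
  apply/(integrable_mkcond _ mD); apply: measurable_bounded_integrable => //.
  - have m1 (r : R) : measurable (`[0, r]%classic : set (measurableTypeR R)) by [].
    rewrite [X in (X < _)%E](product_measure1E (@lebesgue_measure R) (@lebesgue_measure R) (m1 S) (m1 1)).
    by rewrite /= !lebesgue_measure_itv /= !lte_fin S0 ltr01 /= ltry.
  - apply: (measurable_funS _ DW); first exact: open_measurable_plane.
    exact: open_continuous_measurable_plane.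
  - exists M; split; first exact: num_real.
    by move=> y My x Dx /=; apply: le_trans (ltW My); exact: HM.
split => //.
- rewrite -integral12_prod_meas1 // integral_mkcond; apply: eq_integral => s _.
  rewrite patchE; case: ifPn => s1.
    rewrite integral_mkcond; apply: eq_integral => t _.
    by rewrite /G !patchE D01 s1.
  rewrite /fubini_F; under eq_integral do rewrite /G patchE D01 (negbTE s1) /=.
  by rewrite integral0.
- rewrite -integral21_prod_meas1 // integral_mkcond; apply: eq_integral => t _.
  rewrite patchE; case: ifPn => t1.
    rewrite integral_mkcond; apply: eq_integral => s _.
    by rewrite /G !patchE D01 t1 andbT.
  rewrite /fubini_G; under eq_integral do rewrite /G patchE D01 (negbTE t1) andbF /=.
  by rewrite integral0.
Qed.

(** Divergence theorem on a rectangle: the fundamental theorem of calculus in each variable, then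
    Fubini. [P] and [T] are the flux densities through the lines of constant [s] and of constant
    [t]. *)
Lemma rectangle_divergence (R : realType) (S : R) (W : set (plane R))
    (P T A B : plane R -> R) : 0 < S -> open W ->
  (forall s t, 0 <= s -> s <= S -> 0 <= t -> t <= 1 -> W (s, t)) ->
  (forall x, W x -> {for x, continuous A}) ->
  (forall x, W x -> {for x, continuous B}) ->
  (forall s t, W (s, t) -> is_derive s 1 (fun x => P (x, t)) (A (s, t))) ->
  (forall s t, W (s, t) -> is_derive t 1 (fun y => T (s, y)) (B (s, t))) ->
  (\int[@lebesgue_measure R]_(t in `[0%R, 1%R]) (P (S, t) - P (0, t))%:E +
   \int[@lebesgue_measure R]_(s in `[0%R, S]) (T (s, 1) - T (s, 0))%:E =
   \int[@lebesgue_measure R]_(s in `[0%R, S])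
     \int[@lebesgue_measure R]_(t in `[0%R, 1%R]) (A (s, t) + B (s, t))%:E)%E.
Proof.
move=> S0 oW HW cA cB dP dT.
have [iA _ EA] := rectangle_integrals S0 oW HW cA.
have [iB EB _] := rectangle_integrals S0 oW HW cB.
have cAB x : W x -> {for x, continuous (A \+ B)}.
  by move=> Wx; apply: cvgD; [exact: cA|exact: cB].
have [_ -> _] := rectangle_integrals S0 oW HW cAB.
have -> : (\int[@lebesgue_measure R]_(t in `[0%R, 1%R]) (P (S, t) - P (0, t))%:E)%E =
    (\int[@lebesgue_measure R]_(t in `[0%R, 1%R]) \int[@lebesgue_measure R]_(s in `[0%R, S]) (A (s, t))%:E)%E.
  apply: eq_integral => t; rewrite inE /= in_itv /= => /andP[t0 t1].
  symmetry; apply: (@integral_derivative _ (fun x => P (x, t)) (fun s => A (s, t)) 0 S) => //.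
  - by move=> s s0 s1; apply: dP; exact: HW.
  - by move=> s s0 s1; apply: continuous_section1; apply: cA; exact: HW.
have -> : (\int[@lebesgue_measure R]_(s in `[0%R, S]) (T (s, 1) - T (s, 0))%:E)%E =
    (\int[@lebesgue_measure R]_(s in `[0%R, S]) \int[@lebesgue_measure R]_(t in `[0%R, 1%R]) (B (s, t))%:E)%E.
  apply: eq_integral => s; rewrite inE /= in_itv /= => /andP[s0 s1].
  symmetry; apply: (@integral_derivative _ (fun y => T (s, y)) (fun t => B (s, t)) 0 1) => //.
  - by move=> t t0 t1; apply: dT; exact: HW.
  - by move=> t t0 t1; apply: continuous_section2; apply: cB; exact: HW.
rewrite EA EB -integralD //.
apply: eq_integral => z _; rewrite !patchE; case: ifP => // _.
by rewrite adde0.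
Qed.

Section Calculus.
Context {R : realType}.
Implicit Types (f g : R -> R) (x c d e : R).

Lemma is_derive_mul f g x d e : is_derive x 1 f d -> is_derive x 1 g e ->
  is_derive x 1 (fun y => f y * g y) (f x * e + g x * d).
Proof. exact: is_deriveM. Qed.

Lemma is_derive_add f g x d e : is_derive x 1 f d -> is_derive x 1 g e ->
  is_derive x 1 (fun y => f y + g y) (d + e).
Proof. exact: is_deriveD. Qed.

Lemma is_derive_sub f g x d e : is_derive x 1 f d -> is_derive x 1 g e ->
  is_derive x 1 (fun y => f y - g y) (d - e).
Proof. exact: is_deriveB. Qed.

Lemma is_derive_const c x : is_derive x 1 (fun _ : R => c) 0.
Proof. exact: is_derive_cst. Qed.

Lemma is_derive_var x : is_derive x 1 (fun y : R => y) 1.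
Proof. exact: is_derive_id. Qed.

Lemma is_derive_conv f x d e : is_derive x 1 f d -> d = e -> is_derive x 1 f e.
Proof. by move=> H <-. Qed.

End Calculus.

Ltac derive_leaf := first
  [ eassumption | apply: is_derive_const | apply: is_derive_var ].
Ltac derive_poly := repeat first
  [ derive_leaf | apply: is_derive_mul | apply: is_derive_sub
  | apply: is_derive_add ].

(* The fluxes of Rellich's vector field, centred at [p], through the curves of
   constant [s] and of constant [t] in the coordinates [p + s W], [W = A + t B];
   [K = det2 A B], and [g], [g1], [g2] are the values of [f] and of its partial
   derivatives. *)
Definition flux_s (R : realType) (K lambda : R) (B : plane R)
    (s : R) (W : plane R) (g g1 g2 : R) : R :=
  s * s * (2 * (W.1 * g1 + W.2 * g2) * (g1 * B.2 - g2 * B.1) +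
           K * (lambda * (g * g) - (g1 * g1 + g2 * g2))).

Definition flux_t (R : realType) (s : R) (W : plane R) (g1 g2 : R) : R :=
  2 * s * (W.1 * g1 + W.2 * g2) * (W.1 * g2 - W.2 * g1).

Definition dflux_s (R : realType) (K lambda : R) (B : plane R)
    (s : R) (W : plane R) (g g1 g2 dg d1 d2 : R) : R :=
  2 * s * (2 * (W.1 * g1 + W.2 * g2) * (g1 * B.2 - g2 * B.1) +
           K * (lambda * (g * g) - (g1 * g1 + g2 * g2))) +
  s * s * (2 * (W.1 * d1 + W.2 * d2) * (g1 * B.2 - g2 * B.1) +
           2 * (W.1 * g1 + W.2 * g2) * (d1 * B.2 - d2 * B.1) +
           K * (lambda * (2 * g * dg) - (2 * g1 * d1 + 2 * g2 * d2))).

Definition dflux_t (R : realType) (B : plane R) (s : R) (W : plane R)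
    (g1 g2 d1 d2 : R) : R :=
  2 * s * ((B.1 * g1 + B.2 * g2 + W.1 * d1 + W.2 * d2) * (W.1 * g2 - W.2 * g1) +
    (W.1 * g1 + W.2 * g2) * (B.1 * g2 - B.2 * g1 + W.1 * d2 - W.2 * d1)).

Lemma is_derive_flux_s (R : realType) (K lambda : R) (B W : plane R)
    (g g1 g2 : R -> R) (s dg d1 d2 : R) :
  is_derive s 1 g dg -> is_derive s 1 g1 d1 -> is_derive s 1 g2 d2 ->
  is_derive s 1 (fun x => flux_s K lambda B x W (g x) (g1 x) (g2 x))
    (dflux_s K lambda B s W (g s) (g1 s) (g2 s) dg d1 d2).
Proof.
move=> H H1 H2; rewrite /flux_s /dflux_s.
eapply is_derive_conv; first by derive_poly.
by plane_ring.
Qed.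

Lemma is_derive_flux_t (R : realType) (B A : plane R)
    (g1 g2 : R -> R) (s t d1 d2 : R) :
  is_derive t 1 g1 d1 -> is_derive t 1 g2 d2 ->
  is_derive t 1 (fun x => flux_t s (A + x *: B) (g1 x) (g2 x))
    (dflux_t B s (A + t *: B) (g1 t) (g2 t) d1 d2).
Proof.
move=> H1 H2; rewrite /flux_t /dflux_t.
have D : is_derive t 1 (fun x : R => 2 * s * ((A.1 + x * B.1) * g1 x + (A.2 + x * B.2) * g2 x) *
    ((A.1 + x * B.1) * g2 x - (A.2 + x * B.2) * g1 x)) (dflux_t B s (A + t *: B) (g1 t) (g2 t) d1 d2).
  rewrite /dflux_t; eapply is_derive_conv; first by derive_poly.
  by plane_ring.
exact: D.
Qed.

Definition radial (R : realType) (p A B : plane R) (z : plane R) : plane R :=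
  p + z.1 *: (A + z.2 *: B).

Lemma radial_continuous (R : realType) (p A B : plane R) :
  continuous (radial p A B).
Proof.
move=> z; have c1 : fst @ z --> z.1 by exact: cvg_fst.
have c2 : snd @ z --> z.2 by exact: cvg_snd.
apply: cvgD; first exact: cvg_cst.
apply: cvgZ => //; apply: cvgD; first exact: cvg_cst.
exact: cvgZr_tmp.
Qed.

Lemma is_derive_radial_s (R : realType) (U : set (plane R)) (g : plane R -> R)
    (p A B : plane R) (s t : R) : open U -> C1_on U g -> U (radial p A B (s, t)) ->
  is_derive s 1 (fun x => g (radial p A B (x, t)))
    (dir_deriv (A + t *: B) g (radial p A B (s, t))).
Proof.
move=> oU Cg Us.
have := C1_is_derive (A + t *: B) oU Cg Us.
by rewrite {1}/radial /= => /is_derive_along.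
Qed.

Lemma is_derive_radial_t (R : realType) (U : set (plane R)) (g : plane R -> R)
    (p A B : plane R) (s t : R) : open U -> C1_on U g -> U (radial p A B (s, t)) ->
  is_derive t 1 (fun x => g (radial p A B (s, x)))
    (s * dir_deriv B g (radial p A B (s, t))).
Proof.
move=> oU Cg Us.
have E (x : R) : radial p A B (s, x) = (p + s *: A) + x *: (s *: B).
  by rewrite /radial /=; plane_eq.
have := C1_is_derive (s *: B) oU Cg Us.
rewrite {1}E => /is_derive_along H.
rewrite (_ : (fun x => _) = (fun x : R => g ((p + s *: A) + x *: (s *: B)))); last first.
  by apply/funext => x; rewrite E.
apply: (is_derive_conv H); rewrite /dir_deriv; plane_ring.
Qed.

(** Rellich's pointwise identity times the Jacobian [s * det2 W B], with [h11], [h12], [h22] the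
    Hessian of [f]: a change of [s] differentiates along [W], a change of [t] along [s *: B]. Once
    the equation eliminates [h22], it is a polynomial identity. *)
Lemma dflux_divergence (R : realType) (lambda s : R) (W B : plane R)
    (g g1 g2 h11 h12 h22 : R) : h11 + h22 = - lambda * g ->
  dflux_s (det2 W B) lambda B s W g g1 g2 (W.1 * g1 + W.2 * g2)
    (W.1 * h11 + W.2 * h12) (W.1 * h12 + W.2 * h22) +
  dflux_t B s W g1 g2 (s * (B.1 * h11 + B.2 * h12)) (s * (B.1 * h12 + B.2 * h22)) =
  2 * lambda * det2 W B * s * g ^+ 2.
Proof.
move=> E; have -> : h22 = - lambda * g - h11 by rewrite -E; ring.
by rewrite /dflux_s /dflux_t /det2; ring.
Qed.

Section Continuity.
Context {R : realType} {T : topologicalType}.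
Implicit Types (f g : T -> R) (x : T) (c : R).

Lemma continuous_for_mul f g x : {for x, continuous f} -> {for x, continuous g} ->
  {for x, continuous (fun y => f y * g y)}.
Proof. by move=> cf cg; apply: cvgM. Qed.

Lemma continuous_for_add f g x : {for x, continuous f} -> {for x, continuous g} ->
  {for x, continuous (fun y => f y + g y)}.
Proof. by move=> cf cg; apply: cvgD. Qed.

Lemma continuous_for_sub f g x : {for x, continuous f} -> {for x, continuous g} ->
  {for x, continuous (fun y => f y - g y)}.
Proof. by move=> cf cg; apply: cvgB. Qed.

Lemma continuous_for_cst c x : {for x, continuous (fun _ : T => c)}.
Proof. exact: cvg_cst. Qed.

End Continuity.

(* Dispatching on the head symbol, since unification would otherwise unfold the
   ring operations. *)
Ltac continuous_poly := lazymatch goal with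
  | |- prop_for _ (inPhantom (continuous ?f)) =>
    lazymatch f with
    | (fun y => @Algebra.add _ (@?a y) (@Algebra.opp _ (@?b y))) =>
        refine (@continuous_for_sub _ _ a b _ _ _); continuous_poly
    | (fun y => @Algebra.add _ (@?a y) (@?b y)) =>
        refine (@continuous_for_add _ _ a b _ _ _); continuous_poly
    | (fun y => @GRing.mul _ (@?a y) (@?b y)) =>
        refine (@continuous_for_mul _ _ a b _ _ _); continuous_poly
    | _ => first [assumption | exact: continuous_for_cst]
    end
  end.

Lemma continuous_dflux (R : realType) (T : topologicalType) (K lambda : R)
    (B : plane R) (s g g1 g2 dg d1 d2 : T -> R) (W : T -> plane R) (x : T) :
  {for x, continuous s} -> {for x, continuous (fun y => (W y).1)} ->
  {for x, continuous (fun y => (W y).2)} ->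
  {for x, continuous g} -> {for x, continuous g1} -> {for x, continuous g2} ->
  {for x, continuous dg} -> {for x, continuous d1} -> {for x, continuous d2} ->
  {for x, continuous (fun y => dflux_s K lambda B (s y) (W y) (g y) (g1 y) (g2 y)
    (dg y) (d1 y) (d2 y))} /\
  {for x, continuous (fun y => dflux_t B (s y) (W y) (g1 y) (g2 y) (d1 y) (d2 y))}.
Proof. by rewrite /dflux_s /dflux_t => *; split; continuous_poly. Qed.

Lemma continuous_dot2 (R : realType) (T : topologicalType)
    (a b c d : T -> R) (x : T) : {for x, continuous a} -> {for x, continuous b} ->
  {for x, continuous c} -> {for x, continuous d} ->
  {for x, continuous (fun y => a y * c y + b y * d y)}.
Proof. by move=> *; continuous_poly. Qed.

Definition sector_flux (R : realType) (f : plane R -> R) (lambda : R)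
    (p A B : plane R) (z : plane R) : R :=
  flux_s (det2 A B) lambda B z.1 (A + z.2 *: B) (f (radial p A B z))
    (partial1 f (radial p A B z)) (partial2 f (radial p A B z)).

Definition ray_flux (R : realType) (f : plane R -> R) (p W : plane R) (s : R) : R :=
  flux_t s W (partial1 f (p + s *: W)) (partial2 f (p + s *: W)).

Lemma sector_rellich (R : realType) (U : set (plane R)) (f : plane R -> R)
    (lambda S : R) (p A B : plane R) :
  open U -> C2_on U f -> (forall x, U x -> laplacian f x = - lambda * f x) ->
  0 < S ->
  (forall s t, 0 <= s -> s <= S -> 0 <= t -> t <= 1 -> U (radial p A B (s, t))) ->
  (\int[@lebesgue_measure R]_(t in `[0%R, 1%R]) (sector_flux f lambda p A B (S, t))%:E +
   \int[@lebesgue_measure R]_(s in `[0%R, S])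
     (ray_flux f p (A + B) s - ray_flux f p A s)%:E =
   \int[@lebesgue_measure R]_(s in `[0%R, S]) \int[@lebesgue_measure R]_(t in `[0%R, 1%R])
     (2 * lambda * det2 A B * s * f (radial p A B (s, t)) ^+ 2)%:E)%E.
Proof.
move=> oU Cf lap S0 HU; have [C C1 C2] := Cf.
pose W : set (plane R) := radial p A B @^-1` U.
have oW : open W by apply: open_comp => // z _; exact: radial_continuous.
pose T (z : plane R) := flux_t z.1 (A + z.2 *: B)
  (partial1 f (radial p A B z)) (partial2 f (radial p A B z)).
pose h11 := partial1 (partial1 f); pose h12 := partial2 (partial1 f).
pose h21 := partial1 (partial2 f); pose h22 := partial2 (partial2 f).
pose w (z : plane R) : plane R := A + z.2 *: B.
pose dP (z : plane R) := dflux_s (det2 A B) lambda B z.1 (w z) (f (radial p A B z))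
  (partial1 f (radial p A B z)) (partial2 f (radial p A B z))
  (dir_deriv (w z) f (radial p A B z)) (dir_deriv (w z) (partial1 f) (radial p A B z))
  (dir_deriv (w z) (partial2 f) (radial p A B z)).
pose dT (z : plane R) := dflux_t B z.1 (w z)
  (partial1 f (radial p A B z)) (partial2 f (radial p A B z))
  (z.1 * dir_deriv B (partial1 f) (radial p A B z))
  (z.1 * dir_deriv B (partial2 f) (radial p A B z)).
have cW z (g : plane R -> R) : {for radial p A B z, continuous g} ->
    {for z, continuous (fun y => g (radial p A B y))}.
  by move=> cg; apply: (@continuous_comp _ _ _ (radial p A B) g) => //; exact: radial_continuous.
have cw (z : plane R) : {for z, continuous (fun y : plane R => (w y).1)} /\
    {for z, continuous (fun y : plane R => (w y).2)} /\
    {for z, continuous (fun y : plane R => y.1)}.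
  have c2 : {for z, continuous (fun y : plane R => y.2)} by exact: cvg_snd.
  have k1 : {for z, continuous (fun y : plane R => A.1 + y.2 * B.1)} by continuous_poly.
  have k2 : {for z, continuous (fun y : plane R => A.2 + y.2 * B.2)} by continuous_poly.
  by split; [exact: k1|split; [exact: k2|exact: cvg_fst]].
have cg z (g : plane R -> R) : C1_on U g -> W z ->
    [/\ {for z, continuous (fun y : plane R => g (radial p A B y))},
        {for z, continuous (fun y : plane R => dir_deriv (w y) g (radial p A B y))} &
        {for z, continuous (fun y : plane R => y.1 * dir_deriv B g (radial p A B y))}].
  move=> Cg Wz; have [c1 [c2 c3]] := cw z; have [_ _ k1 k2] := Cg _ Wz.
  have k0 := C1_continuous oU Cg Wz.
  split; first exact: cW.
  - exact: (continuous_dot2 c1 c2 (cW _ _ k1) (cW _ _ k2)).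
  - apply: continuous_for_mul => //.
    exact: (continuous_dot2 (@continuous_for_cst _ _ B.1 z)
      (@continuous_for_cst _ _ B.2 z) (cW _ _ k1) (cW _ _ k2)).
have cd z : W z -> {for z, continuous dP} /\ {for z, continuous dT}.
  move=> Wz; have [c1 [c2 c3]] := cw z.
  have [k0 k0' k0''] := cg z f C Wz; have [k1 k1' k1''] := cg z _ C1 Wz.
  have [k2 k2' k2''] := cg z _ C2 Wz.
  have [h _] := continuous_dflux (det2 A B) lambda B c3 c1 c2 k0 k1 k2 k0' k1' k2'.
  by have [_ h'] := continuous_dflux (det2 A B) lambda B c3 c1 c2 k0 k1 k2 k0' k1'' k2''.
have cdP z (Wz : W z) := (cd z Wz).1.
have cdT z (Wz : W z) := (cd z Wz).2.
have := rectangle_divergence (P := sector_flux f lambda p A B) (T := T) S0 oW HU cdP cdT.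
move=> /(_ _ _)/wrap[||].
- move=> s t Wst; rewrite /sector_flux /=.
  by apply: is_derive_flux_s; apply: (is_derive_radial_s oU).
- move=> s t Wst; rewrite /T /=.
  by apply: is_derive_flux_t; apply: (is_derive_radial_t oU).
move=> RD; transitivity (\int[@lebesgue_measure R]_(s in `[0%R, S])
    \int[@lebesgue_measure R]_(t in `[0%R, 1%R]) (dP (s, t) + dT (s, t))%:E)%E.
  rewrite -RD; apply: (f_equal2 adde); apply: eq_integral => t _.
  (* The edge [s = 0] of the rectangle collapses to the point [p]; its flux vanishes by the factor
     [s * s]. *)
  - by rewrite {3}/sector_flux /flux_s /= !mul0r subr0.
  - by rewrite /T /ray_flux /radial /= scale1r scale0r addr0.
apply: eq_integral => s; rewrite inE /= in_itv /= => /andP[s0 s1].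
apply: eq_integral => t; rewrite inE /= in_itv /= => /andP[t0 t1].
have Ust := HU s t s0 s1 t0 t1; congr (_%:E).
have dw : det2 (w (s, t)) B = det2 A B by rewrite /w /det2; plane_ring.
have := lap _ Ust; rewrite /laplacian => E.
have := dflux_divergence s (w (s, t)) B (partial1 f (radial p A B (s, t)))
  (partial2 f (radial p A B (s, t))) (h12 (radial p A B (s, t))) E.
rewrite dw => <-; rewrite /dP /dT /dir_deriv /= -/(h12 _).
(* The pointwise identity is stated for a symmetric Hessian. *)
by rewrite (mixed_partials oU Cf Ust).
Qed.

(** * Normal derivatives at the sides *)

Lemma closed_polygon_closed (R : realType) (v n : 'I_4 -> plane R) :
  closed (closed_polygon v n).
Proof.
pose F k := [set x : plane R | 0 <= dotp (x - v k) (n k)].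
rewrite (_ : closed_polygon _ _ = F 0 `&` F 1 `&` F 2 `&` F 3).
  by do ?apply: closedI; exact: closed_halfplane.
apply/seteqP; split=> y /=; first by move=> h; do !split; exact: h.
by case=> [[[? ?] ?] ?]; exact: forall_ord4.
Qed.

(* The outward unit normals are the opposites of [side_normal], normalized. *)
Lemma outward_normal_side_coord (R : realType) (v nu : 'I_4 -> plane R) p K k :
  balanced_quadrilateral v p K -> outward_unit_normal v k (nu k) ->
  dotp (nu k) (nu k) = 1 /\
  exists2 c : R, 0 < c & forall x, dotp (x - v k) (- nu k) = c * side_coord v K k x.
Proof.
move=> B [n1 nw Hout]; have K0 := balanced_neq0 B; have KE := balanced_triangles B k.
have nn : dotp (nu k) (nu k) = 1.
  have n0 : 0 <= dotp (nu k) (nu k) by rewrite /dotp addr_ge0 // -expr2 sqr_ge0.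
  by rewrite -(sqr_sqrtr n0) -/(enorm _) n1 expr1n.
split => //; set w := v (k + 1) - v k in nw KE *.
have w0 : perp w != 0.
  apply: contra_neq K0 => E; have w2 : w.2 = 0 := congr1 fst E.
  have /eqP : - w.1 = 0 := congr1 snd E; rewrite oppr_eq0 => /eqP w1.
  by rewrite -KE /det2 w1 w2 !mulr0 subrr.
have [mu nuE] : exists mu, nu k = mu *: perp w.
  apply: parallel_scale => //.
  by rewrite -[RHS]nw /det2; plane_ring.
have E x : dotp (x - v k) (- nu k) = (mu * K) * side_coord v K k x.
  rewrite side_coordE /side_normal -/w nuE; apply: (mulIf K0); move: (K) K0 => K' K0.
  by plane_unfold; field.
exists (mu * K) => //.
(* The sign of [mu * K] is read off slightly inside the region, on the normal through the midpoint
   of the side. *)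
have [|eps /= eps0 He] := Hout (v k + 2^-1 *: w).
  exists 2^-1 => //; rewrite /= in_itv /= invr_gt0 ltr0n /= invf_lt1 ?ltr0n //.
  by rewrite ltr1n.
have e20 : 0 < eps / 2 by rewrite divr_gt0.
have [|Q _] := He (eps / 2) _ e20.
  by rewrite /ball_ /= sub0r normrN gtr0_norm //; lra.
move: Q; rewrite (quad_region_polygon B) => /(_ k); rewrite -side_coordE => Q.
have : 0 < (mu * K) * side_coord v K k (v k + 2^-1 *: w - (eps / 2) *: nu k).
  rewrite -E; have -> : dotp (v k + 2^-1 *: w - (eps / 2) *: nu k - v k) (- nu k) =
    (eps / 2) * dotp (nu k) (nu k) - 2^-1 * dotp (nu k) w by plane_ring.
  by rewrite nn nw; lra.
by rewrite pmulr_lgt0.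
Qed.

Section Normals.
Context {R : realType} (v nu : 'I_4 -> plane R) (p : plane R) (K : R).
Hypothesis B : balanced_quadrilateral v p K.
Hypothesis nuP : forall k, outward_unit_normal v k (nu k).
Let n k := - nu k.

Lemma inner_normal_polygon : quad_region v = polygon v n /\
  forall x, closed_polygon v n x <-> (forall k, 0 <= side_coord v K k x).
Proof.
have H k := (outward_normal_side_coord B (nuP k)).2.
split.
- rewrite (quad_region_polygon B); apply/seteqP; split=> x Hx k; have [c c0 E] := H k.
    by rewrite /n E pmulr_rgt0 // side_coordE; exact: Hx.
  by move: (Hx k); rewrite /n E pmulr_rgt0 // side_coordE.
- move=> x; split=> Hx k; have [c c0 E] := H k.
    by move: (Hx k); rewrite /n E pmulr_rge0.
  by rewrite /n E pmulr_rge0.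
Qed.

Lemma inner_normal_unit k : dotp (n k) (n k) = 1.
Proof.
have [<- _] := outward_normal_side_coord B (nuP k).
by rewrite /n; plane_ring.
Qed.

Lemma dirichlet_polygon_solution lambda f : dirichlet_solution v lambda f ->
  polygon_solution v n lambda f.
Proof.
have [QE QcE] := inner_normal_polygon.
have bdE x : closed_polygon v n x -> ~ polygon v n x -> quad_boundary v x.
  move=> Cx Qx; apply/(balanced_boundary B); split; first exact/QcE.
  apply: contrapT => /forallNP H; apply: Qx; rewrite -QE (quad_region_polygon B) => k.
  rewrite -side_coordE lt_neqAle eq_sym (QcE x).1 // andbT; apply/eqP; exact: H.
move=> [C2f cf lap bd]; split.
- exact: inner_normal_unit.
- have [M HM] := balanced_bounded B.
  apply: (@plane_compact _ _ M); first exact: closed_polygon_closed.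
  by move=> x /QcE; exact: HM.
- by rewrite -QE.
- have -> : closed_polygon v n = quad_region v `|` quad_boundary v => //.
  apply/seteqP; split=> x.
    move=> Cx; have [Qx|Qx] := pselect (polygon v n x); first by left; rewrite QE.
    by right; exact: bdE.
  case; first by rewrite QE; exact: polygonW.
  by move=> /(balanced_boundary B)[? _]; apply/QcE.
- move=> x; rewrite -QE => /lap; rewrite mulNr; lra.
- by move=> x Cx Qx; apply: bd; exact: bdE.
Qed.

(** A side [j] whose coordinate is positive at the point leaves room in all directions; a side on
    the same line only constrains the depth [b]. [balanced_side] says that these are the only
    cases. *)
Lemma side_flat_boundary k t : 0 < t -> t < 1 ->
  exists rho, flat_boundary v n k (v k + t *: (v (k + 1) - v k)) rho.
Proof.
move=> t0 t1; set w := v (k + 1) - v k; set x0 := v k + t *: w.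
have [_ nw _] := nuP k.
have x0k : dotp (x0 - v k) (n k) = 0.
  by rewrite -(mulr0 (- t)) -nw /x0 -/w; plane_ring.
have [ck ck0 Ek] := (outward_normal_side_coord B (nuP k)).2.
have step j : exists2 rho : R, 0 < rho & forall a b, `|a| <= rho -> 0 <= b -> b <= rho ->
    0 <= dotp (frame_point x0 (n k) a b - v j) (n j) /\
    (0 < b -> 0 < dotp (frame_point x0 (n k) a b - v j) (n j)).
  have [cj cj0 Ej] := (outward_normal_side_coord B (nuP j)).2.
  have [pos|same] := balanced_side B j k.
  - have m0 : 0 < dotp (x0 - v j) (n j) by rewrite /n Ej mulr_gt0 // pos.
    (* Each of the displacements [a] and [b] lowers the distance by at most [m / 3], which leaves at
       least [m / 3]. *)
    set m := dotp _ _ in m0; exists (m / 3); first by rewrite divr_gt0.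
    move=> a b am b0 bm.
    have E : dotp (frame_point x0 (n k) a b - v j) (n j) =
        m + a * dotp (perp (n k)) (n j) + b * dotp (n k) (n j).
      by rewrite /m /frame_point; plane_ring.
    have p1 : dotp (perp (n k)) (perp (n k)) = 1 by rewrite dotp_perp2 inner_normal_unit.
    have h1 : `|a * dotp (perp (n k)) (n j)| <= m / 3.
      rewrite normrM -[leRHS]mulr1 ler_pM //.
      exact: dotp_unit_le1 p1 (inner_normal_unit j).
    have h2 : `|b * dotp (n k) (n j)| <= m / 3.
      rewrite normrM -[leRHS]mulr1 ler_pM //; first by rewrite ger0_norm.
      exact: dotp_unit_le1 (inner_normal_unit k) (inner_normal_unit j).
    move: h1 h2; rewrite !ler_norml E => /andP[h1 _] /andP[h2 _].
    by split=> [|_]; lra.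
  - exists 1 => // a b _ b0 _.
    have bE : dotp (frame_point x0 (n k) a b - v k) (n k) = b.
      have [_ {2}<-] := frame_point_coord x0 a b (inner_normal_unit k).
      by rewrite -[RHS]addr0 -x0k; plane_ring.
    have E : dotp (frame_point x0 (n k) a b - v j) (n j) = cj / ck * b.
      by rewrite -[in RHS]bE /n Ej Ek same; field; exact: lt0r_neq0.
    by rewrite E; split=> [|h]; [rewrite mulr_ge0 // divr_ge0 // ltW|rewrite mulr_gt0 // divr_gt0].
have [r0 r00 H0] := step 0; have [r1 r10 H1] := step 1.
have [r2 r20 H2] := step 2; have [r3 r30 H3] := step 3.
pose rho := Num.min (Num.min r0 r1) (Num.min r2 r3).
have le_rho (x : R) : x <= rho -> [/\ x <= r0, x <= r1, x <= r2 & x <= r3].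
  by rewrite /rho !le_min => /andP[/andP[-> ->] /andP[-> ->]].
exists rho; split => //; first by rewrite /rho !lt_min r00 r10 r20.
move=> a b /le_rho[a0 a1 a2 a3] b0 /le_rho[b0' b1' b2' b3'].
split=> [|bpos]; apply: forall_ord4.
all: try by apply: (H0 a b _ _ _).1.
all: try by apply: (H1 a b _ _ _).1.
all: try by apply: (H2 a b _ _ _).1.
all: try by apply: (H3 a b _ _ _).1.
all: try by apply: (H0 a b _ _ _).2.
all: try by apply: (H1 a b _ _ _).2.
all: try by apply: (H2 a b _ _ _).2.
all: try by apply: (H3 a b _ _ _).2.
Qed.

End Normals.

Lemma cvg_le_linear (R : realType) (x u : nat -> R) (l c : R) :
  u @ \oo --> (0 : R) -> (\forall m \near \oo, `|x m - l| <= c * u m) ->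
  x @ \oo --> l.
Proof.
move=> u0 H; have cu : (fun m => c * u m) @ \oo --> (0 : R).
  by rewrite -(mulr0 c); apply: cvgMl_tmp.
apply/cvgrPdist_lt => e e0; move/cvgrPdist_lt: cu => /(_ e e0) H2.
near=> m; rewrite distrC; apply: (@le_lt_trans _ _ (c * u m)); first by near: m.
apply: le_lt_trans (ler_norm _) _; rewrite -normrN -(sub0r (c * u m)).
by near: m.
Unshelve. all: by end_near. Qed.

Lemma cvg_flux_s (R : realType) (K lambda : R) (B W : plane R)
    (s g g1 g2 : nat -> R) (ls lg l1 l2 : R) :
  s @ \oo --> ls -> g @ \oo --> lg -> g1 @ \oo --> l1 -> g2 @ \oo --> l2 ->
  (fun m => flux_s K lambda B (s m) W (g m) (g1 m) (g2 m)) @ \oo -->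
    flux_s K lambda B ls W lg l1 l2.
Proof.
move=> hs hg h1 h2; have c (r : R) : (fun _ : nat => r) @ \oo --> r by exact: cvg_cst.
exact: (cvgM (cvgM hs hs) (cvgD
  (cvgM (cvgM (c 2) (cvgD (cvgM (c W.1) h1) (cvgM (c W.2) h2)))
        (cvgB (cvgM h1 (c B.2)) (cvgM h2 (c B.1))))
  (cvgM (c K) (cvgB (cvgM (c lambda) (cvgM hg hg)) (cvgD (cvgM h1 h1) (cvgM h2 h2)))))).
Qed.

Section BoundaryLimits.
Context {R : realType} (v n : 'I_4 -> plane R) (lambda : R) (f : plane R -> R).
Hypothesis Sf : polygon_solution v n lambda f.
Variables (k : 'I_4) (x0 : plane R) (r G C : R).
Hypothesis FB : flat_boundary v n k x0 (3 * r).
Hypothesis C0 : 0 <= C.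
Hypothesis HG : forall a b : R, `|a| <= r / 2 -> 0 < b -> b <= r / 2 ->
    `|dir_deriv (n k) f (frame_point x0 (n k) a b) - G| <= C * (`|a| + b) /\
    `|dir_deriv (perp (n k)) f (frame_point x0 (n k) a b)| <= C * b.

(** Mean value theorem on the normal segment from [x0], where [f] is zero; at that end continuity is
    enough. *)
Lemma boundary_quotient (b : R) : 0 < b -> b <= r / 2 ->
  `|b^-1 * f (frame_point x0 (n k) 0 b) - G| <= C * b.
Proof.
move=> b0 br; have [rho0 _ HF] := FB.
have a0 : `|0 : R| <= 3 * r by rewrite normr0; lra.
have oQ := @polygon_open R v n.
have fpE (s : R) : frame_point x0 (n k) 0 0 + s *: n k = frame_point x0 (n k) 0 s.
  by rewrite frame_pointD2 add0r.
have [||c] := @MVT _ (fun s => f (frame_point x0 (n k) 0 s))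
  (fun s => dir_deriv (n k) f (frame_point x0 (n k) 0 s)) 0 b b0.
- move=> s; rewrite in_itv /= => /andP[s0 sb].
  have Q : polygon v n (frame_point x0 (n k) 0 s).
    by apply: (HF _ _ a0 (ltW s0) _).2 => //; lra.
  have [d _] := C2_is_derive (n k) (n k) oQ (solution_C2 Sf) Q.
  move: d; rewrite -fpE => /is_derive_along.
  by under eq_fun do rewrite fpE.
- apply: (@within_comp_continuous _ _ _ `[0, b] _ (fun s : R => frame_point x0 (n k) 0 s) _ (solution_continuous Sf)).
    move=> s; rewrite /frame_point; apply: cvgD; first exact: cvg_cst.
    by apply: cvgZr_tmp; exact: cvg_id.
  move=> s; rewrite /= in_itv /= => /andP[s0 sb].
  by apply: (HF _ _ a0 s0 _).1; lra.
rewrite in_itv /= => /andP[c0 cb].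
rewrite (flat_boundary0 Sf FB a0) !subr0 => ->.
rewrite mulrCA mulVf ?mulr1 ?gt_eqF //.
have a1 : `|0 : R| <= r / 2 by rewrite normr0; lra.
have [H _] := HG a1 c0 (le_trans (ltW cb) br).
by apply: le_trans H _; rewrite normr0 add0r ler_wpM2l // ltW.
Qed.

(** This certifies that the [lim] in [normal_derivative] is a genuine limit. The outward normal is
    [- n k] and [h] is negative, so the point moves inwards by [- h]; hence the sign of [G]. *)
Lemma normal_derivative_limit : normal_derivative f (- n k) x0 = - G.
Proof.
apply: cvg_lim => //; have [rho0 _ _] := FB.
have r0 : 0 < r by lra.
have x0E : frame_point x0 (n k) 0 0 = x0 by rewrite /frame_point; plane_eq.
have f0 : f x0 = 0.
  by rewrite -x0E (flat_boundary0 Sf FB) // normr0; lra.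
apply/cvgrPdist_le => e e0.
pose d := Num.min (r / 2) (e / (C + 1)).
have C1 : 0 < C + 1 by rewrite ltr_wpDl.
have d0 : 0 < d by rewrite lt_min !divr_gt0.
rewrite near_withinE; exists d => //= h; rewrite /= sub0r normrN => hd h0.
have b0 : 0 < - h by rewrite oppr_gt0.
move: hd; rewrite (ltr0_norm h0) lt_min => /andP[hr he].
have -> : x0 + h *: - n k = frame_point x0 (n k) 0 (- h).
  by rewrite /frame_point; plane_eq.
have := boundary_quotient b0 (ltW hr).
rewrite f0 subr0 invrN mulNr => H.
rewrite addrC; apply: le_trans H _.
have Ch : C * - h <= (C + 1) * - h by rewrite ler_wpM2r ?ltW // ltrDl.
by apply: le_trans Ch _; rewrite mulrC -ler_pdivlMr // ltW.
Qed.

(** The ray is transversal to the side, so the depth is [u m * b0] with [b0 > 0]; [f] tends to [0]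
    and its gradient to [G *: n k]. The limit flux is [2 * G ^+ 2 * dotp W (n k) * det2 (n k) B -
    det2 A B * G ^+ 2], and since [n k] is a unit vector orthogonal to [B],
    [dotp W (n k) * det2 (n k) B] equals [det2 W B = det2 A B]. *)
Lemma sector_flux_limit (p A B : plane R) (t : R) (u : nat -> R) :
  x0 = p + (A + t *: B) -> dotp (n k) B = 0 -> dotp (A + t *: B) (n k) < 0 ->
  (forall m, 0 < u m) -> u @ \oo --> (0 : R) ->
  (fun m => sector_flux f lambda p A B (1 - u m, t)) @ \oo --> det2 A B * G ^+ 2.
Proof.
move=> x0E nB Wn u0 ucv; set W := A + t *: B in x0E Wn.
have [rho0 _ HF] := FB; have r0 : 0 < r by lra.
have n1 := solution_unit Sf k.
pose a0 := - dotp W (perp (n k)); pose b0 := - dotp W (n k).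
have b00 : 0 < b0 by rewrite oppr_gt0.
have xE m : radial p A B (1 - u m, t) = frame_point x0 (n k) (u m * a0) (u m * b0).
  have WE := frame_decomposition W n1.
  transitivity (p + W - u m *: W); first by rewrite /radial /= -/W; plane_eq.
  rewrite /frame_point x0E /a0 /b0 {2}WE.
  by move: (dotp _ _) (dotp _ _) => c d; plane_eq.
have [Cd Cd0 HCd] := solution_le_dist Sf.
have small : \forall m \near \oo, [/\ `|u m * a0| <= r / 2, 0 < u m * b0 & u m * b0 <= r / 2].
  pose d := r / 2 / (`|a0| + b0 + 1).
  have den : 0 < `|a0| + b0 + 1 by rewrite ltr_wpDl // addr_ge0 // ltW.
  have d0 : 0 < d by rewrite !divr_gt0.
  move/cvgrPdist_lt : ucv => /(_ d d0); apply: filterS => m.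
  rewrite sub0r normrN gtr0_norm // ltr_pdivlMr // => um.
  have := mulr_ge0 (ltW (u0 m)) (normr_ge0 a0); have := mulr_gt0 (u0 m) b00.
  have := u0 m; rewrite normrM gtr0_norm //.
  by move=> *; split => //; lra.
pose D1 m := partial1 f (radial p A B (1 - u m, t)).
pose D2 m := partial2 f (radial p A B (1 - u m, t)).
have n1le : `|(n k).1| <= 1 /\ `|(n k).2| <= 1.
  have E1 : `|(n k).1| ^+ 2 + `|(n k).2| ^+ 2 = 1.
    by rewrite !real_normK ?num_real // -[RHS]n1 /dotp !expr2.
  have := sqr_ge0 `|(n k).1|; have := sqr_ge0 `|(n k).2|.
  have := normr_ge0 (n k).1; have := normr_ge0 (n k).2.
  by move=> *; split; nra.
(* The partial derivatives are recovered from the frame: up to the factor [u m], the normal part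
   contributes an error [C * (|a0| + b0)] and the tangential part [C * b0]. *)
have key m : [/\ `|u m * a0| <= r / 2, 0 < u m * b0 & u m * b0 <= r / 2] ->
    `|D1 m - G * (n k).1| <= C * (`|a0| + 2 * b0) * u m /\
    `|D2 m - G * (n k).2| <= C * (`|a0| + 2 * b0) * u m.
  move=> [h1 h2 h3]; have [k1 k2] := HG h1 h2 h3; rewrite -xE in k1 k2.
  have E1 : D1 m - G * (n k).1 = (dir_deriv (n k) f (radial p A B (1 - u m, t)) - G) * (n k).1
      + dir_deriv (perp (n k)) f (radial p A B (1 - u m, t)) * (n k).2.
    rewrite /dir_deriv /= -/(D1 m) -/(D2 m) -[D1 m in LHS]mulr1 -n1 /dotp.
    by ring.
  have E2 : D2 m - G * (n k).2 = (dir_deriv (n k) f (radial p A B (1 - u m, t)) - G) * (n k).2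
      + - dir_deriv (perp (n k)) f (radial p A B (1 - u m, t)) * (n k).1.
    rewrite /dir_deriv /= -/(D1 m) -/(D2 m) -[D2 m in LHS]mulr1 -n1 /dotp.
    by ring.
  have le1 (x y : R) : `|y| <= 1 -> `|x * y| <= `|x|.
    by move=> y1; rewrite normrM ler_piMr.
  have bd : C * (`|u m * a0| + u m * b0) + C * (u m * b0) = C * (`|a0| + 2 * b0) * u m.
    by rewrite normrM (gtr0_norm (u0 m)); ring.
  rewrite E1 E2 -bd; split; apply: le_trans (ler_normD _ _) _; apply: lerD.
  - by apply: le_trans (le1 _ _ n1le.1) _.
  - by apply: le_trans (le1 _ _ n1le.2) _.
  - by apply: le_trans (le1 _ _ n1le.2) _.
  - by apply: le_trans (le1 _ _ n1le.1) _; rewrite normrN.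
have c1 : D1 @ \oo --> G * (n k).1.
  by apply: (cvg_le_linear ucv); apply: filterS small => m sm; have [h h'] := key m sm; first [exact: h|exact: h'].
have c2 : D2 @ \oo --> G * (n k).2.
  by apply: (cvg_le_linear ucv); apply: filterS small => m sm; have [h h'] := key m sm; first [exact: h|exact: h'].
have c0 : (fun m => f (radial p A B (1 - u m, t))) @ \oo --> (0 : R).
  apply: (@cvg_le_linear _ _ _ _ (Cd * b0) ucv); apply: filterS small => m [h1 h2 h3].
  have Q : closed_polygon v n (frame_point x0 (n k) (u m * a0) (u m * b0)).
    by apply: (HF _ _ _ (ltW h2) _).1; lra.
  rewrite subr0 xE; apply: le_trans (HCd k _ Q) _.
  have [_ x0k _] := FB; have [_ bE] := frame_point_coord x0 (u m * a0) (u m * b0) n1.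
  rewrite (_ : dotp _ _ = dotp (frame_point x0 (n k) (u m * a0) (u m * b0) - x0) (n k)
    + dotp (x0 - v k) (n k)); last by plane_ring.
  by rewrite bE x0k addr0 mulrA mulrAC.
have cs : (fun m => 1 - u m) @ \oo --> (1 : R).
  by rewrite -[X in _ --> X](subr0 1); apply: cvgB => //; exact: cvg_cst.
have := @cvg_flux_s _ (det2 A B) lambda B W _ _ _ _ _ _ _ _ cs c0 c1 c2.
rewrite (_ : flux_s _ _ _ _ _ _ _ _ = det2 A B * G ^+ 2) //.
have WB : det2 W B = det2 A B by rewrite /W /det2; plane_ring.
have E : (W.1 * (n k).1 + W.2 * (n k).2) * ((n k).1 * B.2 - (n k).2 * B.1) = det2 A B.
  rewrite -WB -[RHS]mulr1 -n1 -[RHS]subr0 -(mulr0 (W.1 * (n k).2 - W.2 * (n k).1)) -nB.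
  by rewrite /det2 /dotp; ring.
have n1' : (n k).1 * (n k).1 + (n k).2 * (n k).2 = 1 by exact: n1.
rewrite /flux_s !mulr1 mul1r mulr0 mulr0 sub0r.
have -> : 2 * (W.1 * (G * (n k).1) + W.2 * (G * (n k).2)) * (G * (n k).1 * B.2 - G * (n k).2 * B.1)
   = 2 * G ^+ 2 * ((W.1 * (n k).1 + W.2 * (n k).2) * ((n k).1 * B.2 - (n k).2 * B.1)).
  by ring.
rewrite E.
have -> : G * (n k).1 * (G * (n k).1) + G * (n k).2 * (G * (n k).2) =
  G ^+ 2 * ((n k).1 * (n k).1 + (n k).2 * (n k).2) by ring.
by rewrite n1'; ring.
Qed.

End BoundaryLimits.

(** * Passage to the limit *)

Lemma continuous_flux_t (R : realType) (T : topologicalType) (W : plane R)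
    (s g1 g2 : T -> R) (x : T) :
  {for x, continuous s} -> {for x, continuous g1} -> {for x, continuous g2} ->
  {for x, continuous (fun y => flux_t (s y) W (g1 y) (g2 y))}.
Proof. by rewrite /flux_t => *; continuous_poly. Qed.

Lemma ray_flux_continuous (R : realType) (f : plane R -> R) (p W : plane R) (s : R) :
  {for p + s *: W, continuous (partial1 f)} ->
  {for p + s *: W, continuous (partial2 f)} ->
  {for s, continuous (ray_flux f p W)}.
Proof.
move=> c1 c2; have cr : {for s, continuous (fun y : R => p + y *: W)}.
  by apply: cvgD; [exact: cvg_cst|apply: cvgZr_tmp; exact: cvg_id].
have cg (g : plane R -> R) : {for p + s *: W, continuous g} ->
    {for s, continuous (fun y : R => g (p + y *: W))}.
  by move=> cg; apply: (@continuous_comp _ _ _ (fun y : R => p + y *: W) g).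
have ci : {for s, continuous (fun y : R => y)} by exact: cvg_id.
have H := @continuous_flux_t R _ W _ _ _ s ci (cg _ c1) (cg _ c2).
rewrite /ray_flux. exact H.
Qed.

Lemma integralB_Rintegral d (T : measurableType d) (R : realType)
    (mu : {measure set T -> \bar R}) (D : set T) (f g : T -> R) : measurable D ->
  mu.-integrable D (EFin \o f) -> mu.-integrable D (EFin \o g) ->
  (\int[mu]_(x in D) (f x - g x)%:E = (Rintegral mu D f - Rintegral mu D g)%:E)%E.
Proof.
move=> mD fi gi; rewrite integralB_EFin // EFinB.
by apply: (f_equal2 (fun a b => a - b)%E); rewrite /Rintegral fineK //;
  exact: integrable_fin_num.
Qed.

Section RellichSum.
Context {R : realType} (v nu : 'I_4 -> plane R) (p : plane R) (K : R).
Hypothesis B : balanced_quadrilateral v p K.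
Hypothesis nuP : forall k, outward_unit_normal v k (nu k).
Let n k := - nu k.
Let w k : plane R := v (k + 1) - v k.
Let A k : plane R := v k - p.

Lemma radial_polygon k (s t : R) : 0 <= s -> s < 1 -> 0 <= t -> t <= 1 ->
  polygon v n (radial p (A k) (w k) (s, t)).
Proof.
move=> s0 s1 t0 t1 j; have [_ [c c0 E]] := outward_normal_side_coord B (nuP j).
rewrite /n E mulr_gt0 //.
have -> : radial p (A k) (w k) (s, t) = p + s *: ((v k + t *: w k) - p).
  by rewrite /radial /A; plane_eq.
rewrite (side_coord_ray _ _ _ B).
have [H _] : (forall j, 0 <= side_coord v K j (v k + t *: w k)) /\ exists j, side_coord v K j (v k + t *: w k) = 0.
  apply/(balanced_boundary B); exists k => //; exists t => //.
  by rewrite /= in_itv /= t0.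
by have := H j; nra.
Qed.

Lemma ray_polygon k (s : R) : 0 <= s -> s < 1 -> polygon v n (p + s *: A k).
Proof.
move=> s0 s1; have := @radial_polygon k s 0 s0 s1 (lexx _) ler01.
by rewrite /radial /= scale0r addr0.
Qed.

Context (lambda : R) (f : plane R -> R).
Hypothesis Sf : polygon_solution v n lambda f.

Lemma ray_flux_integrable k (S : R) : S < 1 ->
  (@lebesgue_measure R).-integrable `[0, S] (EFin \o ray_flux f p (A k)).
Proof.
move=> S1; apply: continuous_compact_integrable; first exact: segment_compact.
have cr (s : R) : s \in `[0%R, S]%classic -> {for s, continuous (ray_flux f p (A k))}.
  rewrite inE /= in_itv /= => /andP[s0 sS].
  have Q := ray_polygon k s0 (le_lt_trans sS S1).
  have [C _ _] := solution_C2 Sf; have [_ _ c1 c2] := C _ Q.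
  exact: (@ray_flux_continuous R f p (A k) s c1 c2).
by move: (ray_flux f p (A k)) cr => g cr; apply: continuous_in_subspaceT.
Qed.

(* The fluxes through the rays from [p] to the vertices cancel in pairs. *)
Lemma rellich_sum (S : R) : 0 < S -> S < 1 ->
  (\sum_(k < 4) \int[@lebesgue_measure R]_(t in `[0%R, 1%R])
      (sector_flux f lambda p (A k) (w k) (S, t))%:E =
   \sum_(k < 4) \int[@lebesgue_measure R]_(s in `[0%R, S])
      \int[@lebesgue_measure R]_(t in `[0%R, 1%R])
      (2 * lambda * K * s * f (radial p (A k) (w k) (s, t)) ^+ 2)%:E)%E.
Proof.
move=> S0 S1.
pose J k := Rintegral (@lebesgue_measure R) `[0%R, S] (ray_flux f p (A k)).
have D k : (\int[@lebesgue_measure R]_(s in `[0%R, S])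
    (ray_flux f p (A k + w k) s - ray_flux f p (A k) s)%:E = (J (k + 1) - J k)%:E)%E.
  have -> : A k + w k = A (k + 1) by rewrite /A /w; plane_eq.
  by apply: integralB_Rintegral => //; exact: ray_flux_integrable.
move: J D => J D; have split (F G : 'I_4 -> \bar R) : (\sum_k G k = 0 -> \sum_k (F k + G k) = \sum_k F k)%E.
  by move=> G0; rewrite big_split /= G0 adde0.
transitivity (\sum_(k < 4) (\int[@lebesgue_measure R]_(t in `[0%R, 1%R])
      (sector_flux f lambda p (A k) (w k) (S, t))%:E +
   \int[@lebesgue_measure R]_(s in `[0%R, S])
     (ray_flux f p (A k + w k) s - ray_flux f p (A k) s)%:E))%E.
  apply: esym; apply: split; rewrite (eq_bigr _ (fun k _ => D k)) sumEFin sumrB.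
  have -> : \sum_k J (k + 1) = \sum_k J k by rewrite [RHS](reindex_inj (addIr 1)).
  by rewrite subrr.
apply: eq_bigr => k _.
have HU (s t : R) : 0 <= s -> s <= S -> 0 <= t -> t <= 1 ->
    polygon v n (radial p (A k) (w k) (s, t)).
  by move=> s0 sS t0 t1; apply: radial_polygon => //; exact: le_lt_trans S1.
have := sector_rellich (@polygon_open R v n) (solution_C2 Sf) (solution_eq Sf) S0 HU.
by rewrite (balanced_triangles B k : det2 (A k) (w k) = K).
Qed.

End RellichSum.

(** * Monotone convergence of the interior term *)

Lemma measurable_radial (R : realType) (p A B : plane R) :
  measurable_fun setT (radial p A B : mplane R -> mplane R).
Proof.
have c (a b e : R) : measurable_fun setT
    ((fun z => a + z.1 * (b + z.2 * e)) : mplane R -> measurableTypeR R).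
  apply: measurable_funD => //; apply: measurable_funM => //.
  by apply: measurable_funD => //; exact: measurable_funM.
rewrite (_ : radial p A B = fun z => (p.1 + z.1 * (A.1 + z.2 * B.1), p.2 + z.1 * (A.2 + z.2 * B.2))) //.
by apply: measurable_fun_pair; exact: c.
Qed.

Lemma measurable_radial_integral (R : realType) (p A B : plane R)
    (F : plane R -> \bar R) (i : interval R) :
  measurable_fun setT (F : mplane R -> \bar R) -> (forall x, (0 <= F x)%E) ->
  measurable_fun setT ((fun s => s%:E * \int[@lebesgue_measure R]_(t in [set` i])
      F (radial p A B (s, t)))%E : measurableTypeR R -> \bar R).
Proof.
move=> mF F0; apply: emeasurable_funM; first exact: measurable_funTS.
pose G : mplane R -> \bar R := (F \o radial p A B) \_ [set z | z.2 \in i].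
have mi : measurable ([set z | z.2 \in i] : set (mplane R)).
  rewrite (_ : [set z | _] = setT `*` [set` i]); last by apply/seteqP; split=> z //= [].
  exact: measurableX.
have mG : measurable_fun setT G.
  apply/(measurable_restrictT _ mi); apply: (@measurable_funTS _ _ _ _ _ (F \o radial p A B)).
  exact: measurableT_comp mF (@measurable_radial R p A B).
have G0 z : (0 <= G z)%E by rewrite /G patchE; case: ifP => _ /=; [exact: F0|].
have mH := measurable_fun_fubini_tonelli_F (m2 := @lebesgue_measure R) G mG G0.
apply: (eq_measurable_fun _ _ mH) => s _; rewrite /fubini_F [RHS]integral_mkcond.
apply: eq_integral => t _; rewrite /G !patchE.
by congr (if _ then _ else _); apply/idP/idP; rewrite !inE.
Qed.

(** With [m.+2], the factor [1 - shrink R m] lies strictly between [0] and [1] from [m = 0] on. *)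
Definition shrink (R : realType) (m : nat) : R := m.+2%:R^-1.

Lemma shrink_gt0 (R : realType) m : 0 < shrink R m.
Proof. by rewrite invr_gt0. Qed.

Lemma shrink_lt1 (R : realType) m : shrink R m < 1.
Proof. by rewrite invf_lt1 // ltr1n. Qed.

Lemma shrink_cvg (R : realType) : shrink R @ \oo --> (0 : R).
Proof. by have := @cvg_harmonic R; rewrite -(cvg_shiftS (@harmonic R)). Qed.

(** Monotone convergence along intervals that increase to [[0, 1[]. The sign of [q] is asked for
    [0 <= s] only, because of the factor [s] in [sector_mass]. *)
Lemma integral_shrink_cvg (R : realType) (q : R -> \bar R) :
  measurable_fun setT (q : measurableTypeR R -> \bar R) ->
  (forall s, 0 <= s -> (0 <= q s)%E) ->
  (fun m => \int[@lebesgue_measure R]_(s in `[0%R, (1 - shrink R m)%R]) q s)%E @ \oo -->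
    (\int[@lebesgue_measure R]_(s in `]0%R, 1%R[) q s)%E.
Proof.
move=> mq q0.
have mqD (D : set (measurableTypeR R)) : measurable_fun D (q : measurableTypeR R -> \bar R).
  exact: measurable_funTS.
pose F m : set (measurableTypeR R) := `[0%R, (1 - shrink R m)%R]%classic.
have ndF : {homo F : m k / (m <= k)%N >-> (m <= k)%O}.
  move=> m k mk; apply/subsetPset => s; rewrite /F /= !in_itv /= => /andP[-> h] /=.
  by apply: le_trans h _; rewrite lerD2l lerN2 lef_pV2 ?posrE ?ler_nat.
have mF m : measurable (F m) by exact: measurable_itv.
have qF m s : F m s -> (0 <= q s)%E.
  by rewrite /F /= in_itv /= => /andP[s0 _]; exact: q0.
have := ge0_nondecreasing_set_cvg_integral (mu := @lebesgue_measure R) ndF mF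
  (fun m => mqD (F m)) qF.
rewrite (_ : \bigcup_m F m = `[0%R, 1%R[%classic); last first.
  apply/seteqP; split=> [s [m _]|s]; rewrite /F /= !in_itv /= => /andP[s0 s1].
    by rewrite s0 /= (le_lt_trans s1) // ltrBlDr ltrDl shrink_gt0.
  have e0 : 0 < 1 - s by rewrite subr_gt0.
  have /cvgrPdist_lt/(_ _ e0)[m _ /(_ m (leqnn m))] := @shrink_cvg R.
  rewrite /= sub0r normrN gtr0_norm ?shrink_gt0 // => h.
  by exists m => //; rewrite /= in_itv /= s0 /=; lra.
by rewrite -(@integral_itv_obnd_cbnd R 0 (BLeft 1) q (mqD _)).
Qed.

Section SectorMass.
Context {R : realType} (v : 'I_4 -> plane R) (p : plane R) (K : R).
Hypothesis B : balanced_quadrilateral v p K.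
Variable F : plane R -> \bar R.
Hypothesis mF : measurable_fun setT (F : mplane R -> \bar R).
Hypothesis F0 : forall x, (0 <= F x)%E.
Hypothesis F1 : (\int[lebesgue2 R]_(x in quad_region v) F x = 1)%E.

(** Up to the factor [|K|], the density in [s] of the mass of [F] in the sector number [k]. *)
Definition sector_mass (k : 'I_4) (s : R) : \bar R :=
  (s%:E * \int[@lebesgue_measure R]_(t in `[0%R, 1%R[)
     F (radial p (v k - p) (v (k + 1) - v k) (s, t))%R)%E.

Let mq k : measurable_fun setT (sector_mass k : measurableTypeR R -> \bar R).
Proof. exact: measurable_radial_integral. Qed.

Let q0 k s : 0 <= s -> (0 <= sector_mass k s)%E.
Proof. by move=> s0; apply: mule_ge0; [rewrite lee_fin|exact: integral_ge0]. Qed.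

Let I k : \bar R := (\int[@lebesgue_measure R]_(s in `]0%R, 1%R[) sector_mass k s)%E.

Let I0 k : (0 <= I k)%E.
Proof.
by apply: integral_ge0 => s; rewrite /= in_itv /= => /andP[/ltW s0 _]; exact: q0.
Qed.

Let sumI : (\sum_k I k = (`|K|^-1)%:E)%E.
Proof.
have K0 : `|K| != 0 by rewrite normr_eq0 (balanced_neq0 B).
have : (`|K|%:E * \sum_k I k = 1)%E.
  by rewrite ge0_sume_distrr // -F1 (integral_quadrilateral B mF F0).
have : (0 <= \sum_k I k)%E by exact: sume_ge0.
(* The value [+oo] is excluded because [|K|] times the sum is [1]. *)
case: (\sum_k I k)%E => [x||] // x0; last first.
  by rewrite mulr_infty gtr0_sg ?mul1e // lt_neqAle eq_sym K0 normr_ge0.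
by rewrite -EFinM => -[xE]; rewrite -[x](mulKf K0) xE mulr1.
Qed.

Lemma sector_mass_limit :
  (fun m => \sum_(k < 4) \int[@lebesgue_measure R]_(s in `[0%R, (1 - shrink R m)%R])
     sector_mass k s)%E @ \oo --> (`|K|^-1)%:E.
Proof.
rewrite -sumI; apply: cvg_nnesum => k _; last first.
  by apply: integral_shrink_cvg; [exact: mq|exact: q0].
apply: nearW => m; apply: integral_ge0 => s; rewrite /= in_itv /= => /andP[s0 _].
exact: q0.
Qed.

Lemma sector_mass_integrable k m :
  (@lebesgue_measure R).-integrable `[0%R, (1 - shrink R m)%R] (sector_mass k).
Proof.
have mq' (D : set (measurableTypeR R)) : measurable_fun D (sector_mass k : measurableTypeR R -> \bar R).
  by apply: measurable_funTS; exact: mq.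
apply/integrableP; split; first exact: mq'.
apply: (@le_lt_trans _ _ (\int[@lebesgue_measure R]_(s in `[0%R, (1 - shrink R m)%R]) sector_mass k s)%E).
  rewrite le_eqVlt; apply/orP; left; apply/eqP/eq_integral.
  by move=> s; rewrite inE /= in_itv /= => /andP[s0 _]; rewrite gee0_abs ?q0.
apply: (@le_lt_trans _ _ (I k)).
  rewrite /I (@integral_itv_obnd_cbnd R 0 (BLeft 1) (sector_mass k) (mq' _)).
  apply: (ge0_subset_integral _ _ _ (mq' _)) => //.
    by move=> s; rewrite /= in_itv /= => /andP[s0 _]; exact: q0.
  move=> s; rewrite /= !in_itv /= => /andP[-> s1] /=.
  by rewrite (le_lt_trans s1) // ltrBlDr ltrDl shrink_gt0.
apply: (@le_lt_trans _ _ (\sum_k I k)%E); last by rewrite sumI ltry.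
by rewrite (bigD1 k) //= leeDl // sume_ge0.
Qed.

End SectorMass.

Lemma Lnorm2_eq1 (R : realType) (f : plane R -> R) (U : set (plane R)) :
  ('N[lebesgue2 R]_(2%:E) [EFin \o (f \_ U)] = 1)%E ->
  (\int[lebesgue2 R]_(x in U) (f x ^+ 2)%:E = 1)%E.
Proof.
rewrite unlock /= => H; rewrite integral_mkcond.
have I0 : (0 <= \int[lebesgue2 R]_x (`|(f \_ U) x| `^ 2)%:E)%E.
  by apply: integral_ge0 => x _; rewrite lee_fin powR_ge0.
transitivity (\int[lebesgue2 R]_x (`|(f \_ U) x| `^ 2)%:E)%E.
  apply: eq_integral => x _; rewrite powR_mulrn // real_normK ?num_real // !patchE.
  by case: ifP => //; rewrite expr0n.
rewrite -[LHS]poweRe1 // -[X in (_ `^ X)%E](@mulVf _ (2 : R)) ?pnatr_eq0 //.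
by rewrite poweRrM H poweR1r.
Qed.

Section RellichLimit.
Context {R : realType} (v nu : 'I_4 -> plane R) (p : plane R) (K : R).
Hypothesis B : balanced_quadrilateral v p K.
Hypothesis nuP : forall k, outward_unit_normal v k (nu k).
Let n k := - nu k.
Let w k : plane R := v (k + 1) - v k.
Let A k : plane R := v k - p.
Context (lambda : R) (f : plane R -> R).
Hypothesis Sf : polygon_solution v n lambda f.
Hypothesis f1 : (\int[lebesgue2 R]_(x in quad_region v) (f x ^+ 2)%:E = 1)%E.

Let F : plane R -> \bar R := (fun x => (f x ^+ 2)%:E) \_ (quad_region v).

Let QE : quad_region v = polygon v n.
Proof. exact: (inner_normal_polygon B nuP).1. Qed.

Let cf x : polygon v n x -> {for x, continuous f}.
Proof.
by move=> Qx; have [C _ _] := solution_C2 Sf; exact: C1_continuous (@polygon_open R v n) C Qx.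
Qed.

Let mF : measurable_fun setT (F : mplane R -> \bar R).
Proof.
have oQ : open (quad_region v) by rewrite QE; exact: polygon_open.
apply/(measurable_restrictT _ (open_measurable_plane oQ)).
apply: measurableT_comp => //.
apply: (@open_continuous_measurable_plane R _ (fun x => f x ^+ 2)) => // x.
by rewrite QE => /cf c; apply: continuous_for_mul.
Qed.

Let F0 x : (0 <= F x)%E.
Proof. by rewrite /F patchE; case: ifP => // _; rewrite lee_fin sqr_ge0. Qed.

Let F1 : (\int[lebesgue2 R]_(x in quad_region v) F x = 1)%E.
Proof. by rewrite -f1; apply: eq_integral => x xQ; rewrite /F patchE xQ. Qed.

(** For [s < 1] the curve of constant [s] lies in the open region, where [F] is [f ^+ 2]; the
    endpoint [t = 1] is a null set. *)
Let massE k (s : R) : 0 <= s -> s < 1 ->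
  (\int[@lebesgue_measure R]_(t in `[0%R, 1%R])
      (2 * lambda * K * s * f (radial p (A k) (w k) (s, t)) ^+ 2)%:E =
   (2 * lambda * K)%:E * sector_mass v p F k s)%E.
Proof.
move=> s0 s1.
have Qr (t : R) : 0 <= t -> t <= 1 -> polygon v n (radial p (A k) (w k) (s, t)).
  exact: (radial_polygon B nuP k s0 s1).
pose g (t : R) : R := f (radial p (A k) (w k) (s, t)) ^+ 2.
have cg (t : R) : t \in `[0%R, 1%R]%classic -> {for t, continuous g}.
  rewrite inE /= in_itv /= => /andP[t0 t1]; have c := cf (Qr _ t0 t1).
  have c1 : {for t, continuous (fun t : R => f (radial p (A k) (w k) (s, t)))}.
    apply: (@continuous_section2 _ (fun z => f (radial p (A k) (w k) z))).
    by apply: (@continuous_comp _ _ _ (radial p (A k) (w k)) f) => //; exact: radial_continuous.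
  exact: continuous_for_mul.
have ig : (@lebesgue_measure R).-integrable `[0%R, 1%R] (EFin \o g).
  apply: continuous_compact_integrable; first exact: segment_compact.
  by move: g cg => g cg; apply: continuous_in_subspaceT.
rewrite /sector_mass muleA -EFinM.
transitivity (\int[@lebesgue_measure R]_(t in `[0%R, 1%R])
    ((2 * lambda * K * s)%:E * (EFin \o g) t))%E.
  by apply: eq_integral => t _; rewrite /= -EFinM.
rewrite integralZl //; apply: (f_equal2 mule) => //.
rewrite -integral_itv_bndo_bndc; last first.
  by apply: measurable_funS (measurable_int _ ig) => //; apply: subset_itvl; rewrite bnd_simp.
apply: eq_integral => t; rewrite inE /= in_itv /= => /andP[t0 /ltW t1].
by rewrite /F patchE mem_set // QE; exact: Qr.
Qed.

(** In [rellich_sum] the right-hand side is [2 * lambda * K] times a mass that tends to [|K|^-1] by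
    the normalization of [f]. The signed [K] stems from the fluxes, the absolute value from the
    change of variables. *)
Lemma rellich_limit :
  (fun m => \sum_(k < 4) \int[@lebesgue_measure R]_(t in `[0%R, 1%R])
      (sector_flux f lambda p (A k) (w k) (1 - shrink R m, t))%:E)%E @ \oo -->
    (2 * lambda * K / `|K|)%:E.
Proof.
have E m : (\sum_(k < 4) \int[@lebesgue_measure R]_(t in `[0%R, 1%R])
      (sector_flux f lambda p (A k) (w k) (1 - shrink R m, t))%:E =
    (2 * lambda * K)%:E * \sum_(k < 4) \int[@lebesgue_measure R]_(s in `[0%R, (1 - shrink R m)%R])
     sector_mass v p F k s)%E.
  have S0 : 0 < 1 - shrink R m by rewrite subr_gt0 shrink_lt1.
  have S1 : 1 - shrink R m < 1 by rewrite ltrBlDr ltrDl shrink_gt0.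
  rewrite (rellich_sum B nuP Sf S0 S1) fin_num_sume_distrr //; last first.
    by move=> i j _ _; apply: fin_num_adde_defr; apply: integrable_fin_num => //; exact: (sector_mass_integrable B).
  apply: eq_bigr => k _; rewrite -integralZl //; last exact: (sector_mass_integrable B).
  apply: eq_integral => s; rewrite inE /= in_itv /= => /andP[s0 sS].
  by apply: massE => //; exact: le_lt_trans S1.
have fin : (2 * lambda * K)%:E \is a fin_num by [].
have := cvgeZl fin (sector_mass_limit B mF F0 F1); rewrite -EFinM.
by under eq_cvg do rewrite -E.
Qed.

End RellichLimit.

(** * Dominated convergence of the boundary term *)

Lemma continuous_flux_s (R : realType) (T : topologicalType) (K lambda : R)
    (B : plane R) (W : T -> plane R) (s g g1 g2 : T -> R) (x : T) :
  {for x, continuous s} -> {for x, continuous (fun y => (W y).1)} ->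
  {for x, continuous (fun y => (W y).2)} ->
  {for x, continuous g} -> {for x, continuous g1} -> {for x, continuous g2} ->
  {for x, continuous (fun y => flux_s K lambda B (s y) (W y) (g y) (g1 y) (g2 y))}.
Proof. by rewrite /flux_s => *; continuous_poly. Qed.

Lemma continuous_sector_flux (R : realType) (f : plane R -> R) (lambda : R)
    (p A B z : plane R) : {for radial p A B z, continuous f} ->
  {for radial p A B z, continuous (partial1 f)} ->
  {for radial p A B z, continuous (partial2 f)} ->
  {for z, continuous (sector_flux f lambda p A B)}.
Proof.
move=> cf c1 c2.
have cW (g : plane R -> R) : {for radial p A B z, continuous g} ->
    {for z, continuous (fun y => g (radial p A B y))}.
  by move=> cg; apply: (@continuous_comp _ _ _ (radial p A B) g) => //; exact: radial_continuous.
have g0 := cW _ cf; have g1 := cW _ c1; have g2 := cW _ c2.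
have k1 : {for z, continuous (fun y : plane R => y.1)} by exact: cvg_fst.
have k2 : {for z, continuous (fun y : plane R => y.2)} by exact: cvg_snd.
have W1 : {for z, continuous (fun y : plane R => A.1 + y.2 * B.1)} by continuous_poly.
have W2 : {for z, continuous (fun y : plane R => A.2 + y.2 * B.2)} by continuous_poly.
have H := @continuous_flux_s R _ (det2 A B) lambda B (fun y : plane R => A + y.2 *: B)
  _ _ _ _ z k1 W1 W2 g0 g1 g2.
by rewrite /sector_flux; exact H.
Qed.

Lemma flux_s_bound (R : realType) (K lambda : R) (A B : plane R) (M L s t g g1 g2 : R) :
  0 <= s -> s <= 1 -> 0 <= t -> t <= 1 -> `|g| <= M -> `|g1| <= L -> `|g2| <= L ->
  `|flux_s K lambda B s (A + t *: B) g g1 g2| <=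
    2 * ((`|A.1| + `|B.1|) * L + (`|A.2| + `|B.2|) * L) * (L * `|B.2| + L * `|B.1|) +
    `|K| * (`|lambda| * (M * M) + (L * L + L * L)).
Proof.
move=> s0 s1 t0 t1 gM h1 h2.
have M0 : 0 <= M := le_trans (normr_ge0 _) gM.
have L0 : 0 <= L := le_trans (normr_ge0 _) h1.
have le_mul (a b c d : R) : `|a| <= c -> `|b| <= d -> `|a * b| <= c * d.
  by move=> ac bd; rewrite normrM ler_pM.
have le_add (a b c d : R) : `|a| <= c -> `|b| <= d -> `|a + b| <= c + d.
  by move=> ac bd; apply: le_trans (ler_normD _ _) (lerD ac bd).
have le_sub (a b c d : R) : `|a| <= c -> `|b| <= d -> `|a - b| <= c + d.
  by move=> ac bd; apply/le_add => //; rewrite normrN.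
have le_W (a b : R) : `|a + t * b| <= `|a| + `|b|.
  by apply/le_add => //; rewrite normrM ger0_norm // ler_piMl.
have sq : `|s * s| <= 1 by rewrite -(mulr1 1); apply/le_mul; rewrite ger0_norm.
rewrite /flux_s -[leRHS]mul1r; apply/le_mul => //; apply/le_add.
  apply/le_mul; last by apply/le_sub; exact/le_mul.
  apply/le_mul; first by rewrite ger0_norm.
  by apply/le_add; apply/le_mul => //; exact/le_W.
by apply/le_mul => //; apply/le_sub; [apply/le_mul|apply/le_add] => //; exact/le_mul.
Qed.

Lemma cvge_sum_fin_num (R : realType) (I : Type) (r : seq I) (f : I -> nat -> \bar R)
    (l : I -> \bar R) : (forall k, l k \is a fin_num) ->
  (forall k, f k @ \oo --> l k) ->
  (fun m => \sum_(k <- r) f k m)%E @ \oo --> (\sum_(k <- r) l k)%E.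
Proof.
move=> fl fc; elim: r => [|k r IH].
  rewrite big_nil (_ : (fun m => _) = fun=> 0%E); first exact: cvg_cst.
  by apply/funext => m; rewrite big_nil.
rewrite big_cons (_ : (fun m => _) = fun m => (f k m + \sum_(j <- r) f j m)%E); last first.
  by apply/funext => m; rewrite big_cons.
by apply: cvgeD => //; exact: fin_num_adde_defr.
Qed.

Section BoundaryIdentity.
Context {R : realType} (v nu : 'I_4 -> plane R) (p : plane R) (K : R).
Hypothesis B : balanced_quadrilateral v p K.
Hypothesis nuP : forall k, outward_unit_normal v k (nu k).
Let n k := - nu k.
Let w k : plane R := v (k + 1) - v k.
Let A k : plane R := v k - p.
Context (lambda : R) (f : plane R -> R).
Hypothesis Sf : polygon_solution v n lambda f.

Let g k (t : R) : R := `|normal_derivative f (nu k) (v k + t *: w k)| ^+ 2.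

Lemma side_flux_limit k (t : R) : 0 < t -> t < 1 ->
  (fun m => sector_flux f lambda p (A k) (w k) (1 - shrink R m, t)) @ \oo --> K * g k t.
Proof.
move=> t0 t1; have [rho] := side_flat_boundary B nuP k t0 t1.
rewrite (_ : rho = 3 * (rho / 3)); last by rewrite mulrC divfK // pnatr_eq0.
move=> FB; have [G [C [C0 HG]]] := boundary_gradient Sf FB.
have -> : g k t = G ^+ 2.
  rewrite /g -(opprK (nu k)) (normal_derivative_limit Sf FB C0 HG).
  by rewrite normrN real_normK ?num_real.
have [_ nw _] := nuP k; have [_ [c c0 Ec]] := outward_normal_side_coord B (nuP k).
have x0E : v k + t *: w k = p + (A k + t *: w k) by rewrite /A; plane_eq.
have nB : dotp (n k) (w k) = 0 by rewrite -oppr0 -nw /n; plane_ring.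
(* Transversality: the side coordinate of [p] is [1], so [p] has the positive distance [c] to the
   line of the side. *)
have An : dotp (A k + t *: w k) (n k) < 0.
  have -> : dotp (A k + t *: w k) (n k) =
      - dotp (p - v k) (n k) + t * dotp (n k) (w k) by rewrite /A; plane_ring.
  rewrite nB mulr0 addr0 oppr_lt0 Ec /side_coord (balanced_triangles B k).
  by rewrite divff ?mulr1 // (balanced_neq0 B).
have := sector_flux_limit Sf FB HG x0E nB An (@shrink_gt0 R) (@shrink_cvg R).
by rewrite (balanced_triangles B k : det2 (A k) (w k) = K).
Qed.

(** The dominating constant: the gradient bound holds up to the vertices. *)
Lemma sector_flux_bounded k : exists C : R, forall s t : R,
  0 <= s -> s < 1 -> 0 <= t -> t <= 1 ->
  `|sector_flux f lambda p (A k) (w k) (s, t)| <= C.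
Proof.
have [M _ HM] := solution_bounded Sf; have [L _ HL] := solution_gradient_bounded Sf.
eexists => s t s0 s1 t0 t1.
have Q := radial_polygon B nuP k s0 s1 t0 t1.
apply: (@flux_s_bound _ _ _ _ _ M L) => //; first exact: ltW.
- exact/HM/polygonW.
- have := HL (1, 0) _ _ Q; rewrite /dir_deriv /= mul1r mul0r addr0; apply.
  by rewrite /dotp /= mulr0 addr0 mulr1.
- have := HL (0, 1) _ _ Q; rewrite /dir_deriv /= mul1r mul0r add0r; apply.
  by rewrite /dotp /= mulr0 add0r mulr1.
Qed.

(** Open, because [t = 0] and [t = 1] are vertices, where the gradient stays bounded but no limit
    has been established. *)
Let unit_open : set (measurableTypeR R) := `]0%R, 1%R[%classic.

Lemma measurable_sector_flux k (s : R) : 0 <= s -> s < 1 ->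
  measurable_fun unit_open
    (fun t : R => (sector_flux f lambda p (A k) (w k) (s, t))%:E).
Proof.
move=> s0 s1; pose h (t : R) := sector_flux f lambda p (A k) (w k) (s, t).
have ch (t : R) : t \in `[0%R, 1%R]%classic -> {for t, continuous h}.
  rewrite inE /= in_itv /= => /andP[t0 t1].
  have Q := radial_polygon B nuP k s0 s1 t0 t1.
  have [C _ _] := solution_C2 Sf; have [_ _ c1 c2] := C _ Q.
  have c0 := C1_continuous (@polygon_open R v n) C Q.
  apply: (@continuous_section2 _ (sector_flux f lambda p (A k) (w k))).
  exact: (@continuous_sector_flux R f lambda p (A k) (w k) (s, t) c0 c1 c2).
have ih : (@lebesgue_measure R).-integrable `[0%R, 1%R] (EFin \o h).
  apply: continuous_compact_integrable; first exact: segment_compact.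
  by move: h ch => h ch; apply: continuous_in_subspaceT.
by apply: measurable_funS (measurable_int _ ih) => //; apply: subset_itvW; rewrite bnd_simp.
Qed.

Let mu := @lebesgue_measure R.

(** Dominated convergence on an interval of finite length. Besides the limit it yields measurability
    and integrability of the squared normal derivative, as a pointwise limit of measurable
    fluxes. *)
Lemma side_flux_integral_limit k :
  mu.-integrable unit_open (fun t => (K * g k t)%:E) /\
  (fun m => \int[mu]_(t in `[0%R, 1%R])
      (sector_flux f lambda p (A k) (w k) (1 - shrink R m, t))%:E)%E @ \oo -->
    (\int[mu]_(t in unit_open) (K * g k t)%:E)%E.
Proof.
have S0 m : 0 <= 1 - shrink R m by rewrite subr_ge0 ltW ?shrink_lt1.
have S1 m : 1 - shrink R m < 1 by rewrite ltrBlDr ltrDl shrink_gt0.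
have mU : measurable unit_open by exact: measurable_itv.
pose h m (t : R) := (sector_flux f lambda p (A k) (w k) (1 - shrink R m, t))%:E.
have mh m : measurable_fun unit_open (h m) by exact: measurable_sector_flux.
have ch t : unit_open t -> h ^~ t @ \oo --> (K * g k t)%:E.
  rewrite /unit_open /= in_itv /= => /andP[t0 t1].
  by apply: cvg_EFin; [exact: nearW|exact: side_flux_limit].
have mg := @emeasurable_fun_cvg _ _ R unit_open h _ mh ch.
have [C HC] := sector_flux_bounded k.
have iC : mu.-integrable unit_open (EFin \o cst C).
  have i01 : mu.-integrable `[0%R, 1%R] (EFin \o cst C).
    apply: continuous_compact_integrable; first exact: segment_compact.
    by apply: continuous_subspaceT => x; exact: cvg_cst.
  by apply: integrableS i01 => //; apply: subset_itvW; rewrite bnd_simp.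
have [] := dominated_convergence mU mh mg _ iC _.
- exact: aeW.
- apply: aeW => t m; rewrite /unit_open /= in_itv /= => /andP[/ltW t0 /ltW t1].
  by rewrite lee_fin; exact: HC.
move=> ig _ cI; split => //.
rewrite (_ : (fun m => _) = fun m => (\int[mu]_(t in unit_open) h m t)%E) //.
by apply/funext => m; rewrite (integral_itv_bndoo true false (mh m)).
Qed.

Hypothesis f1 : (\int[lebesgue2 R]_(x in quad_region v) (f x ^+ 2)%:E = 1)%E.

(** Two evaluations of one limit: side by side it is [K] times the sum of the integrals, globally it
    is given by [rellich_limit]. Uniqueness of limits, then division by [K]. *)
Lemma boundary_identity :
  (\sum_(k < 4) \int[mu]_(t in `[0%R, 1%R]) (g k t)%:E = (2 * lambda / `|K|)%:E)%E.
Proof.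
have K0 := balanced_neq0 B.
have mU : measurable unit_open by exact: measurable_itv.
have ig k : mu.-integrable unit_open (fun t => (g k t)%:E).
  have := integrableZl mU K^-1 (side_flux_integral_limit k).1.
  by apply: eq_integrable => // t _; rewrite -EFinM mulKf.
pose I k := fine (\int[mu]_(t in unit_open) (g k t)%:E).
have IE k : (\int[mu]_(t in unit_open) (g k t)%:E = (I k)%:E)%E.
  by rewrite /I fineK //; exact: integrable_fin_num.
have KIE k : (\int[mu]_(t in unit_open) (K * g k t)%:E = (K * I k)%:E)%E.
  under eq_integral do rewrite EFinM.
  by rewrite integralZl // IE.
have c1 := rellich_limit B nuP Sf f1.
have E : (\sum_(k < 4) (K * I k)%:E = (2 * lambda * K / `|K|)%:E)%E.
  apply: (cvg_unique _ _ c1) => //; apply: cvge_sum_fin_num => // k.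
  by rewrite -KIE; exact: (side_flux_integral_limit k).2.
rewrite (eq_bigr (fun k => (I k)%:E)); last first.
  by move=> k _; rewrite (integral_itv_bndoo true false (measurable_int _ (ig k))).
move: E; rewrite !sumEFin -mulr_sumr => -[E]; congr (_%:E); apply: (mulfI K0).
by rewrite E; ring.
Qed.

End BoundaryIdentity.

Theorem corollary2 (R : realType) (v nu : 'I_4 -> plane R) (lambda : R)
    (f : plane R -> R)
    (Qsimple : simple_quadrilateral v)
    (Qdiag : exists i : 'I_4,
       quad_diagonal v i (midpoint (v (i + 1)) (v (i + 3))))
    (nuP : forall i, outward_unit_normal v i (nu i))
    (fP : dirichlet_solution v lambda f)
    (f1 : ('N[lebesgue2 R]_(2%:E) [EFin \o (f \_ (quad_region v))] = 1)%E) :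
  exists p : plane R,
    (forall i j, signed_area (v i) (v (i + 1)) (nu i) p =
                 signed_area (v j) (v (j + 1)) (nu j) p) /\
    (\sum_(i < 4)
        (side_integral v i (fun x => `|normal_derivative f (nu i) x| ^+ 2)%R
         * ((side_length v i)^-1)%:E)
     = (4 * lambda / area (quad_region v))%:E)%E.
Proof.
have [i0 Hd] := Qdiag.
have [p [u [w [kappa /kite_balanced B]]]] := quadrilateral_kite Qsimple Hd.
set K := det2 u w in B; have K0 := balanced_neq0 B.
exists p; split.
(* The sign is [1] since [p] lies on the inner side of every line, and the area is [|K|] times that
   of the standard triangle, for every [k]. *)
- suff H k : signed_area (v k) (v (k + 1)) (nu k) p =
      `|K| * fine (lebesgue2 R [set z | [/\ 0 <= z.1, 0 <= z.2 & z.1 + z.2 <= 1]]).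
    by move=> i j; rewrite !H.
  have [_ [c c0 Ec]] := outward_normal_side_coord B (nuP k).
  have KE := balanced_triangles B k.
  have dE : det2 (v (k + 1) - v k) (p - v k) = K.
    by rewrite -KE /det2; plane_ring.
  rewrite /signed_area triangle_area dE //.
  have -> : - dotp (p - v k) (nu k) = c.
    have -> : - dotp (p - v k) (nu k) = dotp (p - v k) (- nu k) by plane_ring.
    by rewrite Ec /side_coord KE divff // mulr1.
  by rewrite gtr0_sg // mul1r.
- have Sf := dirichlet_polygon_solution B nuP fP.
  have -> : (4 * lambda / area (quad_region v))%:E = (2 * lambda / `|K|)%:E.
    rewrite (quad_region_area B); congr (_%:E); field.
    by rewrite normr_eq0.
  rewrite -(boundary_identity B nuP Sf (Lnorm2_eq1 f1)); apply: eq_bigr => k _.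
  (* A side of length zero would make [K] vanish. The length that comes from the parametrization
     then cancels the one in the denominator. *)
  have L0 : side_length v k != 0.
    apply: contra_neq K0 => /eqP; rewrite sqrtr_eq0 /dotp -!expr2 => L.
    have [/eqP w1 /eqP w2] : (v (k + 1) - v k).1 ^+ 2 == 0 /\ (v (k + 1) - v k).2 ^+ 2 == 0.
      have := sqr_ge0 (v (k + 1) - v k).1; have := sqr_ge0 (v (k + 1) - v k).2.
      by split; rewrite eq_le; apply/andP; split => //; lra.
    move/eqP: w1; move/eqP: w2; rewrite !sqrf_eq0 => /eqP w2 /eqP w1.
    by rewrite -(balanced_triangles B k) /det2 w1 w2 !mulr0 subrr.
  by rewrite /side_integral muleAC -EFinM divff // mul1e.
Qed.
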